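(* Let $X\subset\mathbb{P}^3_{\mathbb{K}}$ be a smooth quartic and let $\ell\subset X$ be a line of the second kind with ramification type $R=2^2$, and let $\mathcal{R}=2P_1+2P_2$ be the ramification divisor of $\pi|_\ell$. (a) The quartic $X$ is given by Segre's construction (with respect to $\ell$) if and only if the line $\ell$ runs through the singular points of two singular fibers of Kodaira type $IV$ of the fibration $\pi$. (b) If the equivalent conditions of (a) are satisfied, then: (i) the surface $S_8$ defined by $(X,\ell)$ is a sextic that consists of the tangent planes $T_{P_1}X$, $T_{P_2}X$ and an (irreducible) ruled quartic $S_4$; (ii) the line $\ell$ is met by exactly six triplets of coplanar lines on $X$, that are contained in the planes $T_{P_1}X$, $T_{P_2}X$, and in four other planes $L_1,\dots,L_4$; (iii) the Segre decomposition of $X$ with respect to $\ell$ is unique and coincides with $$\lambda\cdot S_4+L_1\cdot L_2\cdot L_3\cdot L_4=0,\qquad\lambda\in\mathbb{K}^\times;$$ that is, $X$ is given by this equation, and for every Segre decomposition $S+\hat L_1\cdots\hat L_4$ of $X$ one has $S=S_4$ (as surfaces) and $\{\hat L_1,\dots,\hat L_4\}=\{L_1,\dots,L_4\}$; (iv) the fibration $\pi$ is of type $2\,IV\oplus4I_3\oplus4I_1$ (resp. $6\,IV$) if and only if $\operatorname{sing}(S_4)$ is a twisted cubic (resp. a line).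
   Context: $\mathbb{K}$ is an algebraically closed field of characteristic different from $2$ and $3$. The same symbol is used for a homogeneous polynomial and its zero set. Let $X\subset\mathbb{P}^3_{\mathbb{K}}$ be a smooth quartic containing a line $\ell$. The linear system $|\mathcal{O}_X(1)-\ell|$ gives an elliptic fibration $\pi:X\to\mathbb{P}^1$ whose fibers are the plane cubics residual to $\ell$ in $X\cap H$, for planes $H\supset\ell$. For $P\in\ell$, $F_P$ denotes the fiber of $\pi$ containing $P$, so $X\cap T_PX=\ell+F_P$. The line $\ell$ is of the second kind iff it is contained in the (Zariski) closure of the set of inflection points of the smooth fibers of $\pi$. The restriction $\pi|_\ell:\ell\to\mathbb{P}^1$ has degree $3$ and its ramification divisor $\mathcal{R}$ has degree $4$; ramification type $R=2^2$ means $\mathcal{R}=2P_1+2P_2$ with $P_1\ne P_2$. The type of the fibration is the complete list of its singular fibers with Kodaira types. Lines meeting $\ell$ are understood to be different from $\ell$. Segre's construction: $X$ is given by Segre's construction with respect to $\ell$ if $X$ is given by an equation $S+\hat L_1\cdots\hat L_4=0$ (a Segre decomposition), where the quartic $S$ is a union of a family of lines, each of which meets $\ell$, and the planes $\hat L_1,\dots,\hat L_4$ meet along $\ell$. The surface $S_8$ defined by $(X,\ell)$ is the (reduced) union of all lines in $$\mathfrak{S}_\ell=\{\tilde\ell\subset\mathbb{P}^3\text{ a line}:\ \exists P\in\ell\text{ with }\tilde\ell\subset T_PX\text{ and }i(\tilde\ell,F_P;P)\ge2\},$$ where $i(\tilde\ell,F_P;P)$ is the intersection multiplicity at $P$ of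 $\tilde\ell$ and the cubic $F_P$ inside the plane $T_PX$ (taken to be $\infty$ if $P\in\tilde\ell\subset F_P$); it is a hypersurface in $\mathbb{P}^3$. A ruled surface is a reduced, irreducible surface in $\mathbb{P}^3$ that is a union of a family of lines and is not a cone over a planar curve. *)

(* Defs.v *)
From mathcomp Require Import all_boot all_algebra.
From mathcomp Require Export finmap.
From mathcomp Require Export mpoly.

Set Implicit Arguments.
Unset Strict Implicit.
Unset Printing Implicit Defensive.

Import GRing.Theory.
Local Open Scope ring_scope.

(* Projective (n-1)-space is handled through its homogeneous coordinate vectors
   'rV[K]_n: a point is a nonzero vector up to scaling, a line is a vector
   subspace of dimension 2, a plane in P^3 a subspace of dimension 3.
   Linear forms are given by their coefficients, as column vectors. *)

Section ProjectiveGeometry.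
Variables (K : closedFieldType) (n : nat).
Implicit Types (p : {mpoly K[n]}) (u v w : 'rV[K]_n) (m : {vspace 'rV[K]_n}).

Definition linform (c : 'cV[K]_n) : {mpoly K[n]} := \sum_(i < n) c i 0 *: 'X_i.

Definition hyperplane (c : 'cV[K]_n) : {vspace 'rV[K]_n} :=
  lker (linfun (mulmxr c : 'rV[K]_n -> 'rV[K]_1)).

Definition gradient p v : 'cV[K]_n := \col_(i < n) (p^`M(i)).@[v 0].

Definition tangent_space p v : {vspace 'rV[K]_n} := hyperplane (gradient p v).

Definition on_hypersurface p v : Prop := p.@[v 0] = 0.

Definition subset_hypersurface m p : Prop := forall v, v \in m -> on_hypersurface p v.

Definition singular_point p v : Prop :=
  [/\ v != 0, on_hypersurface p v & gradient p v = 0].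

Definition smooth_hypersurface p : Prop := forall v, ~ singular_point p v.

Definition irreducible_mpoly p : Prop :=
  [/\ p != 0, p \isn't a GRing.unit
    & forall q r, p = q * r -> q \is a GRing.unit \/ r \is a GRing.unit].

Definition squarefree_mpoly p : Prop :=
  forall q r, p = q ^+ 2 * r -> q \is a GRing.unit.

(* the univariate polynomial p(v + 'X w) *)
Definition line_restriction p v w : {poly K} :=
  mmap (@polyC K) (fun i => (v 0 i)%:P + w 0 i *: 'X) p.

(* i(m, p; v) >= k, for a line m through the point v; since 'X^k %| 0 the
   multiplicity is infinite if m lies on the hypersurface p.  For p homogeneous
   the condition does not depend on the direction w in m, as long as w is not
   proportional to v, and for w proportional to v it only says p(v) = 0
   (when k > 0). *)
Definition inter_mult_ge p v m (k : nat) : Prop :=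
  [/\ v != 0, v \in m & forall w, w \in m -> 'X^k %| line_restriction p v w].

Definition inter_mult_eq p v m (k : nat) : Prop :=
  inter_mult_ge p v m k /\ ~ inter_mult_ge p v m k.+1.

Definition zariski_closure (A : 'rV[K]_n -> Prop) v : Prop :=
  forall (d : nat) p, p \is d.-homog ->
    (forall w, A w -> on_hypersurface p w) -> on_hypersurface p v.

End ProjectiveGeometry.

Section PlaneCubics.
Variable K : closedFieldType.
Implicit Types (g : {mpoly K[3]}) (u : 'rV[K]_3).

Definition inflection_point g u : Prop :=
  exists2 m : {vspace 'rV[K]_3}, \dim m = 2%N & inter_mult_ge g u m 3.

(* m is a line of the tangent cone at a double point u of g *)
Definition cone_line g u (m : {vspace 'rV[K]_3}) : Prop :=
  \dim m = 2%N /\ inter_mult_ge g u m 3.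

Definition node g u : Prop :=
  singular_point g u /\
  exists m1 m2, m1 != m2 /\ forall m, cone_line g u m <-> (m = m1 \/ m = m2).

Definition cusp g u : Prop :=
  singular_point g u /\ exists m1, forall m, cone_line g u m <-> m = m1.

(* the curves g and h meet in exactly one, resp. exactly two points *)
Definition meet_in_one_point g h : Prop :=
  exists2 u1, u1 != 0 & forall u, u != 0 ->
    (on_hypersurface g u /\ on_hypersurface h u <-> <[u]>%VS = <[u1]>%VS).

Definition meet_in_two_points g h : Prop :=
  exists u1 u2, [/\ u1 != 0, u2 != 0, <[u1]>%VS != <[u2]>%VS
    & forall u, u != 0 ->
        (on_hypersurface g u /\ on_hypersurface h u <->
           (<[u]>%VS = <[u1]>%VS \/ <[u]>%VS = <[u2]>%VS))].

Definition three_lines g (c1 c2 c3 : 'cV[K]_3) : Prop :=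
  [/\ [/\ c1 != 0, c2 != 0 & c3 != 0],
      uniq [:: hyperplane c1; hyperplane c2; hyperplane c3]
    & g = linform c1 * linform c2 * linform c3].

(* The Kodaira types that a plane cubic can have: the fibers of the other
   singular types have more than three components, counted with multiplicity. *)
Inductive kodaira := I1 | I2 | I3 | II | III | IV.

Definition kodaira_type g (k : kodaira) : Prop :=
  match k with
  | I1 => irreducible_mpoly g /\ exists u, node g u
  | II => irreducible_mpoly g /\ exists u, cusp g u
  | I2 => exists c q, [/\ c != 0, q \is 2.-homog, smooth_hypersurface q,
            g = linform c * q & meet_in_two_points (linform c) q]
  | III => exists c q, [/\ c != 0, q \is 2.-homog, smooth_hypersurface q,
            g = linform c * q & meet_in_one_point (linform c) q]
  | I3 => exists c1 c2 c3, three_lines g c1 c2 c3 /\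
            (hyperplane c1 :&: hyperplane c2 :&: hyperplane c3)%VS = 0%VS
  | IV => exists c1 c2 c3, three_lines g c1 c2 c3 /\
            (hyperplane c1 :&: hyperplane c2 :&: hyperplane c3)%VS != 0%VS
  end.

End PlaneCubics.

Section Fibration.
Variable K : closedFieldType.
Local Notation V := ('rV[K]_4).
Implicit Types (f : {mpoly K[4]}) (l m H : {vspace V}) (P v : V).

(* A linear parametrization u |-> u *m M of the plane H by 'rV[K]_3 that
   identifies the line l of H with the vanishing of the last coordinate. *)
Definition adapted_frame l H (M : 'M[K]_(3, 4)) : Prop :=
  [/\ row_free M,
      limg (linfun (mulmxr M : 'rV[K]_3 -> V)) = H
    & forall u : 'rV[K]_3, (u *m M \in l) = (u 0 ord_max == 0)].

Definition frame_preim (M : 'M[K]_(3, 4)) m : {vspace 'rV[K]_3} :=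
  (linfun (mulmxr M : 'rV[K]_3 -> V) @^-1: m)%VS.

Definition restriction f (M : 'M[K]_(3, 4)) : {mpoly K[3]} :=
  f \mPo [tuple \sum_(i < 3) M i j *: 'X_i | j < 4].

(* In the frame M, the cubic residual to l in the section of f by the plane H
   (the fiber over H of the fibration pi induced on the surface by the pencil of
   planes through l) has equation g.  The frame is unique up to a linear
   change of coordinates, so the properties of fibers defined below by means of
   some frame do not depend on it. *)
Definition fiber f l H (M : 'M[K]_(3, 4)) (g : {mpoly K[3]}) : Prop :=
  adapted_frame l H M /\ restriction f M = 'X_ord_max * g.

Definition singular_fiber f l H : Prop :=
  exists M g, fiber f l H M g /\ exists u, singular_point g u.

Definition fiber_type f l H (k : kodaira) : Prop :=
  exists M g, fiber f l H M g /\ kodaira_type g k.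

Definition fibration_type f l (t : seq kodaira) : Prop :=
  exists s : seq {vspace V},
    [/\ uniq s, size s = size t,
        forall H, H \in s <-> singular_fiber f l H
      & forall i, (i < size t)%N -> fiber_type f l (nth 0%VS s i) (nth IV t i)].

Definition IV_fiber_singular_on f l H : Prop :=
  exists M g, [/\ fiber f l H M g, kodaira_type g IV
    & exists2 u, singular_point g u & u *m M \in l].

Definition smooth_fiber_inflection f l v : Prop :=
  exists H M g u, [/\ fiber f l H M g, smooth_hypersurface g,
                      inflection_point g u & v = u *m M].

Definition second_kind f l : Prop :=
  forall v, v \in l -> zariski_closure (smooth_fiber_inflection f l) v.

(* The ramification index at P of the restriction of pi to l is the multiplicity
   of P in the pullback of the point pi(P), i.e. the intersection multiplicity
   at P of l and the fiber F_P, in the plane T_P X. *)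
Definition ramification_index f l P (e : nat) : Prop :=
  exists M g u, [/\ fiber f l (tangent_space f P) M g, u *m M = P
    & inter_mult_eq g u (frame_preim M l) e].

(* D P is the coefficient of the point P; the restriction of pi to l has degree
   3, so in characteristic different from 2 and 3 it is tamely ramified and the
   coefficient is e_P - 1. *)
Definition ramification_divisor f l (D : V -> nat) : Prop :=
  forall P, P \in l -> P != 0 -> ramification_index f l P (D P).+1.

Definition meets_line l m : Prop := m != l /\ (m :&: l)%VS != 0%VS.

Definition union_of_lines (A : {vspace V} -> Prop) (S : {mpoly K[4]}) : Prop :=
  forall v, v != 0 -> on_hypersurface S v ->
    exists m, [/\ \dim m = 2%N, v \in m, subset_hypersurface m S & A m].

Definition segre_decomposition f l (S : {mpoly K[4]}) (L : 4.-tuple 'cV[K]_4) :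
    Prop :=
  [/\ S \is 4.-homog /\ S != 0,
      union_of_lines (meets_line l) S,
      forall c, c \in L -> c != 0,
      (\bigcap_(c <- L) hyperplane c)%VS = l
    & exists2 a : K, a != 0 & a *: f = S + \prod_(c <- L) linform c].

Definition segre_construction f l : Prop := exists S L, segre_decomposition f l S L.

Definition segre_lines f l m : Prop :=
  exists P M g u,
    [/\ \dim m = 2%N, P \in l /\ P != 0, (m <= tangent_space f P)%VS,
        fiber f l (tangent_space f P) M g /\ u *m M = P
      & inter_mult_ge g u (frame_preim M m) 2].

Definition surface_S8 f l v : Prop := exists2 m, segre_lines f l m & v \in m.

(* the set A of points is a hypersurface of degree d, with reduced equation F *)
Definition reduced_surface (A : V -> Prop) (d : nat) (F : {mpoly K[4]}) : Prop :=
  [/\ F \is d.-homog, squarefree_mpoly F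
    & forall v, v != 0 -> (on_hypersurface F v <-> A v)].

(* the cone with vertex w over the plane curve q = 0 in H *)
Definition cone_over_plane_curve (S : {mpoly K[4]}) : Prop :=
  exists (H : {vspace V}) (w : V) (d : nat) (q : {mpoly K[4]}),
    [/\ \dim H = 3%N, w \notin H, q \is d.+1.-homog,
        (exists2 c, c \in H & q.@[c 0] != 0)
      & forall v, on_hypersurface S v <->
          exists c, [/\ c \in H, on_hypersurface q c & v \in (<[w]> + <[c]>)%VS]].

Definition ruled_surface (S : {mpoly K[4]}) : Prop :=
  [/\ irreducible_mpoly S, union_of_lines (fun _ => True) S
    & ~ cone_over_plane_curve S].

Local Open Scope fset_scope.

Definition coplanar_triplet f l (T : {fset {vspace V}}) : Prop :=
  [/\ #|` T| = 3%N,
      forall m, m \in T ->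
        [/\ \dim m = 2%N, subset_hypersurface m f & meets_line l m]
    & exists2 H : {vspace V}, \dim H = 3%N & forall m, m \in T -> (m <= H)%VS].

(* the coplanar triplets of lines meeting l are exactly size pl many, and the
   i-th one is contained in the i-th plane of pl *)
Definition triplets_in_planes f l (pl : seq {vspace V}) : Prop :=
  exists tr : seq {fset {vspace V}},
    [/\ uniq tr, size tr = size pl,
        forall T, T \in tr <-> coplanar_triplet f l T
      & forall i, (i < size pl)%N ->
          forall m, m \in nth fset0 tr i -> (m <= nth 0%VS pl i)%VS].

Definition is_line (A : V -> Prop) : Prop :=
  exists2 m : {vspace V}, \dim m = 2%N & forall v, v != 0 -> (A v <-> v \in m).

Definition is_twisted_cubic (A : V -> Prop) : Prop :=
  exists2 B : 'M[K]_4, B \in unitmx & forall v, v != 0 ->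
    (A v <-> exists a s t : K,
       v = a *: ((\row_(j < 4) (s ^+ (3 - j)%N * t ^+ j)) *m B)).

End Fibration.

(* Main.v *)
From HB Require Import structures.
Require Import Defs.
From mathcomp Require Import all_boot all_algebra ring.

Set Implicit Arguments.
Unset Strict Implicit.
Unset Printing Implicit Defensive.

Import GRing.Theory.
Local Open Scope ring_scope.

(** Choose coordinates (a, b, c, d) in which l is c = d = 0 and P1, P2 are the
    first two coordinate points.  Total ramification at P1 and P2 makes the part
    of f that is linear in (c, d) equal to c a^3 + d b^3, so that the fibre in the
    plane of slope (c : d) = (p : q), in coordinates (x, y, w) of that plane, cuts
    l in p x^3 + q y^3 = 0 ([normal_linear_part]).

    The inflection points of the smooth fibres are zeros of the Hessians of these
    fibres, and the Hessian of the fibre through a point is a form in the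
    coordinates of the point ([flex_form]).  If l is of the second kind, this form
    vanishes on l; since it depends there on the point and on the slope, and three
    points of l share a slope, it yields several relations between coefficients of f
    ([second_kind_relations]).  They say that a translation of a and b by linear
    forms in c and d brings f to the normal form
      c a^3 + d b^3 + a b B(c, d) + G(c, d),
    with B of degree two and G of degree four ([second_kind_normal_form]).  The
    fibres are then the cubics
      p x^3 + q y^3 + B(p, q) x y w + G(p, q) w^3,
    and for p q <> 0 such a cubic contains a line only if
    B(p, q)^3 + 27 p q G(p, q) = 0, when it is of the form X^3 + Y^3 + W^3 - 3 X Y W
    and splits into three lines.

    Both conditions of (a) say that B is a multiple 3 ga c d of c d.  A fibre of
    type IV with vertex on l lies over c = 0 or d = 0, and B vanishes there
    ([two_IV_fibers]).  In a Segre decomposition S has, up to a factor, the same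
    equation as f except for a constant term G' instead of G, where G - G' is the
    product of the planes.  As S is a union of lines meeting l, in each plane of
    the pencil the cubic residual to l contains a line; hence
    B^3 + 27 p q G' = 0 identically, so that B = 3 ga c d and
    G' = - ga^3 c^2 d^2 ([segre_relation], [segre_coefficients]).  This also gives
    uniqueness:
      S4 = c a^3 + d b^3 + 3 ga a b c d - ga^3 c^2 d^2,
    and the planes are the roots of G + ga^3 c^2 d^2.  Conversely, over the slope
    (s^3 : t^3) this S4 contains the line s x + t y = ga s^2 t^2 w, and these lines
    cover it ([ruling_through]); it is irreducible by Eisenstein's criterion.

    Smoothness of f makes the roots of G + ga^3 c^2 d^2 simple and different from
    c = 0 and d = 0: a double root would give a singular point of f on the singular
    locus of S4 ([split_roots]).  So there are exactly six planes with a split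
    fibre, which carry the six triplets ([triplets_of_slopes]).  The tangent to the
    fibre at a point of l other than P1 and P2 is one of the lines of S4, while in
    the tangent planes at P1 and P2 every line through that point is admitted;
    this describes S8 ([reduced_surface_S8]).

    If ga = 0, all the six split fibres consist of concurrent lines, and S4 is
    singular along the line a = b = 0.  If ga <> 0, only those over c = 0 and d = 0
    do, the four other ones are triangles, and four nodal cubics appear over the
    roots of G; the singular locus of S4 is a twisted cubic.  The number of
    singular fibres tells the two cases apart, and so does the singular locus
    ([fibration_types_singular_locus]). *)

(** * Polynomials over an algebraically closed field *)

Section ClosedFieldPolynomials.
Variable K : closedFieldType.

Lemma closed_field_distinct (N : nat) :
  exists s : seq K, uniq s /\ size s = N.
Proof.
elim: N => [|N [s [us ss]]]; first by exists [::].
have : \prod_(a <- s) ('X - a%:P) != 0 :> {poly K}.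
  by rewrite monic_neq0 // monic_prod_XsubC.
case/closed_nonrootP => x; rewrite root_prod_XsubC => xs.
by exists (x :: s); rewrite /= xs us ss.
Qed.

Lemma horner_ext (p q : {poly K}) :
  (forall t, t != 0 -> p.[t] = q.[t]) -> p = q.
Proof.
move=> pq; apply/eqP; rewrite -subr_eq0; apply/negPn/negP => nz.
have : (p - q) * 'X != 0 by rewrite mulf_neq0 ?polyX_eq0.
case/closed_nonrootP => x; rewrite rootM rootX negb_or => /andP[rx x0].
by case/negP: rx; rewrite rootE hornerD hornerN pq // subrr.
Qed.

Lemma coef_eq0_of_horner (s : seq K) :
  (forall t, t != 0 -> (Poly s).[t] = 0) -> forall i, s`_i = 0.
Proof.
move=> h i; rewrite -coef_Poly; have -> : Poly s = 0; last by rewrite coef0.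
by apply: horner_ext => t t0; rewrite h // horner0.
Qed.

Lemma horner_eq0_idomain (R : idomainType) (iota : {rmorphism K -> R})
    (p : {poly R}) : (forall t, p.[iota t] = 0) -> p = 0.
Proof.
move=> h; have [s [us ss]] := closed_field_distinct (size p).
apply: (@roots_geq_poly_eq0 _ p [seq iota t | t <- s]).
- by apply/allP => _ /mapP[t _ ->]; rewrite rootE h.
- by rewrite map_inj_uniq //; apply: fmorph_inj.
- by rewrite size_map ss.
Qed.

Lemma root_of_power (n : nat) (a : K) : (0 < n)%N -> exists x, x ^+ n = a.
Proof.
case: n => // n _.
have sz : size ('X^(n.+1) - a%:P) != 1%N by rewrite size_XnsubC.
have [x] := closed_rootP _ sz; rewrite rootE !hornerE subr_eq0.
by move=> /eqP; exists x.
Qed.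

Lemma primitive_cube_root : 3%N \notin [pchar K] ->
  exists om : K, om ^+ 2 + om + 1 = 0 /\ om != 1.
Proof.
move=> ch3.
have sz : size (Poly [:: 1; 1; 1] : {poly K}) = 3%N.
  by rewrite (PolyK (c := 0)) //= oner_eq0.
have [x rx] : exists x, root (Poly [:: 1; 1; 1] : {poly K}) x.
  by apply/closed_rootP; rewrite sz.
have {}rx : x ^+ 2 + x + 1 = 0.
  move: rx; rewrite rootE horner_Poly /= mul0r add0r => /eqP <-; ring.
exists x; split => //; apply/negP => /eqP x1; case/negP: ch3.
by rewrite inE /=; apply/eqP; rewrite -rx x1; ring.
Qed.

(** Four roots are enough to split the dehomogenised form, and the statement
    records them through Vieta's formulas, which is what computations need. *)
Lemma binary_quartic_roots (h0 h1 h2 h3 h4 : K) : h4 != 0 ->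
  exists r1 r2 r3 r4, [/\ h3 = - h4 * (r1 + r2 + r3 + r4),
    h2 = h4 * (r1 * r2 + r1 * r3 + r1 * r4 + r2 * r3 + r2 * r4 + r3 * r4),
    h1 = - h4 * (r1 * r2 * r3 + r1 * r2 * r4 + r1 * r3 * r4 + r2 * r3 * r4)
    & h0 = h4 * (r1 * r2 * r3 * r4)].
Proof.
move=> nz; pose p : {poly K} := Poly [:: h0; h1; h2; h3; h4].
have ps : polyseq p = [:: h0; h1; h2; h3; h4] by apply: (PolyK (c := 0)).
have [r pr] := closed_field_poly_normal p.
have lp : lead_coef p = h4 by rewrite lead_coefE ps.
have : size p = (size r).+1.
  by rewrite pr size_scale ?lp // size_prod_XsubC.
rewrite ps => -[]; case: r pr => [|r1 [|r2 [|r3 [|r4 []]]]] //= pr _.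
exists r1, r2, r3, r4.
have {}pr : p = Poly [:: h4 * (r1 * r2 * r3 * r4);
    - h4 * (r1 * r2 * r3 + r1 * r2 * r4 + r1 * r3 * r4 + r2 * r3 * r4);
    h4 * (r1 * r2 + r1 * r3 + r1 * r4 + r2 * r3 + r2 * r4 + r3 * r4);
    - h4 * (r1 + r2 + r3 + r4); h4].
  rewrite pr lp; apply: horner_ext => t _.
  rewrite horner_Poly /= !big_cons big_nil !(hornerZ, hornerM, hornerXsubC, hornerC); ring.
have cf i : p`_i = [:: h0; h1; h2; h3; h4]`_i by rewrite ps.
split.
- by have := cf 3%N; rewrite pr coef_Poly /= => <-.
- by have := cf 2%N; rewrite pr coef_Poly /= => <-.
- by have := cf 1%N; rewrite pr coef_Poly /= => <-.
- by have := cf 0%N; rewrite pr coef_Poly /= => <-.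
Qed.

End ClosedFieldPolynomials.

Section MultivariatePolynomials.
Variables (K : closedFieldType).

Lemma rmorph_mmap (n : nat) (R S T : comNzRingType) (f : {rmorphism R -> S})
    (phi : {rmorphism S -> T}) (h : 'I_n -> S) (p : {mpoly R[n]}) :
  phi (mmap f h p) = mmap (phi \o f) (phi \o h) p.
Proof.
rewrite /mmap rmorph_sum /=; apply: eq_bigr => m _.
rewrite rmorphM /=; congr (_ * _).
by rewrite /mmap1 rmorph_prod; apply: eq_bigr => i _; rewrite rmorphXn.
Qed.

Lemma eq_mmap (n : nat) (R : nzRingType) (S : nzRingType) (f f' : R -> S)
    (h h' : 'I_n -> S) (p : {mpoly R[n]}) :
  f =1 f' -> h =1 h' -> mmap f h p = mmap f' h' p.
Proof.
move=> ef eh; apply: eq_bigr => m _; rewrite ef; congr (_ * _).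
by apply: eq_bigr => i _; rewrite eh.
Qed.

Lemma mmap_mpolyX (n : nat) (p : {mpoly K[n]}) :
  mmap (@mpolyC n K) (fun i => 'X_i) p = p.
Proof.
rewrite -[RHS]comp_mpoly_id; apply: eq_mmap => // i.
by rewrite tnth_mktuple.
Qed.

Lemma mpoly_alg_ind (n : nat) (P : {mpoly K[n]} -> Prop) :
  (forall c, P c%:MP) -> (forall i, P 'X_i) ->
  (forall p q, P p -> P q -> P (p + q)) ->
  (forall p q, P p -> P q -> P (p * q)) -> forall p, P p.
Proof.
move=> PC PX PD PM; elim/mpolyind => [|c m p _ _ Pp]; first exact: (PC 0).
apply: (PD) => //; rewrite -mul_mpolyC; apply: (PM) => //.
rewrite mpolyXE_id; apply: (big_ind P); [exact: (PC 1) | exact: PM |].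
move=> i _; elim: (m i) => [|k IH]; first by rewrite expr0; apply: (PC 1).
by rewrite exprS; apply: (PM).
Qed.

(** Polynomials over an infinite field are determined by their values: the
    variables are restored one at a time, each time because a univariate
    polynomial over a domain has finitely many roots. *)
Lemma meval_eq0 (n : nat) (p : {mpoly K[n]}) :
  (forall v : 'rV[K]_n, p.@[v 0] = 0) -> p = 0.
Proof.
move=> p0; pose h (k : nat) (v : 'I_n -> K) (i : 'I_n) : {mpoly K[n]} :=
  if (i < k)%N then 'X_i else (v i)%:MP.
suff H k v : mmap (@mpolyC n K) (h k v) p = 0.
  rewrite -[p]mmap_mpolyX -[RHS](H n (fun=> 0)).
  by apply: eq_mmap => // i; rewrite /h ltn_ord.
elim: k v => [|k IH] v.
  have := p0 (\row_i v i); rewrite /meval => /(congr1 (@mpolyC n K)).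
  rewrite rmorph_mmap mpolyC0 => <-; apply: eq_mmap => // i /=.
  by rewrite /h ltn0 mxE.
pose hh (i : 'I_n) : {poly {mpoly K[n]}} := if (i < k)%N then ('X_i)%:P
  else if i == k :> nat then 'X else (v i)%:MP%:P.
pose Q := mmap (polyC \o @mpolyC n K) hh p.
have Q0 : Q = 0.
  apply: (@horner_eq0_idomain K _ (@mpolyC n K)) => t /=.
  rewrite -horner_evalE rmorph_mmap.
  rewrite -[RHS](IH (fun i => if i == k :> nat then t else v i)).
  apply: eq_mmap => i /=; rewrite horner_evalE; first by rewrite /= ?hornerC.
  rewrite /hh /h; case: ifP => // _; first by rewrite hornerC.
  by case: ifP => _; rewrite ?hornerX ?hornerC.
have [kn|nk] := ltnP k n; last first.
  rewrite -[RHS](IH v); apply: eq_mmap => // i; rewrite /h.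
  by rewrite !(leq_trans (ltn_ord i)) // leqW.
have : Q.['X_(Ordinal kn)] = 0 by rewrite Q0 horner0.
rewrite -horner_evalE rmorph_mmap => <-.
apply: eq_mmap => i /=; rewrite horner_evalE; first by rewrite /= ?hornerC.
rewrite /hh /h ltnS leq_eqVlt orbC; case: (i < k)%N => /=.
  by rewrite hornerC.
case: eqP => [ik|_]; last by rewrite hornerC.
by rewrite hornerX; congr 'X__; apply/val_inj.
Qed.

Lemma meval_inj (n : nat) (p q : {mpoly K[n]}) :
  (forall v : 'rV[K]_n, p.@[v 0] = q.@[v 0]) -> p = q.
Proof.
move=> pq; apply/eqP; rewrite -subr_eq0; apply/eqP/meval_eq0 => v.
by rewrite mevalB pq subrr.
Qed.

Lemma dhomog_meval (n d : nat) (p : {mpoly K[n]}) (t : K) (v : 'rV[K]_n) :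
  p \is d.-homog -> p.@[(t *: v) 0] = t ^+ d * p.@[v 0].
Proof.
move=> hp; rewrite !mevalE mulr_sumr; apply: eq_big_seq => m mp.
rewrite mulrCA; congr (_ * _).
under eq_bigr => i _ do rewrite mxE exprMn.
rewrite big_split /=; congr (_ * _); rewrite prodrXr; congr (_ ^+ _).
by rewrite -(dhomog_mf hp mp) /= mdegE.
Qed.

(** Evaluation determines coefficients, so every monomial m of p satisfies
    t ^ deg m = t ^ d for all t. *)
Lemma dhomogI (n d : nat) (p : {mpoly K[n]}) :
  (forall t (v : 'rV[K]_n), p.@[(t *: v) 0] = t ^+ d * p.@[v 0]) ->
  p \is d.-homog.
Proof.
move=> hp; apply/dhomogP => m mp.
have pt t : \sum_(k <- msupp p) (p@_k * t ^+ mdeg k) *: 'X_[k] = t ^+ d *: p.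
  apply: meval_inj => v; rewrite mevalZ -hp raddf_sum [RHS]mevalE.
  apply: eq_bigr => k _ /=; rewrite mevalZ mevalX -mulrA; congr (_ * _).
  rewrite mdegE -prodrXr -big_split /=.
  by apply: eq_bigr => i _; rewrite mxE exprMn.
have cf t : p@_m * t ^+ mdeg m = t ^+ d * p@_m.
  have := congr1 (mcoeff m) (pt t); rewrite mcoeffZ raddf_sum /= => <-.
  rewrite (bigD1_seq m) ?msupp_uniq //= big1 ?addr0.
    by rewrite mcoeffZ mcoeffX eqxx mulr1.
  by move=> k /negPf km; rewrite mcoeffZ mcoeffX km mulr0.
have : 'X^(mdeg m) = 'X^d :> {poly K}.
  apply: horner_ext => t _; rewrite !hornerXn.
  have := cf t; rewrite mulrC => /mulIf; apply.
  by rewrite -mcoeff_msupp.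
by move/(congr1 (size \o val)); rewrite /= !size_polyXn => -[].
Qed.

End MultivariatePolynomials.

(** * Linear forms, gradients and restrictions to lines *)

Section LinearForms.
Variables (K : closedFieldType) (n : nat).
Implicit Types (v w : 'rV[K]_n) (c : 'cV[K]_n) (p : {mpoly K[n]}).

Definition dot v c : K := (v *m c) 0 0.

Lemma dotDl v w c : dot (v + w) c = dot v c + dot w c.
Proof. by rewrite /dot mulmxDl mxE. Qed.

Lemma dotZl a v c : dot (a *: v) c = a * dot v c.
Proof. by rewrite /dot -scalemxAl mxE. Qed.

Lemma dotDr v c c' : dot v (c + c') = dot v c + dot v c'.
Proof. by rewrite /dot mulmxDr mxE. Qed.

Lemma dotZr a v c : dot v (a *: c) = a * dot v c.
Proof. by rewrite /dot -scalemxAr mxE. Qed.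

Lemma dot0r v : dot v 0 = 0.
Proof. by rewrite /dot mulmx0 mxE. Qed.

Lemma dot_delta (i : 'I_n) c : dot (delta_mx 0 i) c = c i 0.
Proof. by rewrite /dot -rowE mxE. Qed.

Lemma dot_ext c c' : (forall w, dot w c = dot w c') -> c = c'.
Proof.
by move=> h; apply/matrixP => i j; rewrite (ord1 j) -!dot_delta h.
Qed.

Lemma dot_neq0 c : c != 0 -> exists v, dot v c != 0.
Proof.
case/cV0Pn => i ci; exists (delta_mx 0 i); by rewrite dot_delta.
Qed.

Lemma meval_linform c v : (linform c).@[v 0] = dot v c.
Proof.
rewrite /linform raddf_sum /= /dot mxE; apply: eq_bigr => i _.
by rewrite mevalZ mevalXU mulrC.
Qed.

Lemma mem_hyperplane c v : (v \in hyperplane c) = (dot v c == 0).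
Proof.
rewrite /hyperplane memv_ker lfunE /= /dot.
apply/eqP/eqP => [-> | h]; first by rewrite mxE.
by apply/matrixP => i j; rewrite !ord1 h mxE.
Qed.

Lemma dim_hyperplane c : c != 0 -> \dim (hyperplane c) = n.-1.
Proof.
move=> c0; have [v vc] := dot_neq0 c0.
have := limg_ker_dim (linfun (mulmxr c : 'rV[K]_n -> 'rV[K]_1)) fullv.
rewrite capfv dimvf /dim /= mul1n -/(hyperplane c) => e.
suff im1 : (\dim (linfun (mulmxr c : 'rV[K]_n -> 'rV[K]_1) @: fullv) = 1)%N.
  by move: e; rewrite im1 addn1 => /(congr1 predn).
apply/eqP; rewrite eqn_leq; apply/andP; split.
  by apply: leq_trans (dimvS (subvf _)) _; rewrite dimvf /dim /= mul1n.
rewrite lt0n dimv_eq0; apply/negP => /eqP im0.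
have : linfun (mulmxr c : 'rV[K]_n -> 'rV[K]_1) v \in (0 : {vspace 'rV[K]_1})%VS.
  by rewrite -im0 memv_img ?memvf.
rewrite memv0 lfunE /= => /eqP e0; case/negP: vc.
by rewrite /dot e0 mxE.
Qed.

Lemma hyperplane_sub c c' : c != 0 -> c' != 0 ->
  (hyperplane c <= hyperplane c')%VS -> hyperplane c = hyperplane c'.
Proof.
move=> c0 c0' h; apply/eqP; rewrite eqEdim h.
by rewrite !dim_hyperplane ?leqnn.
Qed.

(** A subspace over an infinite field is not a finite union of proper
    subspaces. *)
Lemma subv_hyperplane_of_prod (m : {vspace 'rV[K]_n}) (s : seq 'cV[K]_n) :
  (forall v, v \in m -> \prod_(c <- s) dot v c = 0) ->
  exists2 c, c \in s & (m <= hyperplane c)%VS.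
Proof.
move=> h; apply/hasP; apply/negPn/negP => /hasPn hs.
suff [v vm] : exists2 v, v \in m & \prod_(c <- s) dot v c != 0.
  by rewrite h // eqxx.
elim: s hs {h} => [|c s IH] hs.
  by exists 0; rewrite ?mem0v // big_nil oner_eq0.
have [|v vm nz] := IH; first by move=> d ds; apply: hs; rewrite in_cons ds orbT.
have /subvPn[w wm] := hs c (mem_head _ _); rewrite mem_hyperplane => wc.
pose P := \prod_(d <- c :: s) ((dot v d)%:P + dot w d *: 'X).
have PE t : P.[t] = \prod_(d <- c :: s) dot (v + t *: w) d.
  rewrite horner_prod; apply: eq_bigr => d _.
  by rewrite !hornerE dotDl dotZl mulrC.
have P0 : P != 0.
  rewrite /P prodf_seq_neq0; apply/allP => d; rewrite in_cons => ds.
  apply/negP => /eqP e.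
  have e0 := congr1 (fun q : {poly K} => q`_0) e.
  have e1 := congr1 (fun q : {poly K} => q`_1) e.
  rewrite /= !coefE /= ?mulr0 ?addr0 ?add0r ?mulr1 in e0 e1.
  case/orP: ds => [/eqP dc|ds]; first by rewrite -dc e1 eqxx in wc.
  move: nz; rewrite (big_rem d) //= e0 mul0r eqxx; by [].
case/closed_nonrootP: P0 => t; rewrite rootE PE => nzt.
by exists (v + t *: w); rewrite // memvD ?memvZ.
Qed.

End LinearForms.

Section Restrictions.
Variables (K : closedFieldType) (n : nat).
Implicit Types (v w : 'rV[K]_n) (p : {mpoly K[n]}).

Lemma horner_line_restriction p v w t :
  (line_restriction p v w).[t] = p.@[(v + t *: w) 0].
Proof.
rewrite /line_restriction -horner_evalE rmorph_mmap; apply: eq_mmap => i /=.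
  by rewrite horner_evalE hornerC.
by rewrite horner_evalE !hornerE !mxE mulrC.
Qed.

Lemma line_restrictionE p v w (P : {poly K}) :
  (forall t, p.@[(v + t *: w) 0] = P.[t]) -> line_restriction p v w = P.
Proof. by move=> h; apply: horner_ext => t _; rewrite horner_line_restriction. Qed.

Lemma line_restrictionD p q v w :
  line_restriction (p + q) v w = line_restriction p v w + line_restriction q v w.
Proof.
by apply: line_restrictionE => t; rewrite hornerD !horner_line_restriction mevalD.
Qed.

Lemma line_restrictionM p q v w :
  line_restriction (p * q) v w = line_restriction p v w * line_restriction q v w.
Proof.
by apply: line_restrictionE => t; rewrite hornerM !horner_line_restriction mevalM.
Qed.

Lemma coef0_line_restriction p v w : (line_restriction p v w)`_0 = p.@[v 0].
Proof. by rewrite -horner_coef0 horner_line_restriction scale0r addr0. Qed.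

(** First-order Taylor expansion.  Gradients are computed through it below,
    from the values of a polynomial alone. *)
Lemma coef1_line_restriction p v w :
  (line_restriction p v w)`_1 = dot w (gradient p v).
Proof.
elim/mpoly_alg_ind: p => [c|i|p q IHp IHq|p q IHp IHq].
- have -> : gradient c%:MP v = 0.
    by apply/matrixP => i j; rewrite !mxE mderivC meval0.
  by rewrite (@line_restrictionE _ _ _ c%:P) ?coefC ?dot0r // => t; rewrite mevalC hornerC.
- rewrite (@line_restrictionE _ _ _ ((v 0 i)%:P + w 0 i *: 'X)); last first.
    by move=> t; rewrite mevalXU !mxE !hornerE mulrC.
  rewrite coefD coefC coefZ coefX /= mulr1 add0r /dot mxE (bigD1 i) //= big1.
    by rewrite addr0 mxE mderivX mnm1E eqxx mevalZ mevalX big1 ?mulr1 // => k _; rewrite mnmBE subnn expr0.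
  move=> k /negPf ki; rewrite mxE mderivX mnm1E eq_sym ki mevalZ mul0r mulr0 //.
- rewrite line_restrictionD coefD IHp IHq -dotDr; congr (dot _ _).
  by apply/matrixP => i j; rewrite !mxE mderivD mevalD.
- rewrite line_restrictionM coefM !big_ord_recl big_ord0 /= addr0 subn0 subnn.
  rewrite !coef0_line_restriction IHp IHq -!dotZr mulrC -dotZr -dotDr.
  congr (dot _ _); apply/matrixP => i j.
  by rewrite !mxE mderivM mevalD !mevalM addrC [in LHS]mulrC; congr (_ + _); rewrite mulrC.
Qed.

Lemma dvdXn_coef (k : nat) (p : {poly K}) :
  'X^k %| p <-> forall i, (i < k)%N -> p`_i = 0.
Proof.
split=> [/dvdpP[q ->] i ik|h]; first by rewrite coefMXn ik.
apply/dvdpP; exists (drop_poly k p).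
rewrite -{1}(poly_take_drop k p) (_ : take_poly k p = 0) ?add0r //.
apply/polyP => i; rewrite coef_take_poly coef0.
by case: ifP => // /h.
Qed.

End Restrictions.

(** The chain rule, read off from the restrictions to lines. *)
Lemma gradient_comp (K : closedFieldType) (k n : nat) (g : {mpoly K[k]})
    (p : {mpoly K[n]}) (T : 'M[K]_(k, n)) :
  (forall u : 'rV_k, g.@[u 0] = p.@[(u *m T) 0]) ->
  forall u, gradient g u = T *m gradient p (u *m T).
Proof.
move=> h u; apply: dot_ext => w.
rewrite -coef1_line_restriction [RHS]/dot mulmxA -/(dot (w *m T) _).
rewrite -coef1_line_restriction.
suff -> : line_restriction g u w = line_restriction p (u *m T) (w *m T) by [].
apply: line_restrictionE => t; rewrite horner_line_restriction h.
by rewrite mulmxDl -scalemxAl.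
Qed.

Section LinearSubstitution.
Variables (K : closedFieldType) (k n : nat).

Definition lin_subst (T : 'M[K]_(k, n)) (p : {mpoly K[n]}) : {mpoly K[k]} :=
  p \mPo [tuple \sum_(i < k) T i j *: 'X_i | j < n].

Lemma meval_lin_subst (T : 'M[K]_(k, n)) (p : {mpoly K[n]}) (u : 'rV[K]_k) :
  (lin_subst T p).@[u 0] = p.@[(u *m T) 0].
Proof.
rewrite /lin_subst comp_mpoly_meval; apply: meval_eq => j.
rewrite tnth_mktuple raddf_sum /= mxE; apply: eq_bigr => i _.
by rewrite mevalZ mevalXU mulrC.
Qed.

End LinearSubstitution.

(** * Coordinates adapted to a pencil of planes, and the fibres over it *)

Section Rows.
Variable K : comNzRingType.

Definition row3 (x y w : K) : 'rV[K]_3 := \row_j [:: x; y; w]`_j.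
Definition row4 (a b c d : K) : 'rV[K]_4 := \row_j [:: a; b; c; d]`_j.
Definition col3 (x y w : K) : 'cV[K]_3 := (row3 x y w)^T.

Lemma row3_surj (u : 'rV[K]_3) : exists x y w, u = row3 x y w.
Proof.
exists (u 0 (@Ordinal 3 0 isT)), (u 0 (@Ordinal 3 1 isT)), (u 0 (@Ordinal 3 2 isT)).
apply/matrixP => i j; rewrite (ord1 i) mxE.
by case: j => [[|[|[|//]]] h] /=; congr (u 0 _); apply/val_inj.
Qed.

Lemma row4_surj (v : 'rV[K]_4) : exists a b c d, v = row4 a b c d.
Proof.
exists (v 0 (@Ordinal 4 0 isT)), (v 0 (@Ordinal 4 1 isT)),
  (v 0 (@Ordinal 4 2 isT)), (v 0 (@Ordinal 4 3 isT)).
apply/matrixP => i j; rewrite (ord1 i) mxE.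
by case: j => [[|[|[|[|//]]]] h] /=; congr (v 0 _); apply/val_inj.
Qed.

Lemma row3D x y w x' y' w' :
  row3 x y w + row3 x' y' w' = row3 (x + x') (y + y') (w + w').
Proof. by apply/matrixP => i [[|[|[|//]]] h]; rewrite !mxE. Qed.

Lemma row4D a b c d a' b' c' d' :
  row4 a b c d + row4 a' b' c' d' = row4 (a + a') (b + b') (c + c') (d + d').
Proof. by apply/matrixP => i [[|[|[|[|//]]]] h]; rewrite !mxE. Qed.

Lemma row3Z t x y w : t *: row3 x y w = row3 (t * x) (t * y) (t * w).
Proof. by apply/matrixP => i [[|[|[|//]]] h]; rewrite !mxE. Qed.

Lemma row4Z t a b c d : t *: row4 a b c d = row4 (t * a) (t * b) (t * c) (t * d).
Proof. by apply/matrixP => i [[|[|[|[|//]]]] h]; rewrite !mxE. Qed.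

Lemma row3_inj x y w x' y' w' :
  row3 x y w = row3 x' y' w' -> [/\ x = x', y = y' & w = w'].
Proof.
move=> e; have h (j : 'I_3) := congr1 (fun u : 'rV[K]_3 => u 0 j) e.
move: (h (@Ordinal 3 0 isT)) (h (@Ordinal 3 1 isT)) (h (@Ordinal 3 2 isT)).
by rewrite !mxE.
Qed.

Lemma row4_inj a b c d a' b' c' d' :
  row4 a b c d = row4 a' b' c' d' -> [/\ a = a', b = b', c = c' & d = d'].
Proof.
move=> e; have h (j : 'I_4) := congr1 (fun u : 'rV[K]_4 => u 0 j) e.
move: (h (@Ordinal 4 0 isT)) (h (@Ordinal 4 1 isT)) (h (@Ordinal 4 2 isT))
  (h (@Ordinal 4 3 isT)).
by rewrite !mxE.
Qed.

Lemma row3_0 : row3 0 0 0 = 0.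
Proof. by apply/matrixP => i [[|[|[|//]]] h]; rewrite !mxE. Qed.

Lemma row4_0 : row4 0 0 0 0 = 0.
Proof. by apply/matrixP => i [[|[|[|[|//]]]] h]; rewrite !mxE. Qed.

Lemma row3_mul (n : nat) x y w (A : 'M[K]_(3, n)) :
  row3 x y w *m A = x *: row (@Ordinal 3 0 isT) A + y *: row (@Ordinal 3 1 isT) A
     + w *: row (@Ordinal 3 2 isT) A.
Proof.
apply/matrixP => i j; rewrite !mxE !big_ord_recl big_ord0 !mxE /= addr0 -addrA.
by congr (_ * A _ _ + (_ * A _ _ + _ * A _ _)); apply/val_inj.
Qed.

Lemma row4_mul (n : nat) a b c d (A : 'M[K]_(4, n)) :
  row4 a b c d *m A = a *: row (@Ordinal 4 0 isT) A + b *: row (@Ordinal 4 1 isT) A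
     + c *: row (@Ordinal 4 2 isT) A + d *: row (@Ordinal 4 3 isT) A.
Proof.
apply/matrixP => i j; rewrite !mxE !big_ord_recl big_ord0 !mxE /= addr0 -!addrA.
by congr (_ * A _ _ + (_ * A _ _ + (_ * A _ _ + _ * A _ _))); apply/val_inj.
Qed.

End Rows.

Section PlaneCurves.
Variable K : closedFieldType.

Lemma dot_row3 (x y w a b c : K) :
  dot (row3 x y w) (col3 a b c) = x * a + y * b + w * c.
Proof. by rewrite /dot mxE !big_ord_recl big_ord0 !mxE /= addr0 addrA. Qed.

Lemma col3_neq0 (a b c : K) :
  (col3 a b c != 0) = [|| a != 0, b != 0 | c != 0].
Proof.
rewrite -!negb_and; congr (~~ _); apply/eqP/and3P => [e|[/eqP-> /eqP-> /eqP->]].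
  have /row3_inj[-> -> ->] : row3 a b c = row3 0 0 0.
    by rewrite row3_0 -[LHS]trmxK -/(col3 a b c) e trmx0.
  by rewrite eqxx.
by rewrite /col3 row3_0 trmx0.
Qed.

Lemma row3_neq0 (a b c : K) :
  (row3 a b c != 0) = [|| a != 0, b != 0 | c != 0].
Proof. by rewrite -col3_neq0 /col3 trmx_eq0. Qed.

End PlaneCurves.

Section Coordinates.
Variables (K : closedFieldType) (E : 'M[K]_4).
Hypothesis hE : E \in unitmx.
Local Notation V := ('rV[K]_4).

Definition pt (a b c d : K) : V := row4 a b c d *m E.

Definition coordform (i : 'I_4) : 'cV[K]_4 := col i (invmx E).

Lemma pt_surj (v : V) : exists a b c d, v = pt a b c d.
Proof.
have [a [b [c [d e]]]] := row4_surj (v *m invmx E).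
by exists a, b, c, d; rewrite /pt -e mulmxKV.
Qed.

Lemma pt_inj a b c d a' b' c' d' :
  pt a b c d = pt a' b' c' d' -> [/\ a = a', b = b', c = c' & d = d'].
Proof.
by move=> /(congr1 (mulmxr (invmx E))); rewrite /= !mulmxK // => /row4_inj.
Qed.

Lemma ptD a b c d a' b' c' d' :
  pt a b c d + pt a' b' c' d' = pt (a + a') (b + b') (c + c') (d + d').
Proof. by rewrite /pt -mulmxDl row4D. Qed.

Lemma ptZ t a b c d : t *: pt a b c d = pt (t * a) (t * b) (t * c) (t * d).
Proof. by rewrite /pt scalemxAl row4Z. Qed.

Lemma pt0 : pt 0 0 0 0 = 0.
Proof. by rewrite /pt row4_0 mul0mx. Qed.

Lemma pt_eq0 a b c d :
  (pt a b c d == 0) = [&& a == 0, b == 0, c == 0 & d == 0].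
Proof.
apply/eqP/and4P => [|[/eqP-> /eqP-> /eqP-> /eqP->]]; last exact: pt0.
by rewrite -pt0 => /pt_inj[-> -> -> ->]; rewrite eqxx.
Qed.

Lemma dot_coordform a b c d i : dot (pt a b c d) (coordform i) = [:: a; b; c; d]`_i.
Proof. by rewrite /dot /pt /coordform colE mulmxA mulmxK // -colE !mxE. Qed.

Definition X0 := coordform (@Ordinal 4 0 isT).
Definition X1 := coordform (@Ordinal 4 1 isT).
Definition X2 := coordform (@Ordinal 4 2 isT).
Definition X3 := coordform (@Ordinal 4 3 isT).

Lemma dotX0 a b c d : dot (pt a b c d) X0 = a. Proof. exact: dot_coordform. Qed.
Lemma dotX1 a b c d : dot (pt a b c d) X1 = b. Proof. exact: dot_coordform. Qed.
Lemma dotX2 a b c d : dot (pt a b c d) X2 = c. Proof. exact: dot_coordform. Qed.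
Lemma dotX3 a b c d : dot (pt a b c d) X3 = d. Proof. exact: dot_coordform. Qed.
Definition dotX := (dotX0, dotX1, dotX2, dotX3).

Lemma form_neq0 (c : 'cV[K]_4) v : dot v c != 0 -> c != 0.
Proof. by apply: contraNneq => ->; rewrite dot0r. Qed.

Definition plane_form (p q : K) : 'cV[K]_4 := q *: X2 - p *: X3.
Definition plane (p q : K) : {vspace V} := hyperplane (plane_form p q).

Lemma dot_plane_form p q a b c d :
  dot (pt a b c d) (plane_form p q) = q * c - p * d.
Proof. by rewrite dotDr -scaleNr !dotZr !dotX mulNr. Qed.

Lemma mem_plane p q a b c d : (pt a b c d \in plane p q) = (q * c == p * d).
Proof. by rewrite mem_hyperplane dot_plane_form subr_eq0. Qed.

Lemma plane_form_neq0 p q : (p != 0) || (q != 0) -> plane_form p q != 0.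
Proof.
case/orP => nz.
  by apply: (@form_neq0 _ (pt 0 0 0 1)); rewrite dot_plane_form mulr0 sub0r mulr1 oppr_eq0.
by apply: (@form_neq0 _ (pt 0 0 1 0)); rewrite dot_plane_form mulr0 subr0 mulr1.
Qed.

Lemma dim_plane p q : (p != 0) || (q != 0) -> \dim (plane p q) = 3%N.
Proof. by move=> /plane_form_neq0 /dim_hyperplane. Qed.

Lemma mem_plane_scaled p q x y w : pt x y (w * p) (w * q) \in plane p q.
Proof. by rewrite mem_plane; apply/eqP; ring. Qed.

Lemma mem_planeP p q v : (p != 0) || (q != 0) ->
  v \in plane p q -> exists x y w, v = pt x y (w * p) (w * q).
Proof.
have [x [y [c [d ->]]]] := pt_surj v; rewrite mem_plane => pq /eqP e.
exists x, y; case/orP: pq => nz.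
  exists (c / p); congr pt; first by rewrite divfK.
  by rewrite mulrAC [c * q]mulrC e mulrC mulKf.
exists (d / q); congr pt; last by rewrite divfK.
by rewrite mulrAC [d * p]mulrC -e mulrC mulKf.
Qed.

Lemma eq_plane p q p' q' : (p' != 0) || (q' != 0) ->
  (plane p q == plane p' q') = ((p != 0) || (q != 0)) && (q * p' == p * q').
Proof.
move=> nz'; apply/eqP/andP => [e|[nz /eqP e]].
  have : pt 0 0 p' q' \in plane p q by rewrite e mem_plane mulrC.
  rewrite mem_plane => ->; split => //; apply/negPn/negP.
  rewrite -negb_and !negbK => /andP[/eqP p0 /eqP q0].
  have m a b : pt 0 0 a b \in plane p' q' by rewrite -e mem_plane p0 q0 !mul0r.
  move: (m 1 0) (m 0 1); rewrite !mem_plane !mulr1 !mulr0 => /eqP q'0.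
  by rewrite eq_sym => p'0; move: nz'; rewrite q'0 p'0 eqxx.
apply/eqP; rewrite eqEdim !dim_plane // leqnn andbT.
apply/subvP => v /(mem_planeP nz)[x [y [w ->]]]; rewrite mem_plane.
by apply/eqP; rewrite mulrCA -[in RHS]mulrCA; congr (_ * _); rewrite mulrC -e mulrC.
Qed.

Definition frame (p q : K) : 'M[K]_(3, 4) :=
  (\matrix_(i < 3) nth (0 : 'rV[K]_4) [:: row4 1 0 0 0; row4 0 1 0 0; row4 0 0 p q] i) *m E.

Lemma row3_frame p q x y w : row3 x y w *m frame p q = pt x y (w * p) (w * q).
Proof.
rewrite /frame mulmxA row3_mul !rowK /= !row4Z !row4D /pt.
by congr (row4 _ _ _ _ *m _); ring.
Qed.

Lemma frame_inj (p q : K) (u : 'rV[K]_3) : (p != 0) || (q != 0) -> u *m frame p q = 0 -> u = 0.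
Proof.
have [x [y [w ->]]] := row3_surj u; rewrite row3_frame => nz; rewrite -pt0.
case/pt_inj => -> -> /eqP + /eqP; rewrite !mulf_eq0.
case: (w =P 0) => [-> _ _|_ /= p0 q0]; first by rewrite row3_0.
by rewrite p0 q0 in nz.
Qed.

(** The line of equation al x + de y + ep w = 0 in the plane of slope (p : q),
    where the coordinates (x, y, w) are those of the frame of that plane. *)
Definition plane_line (p q al de ep : K) : {vspace V} :=
  (linfun (mulmxr (frame p q) : 'rV[K]_3 -> V) @: hyperplane (col3 al de ep))%VS.

Lemma mem_plane_line p q al de ep x y w : (p != 0) || (q != 0) ->
  (pt x y (w * p) (w * q) \in plane_line p q al de ep)
  = (al * x + de * y + ep * w == 0).
Proof.
move=> nz; apply/memv_imgP/eqP => [[u]|e].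
  have [x' [y' [w' ->]]] := row3_surj u.
  rewrite mem_hyperplane dot_row3 lfunE /= row3_frame => /eqP e /pt_inj[-> -> ep1 ep2].
  suff -> : w = w' by rewrite -e; ring.
  by case/orP: nz => nz; apply/(mulIf nz).
exists (row3 x y w); last by rewrite lfunE /= row3_frame.
by rewrite mem_hyperplane dot_row3 -e; apply/eqP; ring.
Qed.

Lemma plane_line_sub p q al de ep : (plane_line p q al de ep <= plane p q)%VS.
Proof.
apply/subvP => _ /memv_imgP[u _ ->]; have [x [y [w ->]]] := row3_surj u.
by rewrite lfunE /= row3_frame mem_plane_scaled.
Qed.

Lemma dim_plane_line p q al de ep : (p != 0) || (q != 0) ->
  col3 al de ep != 0 -> \dim (plane_line p q al de ep) = 2%N.
Proof.
move=> nz nz'; rewrite limg_dim_eq ?dim_hyperplane //.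
apply/eqP; rewrite -subv0; apply/subvP => u; rewrite memv_cap memv_ker lfunE /=.
by move=> /andP[_ /eqP /(frame_inj nz) ->]; rewrite mem0v.
Qed.

End Coordinates.

Section Fibers.
Variables (K : closedFieldType) (E : 'M[K]_4) (l : {vspace 'rV[K]_4}).
Hypothesis hE : E \in unitmx.
Hypothesis hl : forall a b c d, (pt E a b c d \in l) = (c == 0) && (d == 0).
Local Notation V := ('rV[K]_4).
Local Notation pt := (pt E).

Lemma plane_frame p q : (p != 0) || (q != 0) ->
  adapted_frame l (plane E p q) (frame E p q).
Proof.
move=> nz; split.
- by apply: inj_row_free => u /(frame_inj hE nz).
- apply/vspaceP => v; apply/memv_imgP/idP => [[u _ ->]|].
    have [x [y [w ->]]] := row3_surj u.
    by rewrite lfunE /= row3_frame mem_plane_scaled.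
  move=> /(mem_planeP hE nz)[x [y [w ->]]]; exists (row3 x y w); rewrite ?memvf //.
  by rewrite lfunE /= row3_frame.
- move=> u; have [x [y [w ->]]] := row3_surj u; rewrite row3_frame hl !mxE /=.
  by rewrite !mulf_eq0 -orb_andr -(negbK (_ && _)) negb_and nz orbF.
Qed.

Variables (f : {mpoly K[4]}) (ga : K -> K -> {mpoly K[3]}).
Hypothesis hf : forall p q x y w,
  f.@[(pt x y (w * p) (w * q)) 0] = w * (ga p q).@[(row3 x y w) 0].

Lemma plane_fiber p q : (p != 0) || (q != 0) ->
  fiber f l (plane E p q) (frame E p q) (ga p q).
Proof.
move=> nz; split; first exact: plane_frame.
apply: meval_inj => u; rewrite (meval_lin_subst _ f) mevalM mevalXU.
by have [x [y [w ->]]] := row3_surj u; rewrite row3_frame hf // [in RHS]mxE.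
Qed.

(** Every fibre, in whatever frame it is written, is one of the cubics ga p q
    up to a linear change of coordinates of its plane. *)
Lemma fiberP H M g : fiber f l H M g ->
  exists p q T, [/\ T \in unitmx, (p != 0) || (q != 0), M = T *m frame E p q,
     H = plane E p q & forall u : 'rV[K]_3, g.@[u 0] = (ga p q).@[(u *m T) 0]].
Proof.
case=> -[Mfree ME Ml] eg.
have rowl (i : 'I_3) : (i != ord_max) -> exists a b, row i M = pt a b 0 0.
  move=> im; have := Ml (delta_mx 0 i); rewrite -rowE mxE eqxx /= [ord_max == i]eq_sym (negPf im) eqxx.
  have [a [b [c [d ->]]]] := pt_surj hE (row i M).
  by rewrite hl => /andP[/eqP-> /eqP->]; exists a, b.
have [a0 [b0 e0]] := rowl (@Ordinal 3 0 isT) isT.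
have [a1 [b1 e1]] := rowl (@Ordinal 3 1 isT) isT.
have [a2 [b2 [p [q e2]]]] := pt_surj hE (row (@Ordinal 3 2 isT) M).
have nz : (p != 0) || (q != 0).
  have := Ml (delta_mx 0 (@Ordinal 3 2 isT)); rewrite -rowE e2 hl.
  have -> : ord_max = @Ordinal 3 2 isT by apply/val_inj.
  rewrite mxE !eqxx oner_eq0 => /negbT.
  by rewrite negb_and.
pose T : 'M[K]_3 := \matrix_(i < 3) nth (0 : 'rV[K]_3) [:: row3 a0 b0 0; row3 a1 b1 0; row3 a2 b2 1] i.
have eM : M = T *m frame E p q.
  apply/row_matrixP => i; rewrite row_mul rowK.
  case: i => [[|[|[|//]]] h] /=; rewrite row3_frame ?mul0r ?mul1r.
  - by rewrite -e0; congr (row _ M); apply/val_inj.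
  - by rewrite -e1; congr (row _ M); apply/val_inj.
  - by rewrite -e2; congr (row _ M); apply/val_inj.
have Tu : T \in unitmx.
  rewrite -row_free_unit; apply: inj_row_free => u uT.
  by apply/(row_free_inj Mfree); rewrite mul0mx eM mulmxA uT mul0mx.
exists p, q, T; split => //.
- have [_ <- _] := plane_frame nz; rewrite -ME.
  apply/vspaceP => v; apply/memv_imgP/memv_imgP => -[u _ ->].
    by exists (u *m T); rewrite ?memvf // !lfunE /= eM mulmxA.
  by exists (u *m invmx T); rewrite ?memvf // !lfunE /= eM [RHS]mulmxA mulmxKV.
- move=> u; rewrite -meval_lin_subst; congr (_.@[_]); apply: (@mulfI _ 'X_ord_max).
    by rewrite -msize_poly_eq0 msizeX mdeg1.
  rewrite -eg; apply: meval_inj => z; rewrite (meval_lin_subst _ f) eM mulmxA.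
  rewrite mevalM mevalXU meval_lin_subst.
  have -> : z 0 ord_max = (z *m T) 0 ord_max.
    have [x [y [w ->]]] := row3_surj z.
    by rewrite row3_mul !rowK /= !row3Z !row3D !mxE /=; ring.
  have [x [y [w ->]]] := row3_surj (z *m T).
  by rewrite row3_frame hf mxE.
Qed.

End Fibers.

Section LinearChange.
Variables (K : closedFieldType) (g h : {mpoly K[3]}) (T : 'M[K]_3).
Hypothesis Tu : T \in unitmx.
Hypothesis gh : forall u : 'rV[K]_3, g.@[u 0] = h.@[(u *m T) 0].

Lemma singular_point_change u : singular_point g u <-> singular_point h (u *m T).
Proof.
have Tf : row_free T by rewrite row_free_unit.
rewrite /singular_point /on_hypersurface gh (gradient_comp gh).
have -> : (u *m T != 0) = (u != 0) by rewrite mulmx_free_eq0.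
split=> -[u0 e gr]; split=> //; last by rewrite gr mulmx0.
by apply/(can_inj (mulKmx Tu)); rewrite gr mulmx0.
Qed.

Lemma line_restriction_change u z :
  line_restriction g u z = line_restriction h (u *m T) (z *m T).
Proof.
apply: line_restrictionE => t; rewrite gh horner_line_restriction.
by rewrite mulmxDl -scalemxAl.
Qed.

End LinearChange.

(** * Quartics through a line, sorted by degree *)

Section BinaryForms.
Variable R : comNzRingType.
Implicit Types h : nat -> R.

Definition bquad h c d : R := h 0%N * c ^+ 2 + h 1%N * (c * d) + h 2%N * d ^+ 2.
Definition bcubic h c d : R :=
  h 0%N * c ^+ 3 + h 1%N * (c ^+ 2 * d) + h 2%N * (c * d ^+ 2) + h 3%N * d ^+ 3.
Definition bquartic h c d : R := h 0%N * c ^+ 4 + h 1%N * (c ^+ 3 * d)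
  + h 2%N * (c ^+ 2 * d ^+ 2) + h 3%N * (c * d ^+ 3) + h 4%N * d ^+ 4.

End BinaryForms.

Section QuarticThroughLine.
Variable R : comNzRingType.
Variables (ca cb cc cd ce cg : nat -> R).

(** The part of degree at least two in (c, d) of a quartic that vanishes for
    c = d = 0, sorted by monomials in (a, b). *)
Definition higher_part a b c d : R :=
  a ^+ 2 * bquad ca c d + a * b * bquad cb c d + b ^+ 2 * bquad cc c d
  + a * bcubic cd c d + b * bcubic ce c d + bquartic cg c d.

Definition fiber_higher_part p q x y w : R :=
  w * (x ^+ 2 * bquad ca p q + x * y * bquad cb p q + y ^+ 2 * bquad cc p q)
  + w ^+ 2 * (x * bcubic cd p q + y * bcubic ce p q) + w ^+ 3 * bquartic cg p q.

Lemma higher_part_plane p q x y w :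
  higher_part x y (w * p) (w * q) = w * fiber_higher_part p q x y w.
Proof.
rewrite /higher_part /fiber_higher_part /bquad /bcubic /bquartic; ring.
Qed.

End QuarticThroughLine.

Section Expansion.
Variable K : closedFieldType.

Lemma sum3_single (F : 'I_5 -> 'I_5 -> 'I_5 -> K) i0 j0 e0 :
  (forall i j e, F i j e != 0 -> [/\ i = i0, j = j0 & e = e0]) ->
  \sum_i \sum_j \sum_e F i j e = F i0 j0 e0.
Proof.
move=> h; have h0 i j e : ~ [/\ i = i0, j = j0 & e = e0] -> F i j e = 0.
  by move=> n; apply/eqP/negPn/negP => /h.
rewrite (bigD1 i0) //= (bigD1 j0) //= (bigD1 e0) //= !big1 ?addr0 //.
- move=> i ii; apply: big1 => j _; apply: big1 => e _; apply: h0 => -[ei _ _].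
  by rewrite ei eqxx in ii.
- move=> j jj; apply: big1 => e _; apply: h0 => -[_ ej _].
  by rewrite ej eqxx in jj.
- by move=> e ee; apply: h0 => -[_ _ ef]; rewrite ef eqxx in ee.
Qed.

(** The sum runs over a box of exponents, those of degree more than four
    contributing zero, so that it unfolds into monomials by computation. *)
Lemma homog4_expand (p : {mpoly K[4]}) : p \is 4.-homog ->
  exists k : nat -> nat -> nat -> K, forall a b c d,
  p.@[(row4 a b c d) 0] =
  \sum_(i <- iota 0 5) \sum_(j <- iota 0 5) \sum_(e <- iota 0 5)
    if (i + j + e <= 4)%N
    then k i j e * (a ^+ i * b ^+ j * c ^+ e * d ^+ (4 - (i + j + e))) else 0.
Proof.
move=> hp; pose mk (i j e : nat) : 'X_{1..4} :=
  Multinom [tuple i; j; e; (4 - (i + j + e))%N].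
exists (fun i j e => p@_(mk i j e)) => a b c d.
have pE : p = \sum_(i < 5) \sum_(j < 5) \sum_(e < 5)
    if (i + j + e <= 4)%N then p@_(mk i j e) *: 'X_[mk i j e] else 0.
  apply/mpolyP => m; rewrite raddf_sum /=.
  under eq_bigr => i _ do rewrite raddf_sum /=.
  under eq_bigr => i _ do under eq_bigr => j _ do rewrite raddf_sum /=.
  have mkE (i j e : nat) : mk i j e = m -> [/\ i = m (@Ordinal 4 0 isT),
      j = m (@Ordinal 4 1 isT) & e = m (@Ordinal 4 2 isT)].
    by move=> <-; rewrite !multinomE !(tnth_nth 0%N).
  have dg : mdeg m = (m (@Ordinal 4 0 isT) + m (@Ordinal 4 1 isT) +
      m (@Ordinal 4 2 isT) + m (@Ordinal 4 3 isT))%N.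
    rewrite mdegE !big_ord_recl big_ord0 addn0 !addnA.
    by congr (m _ + m _ + m _ + m _)%N; apply/val_inj.
  have [m4|m4] := eqVneq (mdeg m) 4%N; last first.
    rewrite (dhomog_nemf_coeff hp m4); apply/esym.
    apply: big1 => i _; apply: big1 => j _; apply: big1 => e _.
    case: ifP => ije; last by rewrite mcoeff0.
    rewrite mcoeffZ mcoeffX; case: eqP => [/= mE|]; last by rewrite mulr0.
    case/eqP: m4; rewrite -mE mdegE !big_ord_recl big_ord0 !multinomE !(tnth_nth 0%N) /= addn0 !addnA.
    by rewrite -!addnA !addnA subnKC.
  have lt5 (i : 'I_4) : (m i < 5)%N.
    have le : (m i <= mdeg m)%N by rewrite mdegE (bigD1 i) //= leq_addr.
    by rewrite ltnS (leq_trans le) // m4.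
  rewrite (@sum3_single _ (Ordinal (lt5 (@Ordinal 4 0 isT)))
    (Ordinal (lt5 (@Ordinal 4 1 isT))) (Ordinal (lt5 (@Ordinal 4 2 isT)))) /=.
    have le4 : (m (@Ordinal 4 0 isT) + m (@Ordinal 4 1 isT) +
      m (@Ordinal 4 2 isT) <= 4)%N.
      by apply: (@leq_trans (mdeg m)); [rewrite dg leq_addr | rewrite m4].
    rewrite le4.
    set m' := mk _ _ _; have -> : m' = m.
      apply/mnmP => -[[|[|[|[|//]]]] hi]; rewrite multinomE (tnth_nth 0%N) /=; try by congr (m _); apply/val_inj.
      have -> : m (Ordinal hi) = m (@Ordinal 4 3 isT) by congr (m _); apply/val_inj.
      by apply/eqP; rewrite -(eqn_add2l (m (@Ordinal 4 0 isT) + m (@Ordinal 4 1 isT) +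
        m (@Ordinal 4 2 isT))) -dg m4 subnKC.
    by rewrite mcoeffZ mcoeffX eqxx mulr1.
  move=> i j e; case: ifP => ije; last by rewrite mcoeff0 eqxx.
  rewrite mcoeffZ mcoeffX; case: (mk i j e =P m) => [em _|]; last by rewrite mulr0 eqxx.
  by have [e1 e2 e3] := mkE _ _ _ em; split; apply/val_inj.
have io (F : nat -> K) : \sum_(i <- iota 0 5) F i = \sum_(i < 5) F i.
  by rewrite -(big_mkord xpredT F).
rewrite io; under [RHS]eq_bigr => i _ do rewrite io.
under [RHS]eq_bigr => i _ do under eq_bigr => j _ do rewrite io.
rewrite [in LHS]pE raddf_sum /=; apply: eq_bigr => i _.
rewrite raddf_sum /=; apply: eq_bigr => j _.
rewrite raddf_sum /=; apply: eq_bigr => e _.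
case: ifP => _; last by rewrite meval0.
rewrite mevalZ mevalX !big_ord_recl big_ord0 !multinomE !(tnth_nth 0%N) !mxE /= mulr1 !mulrA //.
Qed.

Lemma quartic_through_line (f : {mpoly K[4]}) (E : 'M[K]_4) :
  f \is 4.-homog -> (forall a b, f.@[(pt E a b 0 0) 0] = 0) ->
  exists n m ca cb cc cd ce cg, forall a b c d, f.@[(pt E a b c d) 0] =
    c * bcubic n a b + d * bcubic m a b + higher_part ca cb cc cd ce cg a b c d.
Proof.
move=> hf f0; have hF : lin_subst E f \is 4.-homog.
  apply: dhomogI => t v; rewrite !meval_lin_subst -scalemxAl.
  exact: dhomog_meval.
have [k kE] := homog4_expand hF.
have FE a b c d : f.@[(pt E a b c d) 0] = (lin_subst E f).@[(row4 a b c d) 0].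
  by rewrite meval_lin_subst.
pose o := fun i j => k i j 0%N.
have kl i j : (i + j = 4)%N -> k i j 0%N = 0.
  have h : forall t, t != 0 -> (Poly [:: o 0 4; o 1 3; o 2 2; o 3 1; o 4 0]%N).[t] = 0.
    move=> t _; rewrite horner_Poly /= /o.
    have := f0 t 1; rewrite FE kE /= !big_cons !big_nil /= => e.
    by apply: etrans e; ring.
  move=> ij; have i4 : (i <= 4)%N by rewrite -ij leq_addr.
  have := coef_eq0_of_horner h i; have -> : j = (4 - i)%N by rewrite -ij addKn.
  by case: i {ij} i4 => [|[|[|[|[|//]]]]].
exists (nth 0 [:: k 3 0 1; k 2 1 1; k 1 2 1; k 0 3 1]%N),
  (nth 0 [:: k 3 0 0; k 2 1 0; k 1 2 0; k 0 3 0]%N),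
  (nth 0 [:: k 2 0 2; k 2 0 1; k 2 0 0]%N),
  (nth 0 [:: k 1 1 2; k 1 1 1; k 1 1 0]%N),
  (nth 0 [:: k 0 2 2; k 0 2 1; k 0 2 0]%N),
  (nth 0 [:: k 1 0 3; k 1 0 2; k 1 0 1; k 1 0 0]%N),
  (nth 0 [:: k 0 1 3; k 0 1 2; k 0 1 1; k 0 1 0]%N),
  (nth 0 [:: k 0 0 4; k 0 0 3; k 0 0 2; k 0 0 1; k 0 0 0]%N) => a b c d.
rewrite FE kE /= !big_cons !big_nil /=.
rewrite (kl 0 4)%N // (kl 1 3)%N // (kl 2 2)%N // (kl 3 1)%N // (kl 4 0)%N //.
rewrite /higher_part /bquad /bcubic /bquartic /=.
ring.
Qed.

End Expansion.

(** * Total ramification on the line *)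

Section Basis.
Variables (K : closedFieldType) (l : {vspace 'rV[K]_4}) (P1 P2 : 'rV[K]_4).
Hypotheses (dl : \dim l = 2%N) (P1l : P1 \in l) (P2l : P2 \in l).
Hypotheses (P1n : P1 != 0) (P2n : P2 != 0) (P12 : <[P1]>%VS != <[P2]>%VS).

Lemma basis_extending_line : exists E : 'M[K]_4,
  [/\ E \in unitmx, P1 = pt E 1 0 0 0, P2 = pt E 0 1 0 0
    & forall a b c d, (pt E a b c d \in l) = (c == 0) && (d == 0)].
Proof.
have dV : \dim (fullv : {vspace 'rV[K]_4}) = 4%N by rewrite dimvf /dim /= mul1n.
have out (U : {vspace 'rV[K]_4}) : (\dim U < 4)%N -> exists2 v, v \notin U & v != 0.
  move=> dU; have /subvPn[v _ vU] : ~~ (fullv <= U)%VS.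
    by apply/negP => /dimvS; rewrite dV leqNgt dU.
  by exists v => //; apply: contraNneq vU => ->; rewrite mem0v.
have [|e2 e2l _] := out l; first by rewrite dl.
have [|e3 e3l _] := out (l + <[e2]>)%VS.
  apply: leq_ltn_trans (dimv_add_leqif _ _) _.
  by rewrite dl dim_vline; case: (e2 != 0).
pose E : 'M[K]_4 := \matrix_(i < 4) nth (0 : 'rV[K]_4) [:: P1; P2; e2; e3] i.
have ptE a b c d : pt E a b c d = a *: P1 + b *: P2 + c *: e2 + d *: e3.
  by rewrite /pt row4_mul !rowK.
have hl a b c d : (pt E a b c d \in l) = (c == 0) && (d == 0).
  rewrite ptE; apply/idP/andP => [m|[/eqP-> /eqP->]]; last first.
    by rewrite !scale0r !addr0 memvD ?memvZ.
  have abl : a *: P1 + b *: P2 \in l by rewrite memvD ?memvZ.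
  have m' : c *: e2 + d *: e3 \in l.
    by rewrite -[_ + _](addKr (a *: P1 + b *: P2)) memvD ?memvN // addrA.
  have d0 : d = 0.
    apply/eqP/negPn/negP => dn; case/negP: e3l.
    have : d *: e3 \in (l + <[e2]>)%VS.
      rewrite -[d *: e3](addKr (c *: e2)) addrC; apply: memv_add => //.
      by rewrite memvN memvZ ?memv_line.
    by move=> /(memvZ d^-1); rewrite scalerA mulVf // scale1r.
  split; last by rewrite d0.
  apply/negPn/negP => cn; case/negP: e2l.
  move: m'; rewrite d0 scale0r addr0 => /(memvZ c^-1).
  by rewrite scalerA mulVf // scale1r.
exists E; split => //.
- rewrite -row_free_unit; apply: inj_row_free => v.
  have [a [b [c [d ->]]]] := row4_surj v; rewrite -/(pt E a b c d) => e.
  have := hl a b c d; rewrite e mem0v => /esym/andP[/eqP c0 /eqP d0].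
  move: e; rewrite ptE c0 d0 !scale0r !addr0 => e.
  have b0 : b = 0.
    apply/eqP/negPn/negP => bn; case/negP: P12.
    rewrite eq_sym eqEdim !dim_vline P1n P2n leqnn andbT -memvE.
    apply/vlineP; exists (- (b^-1 * a)); apply: (scalerI bn).
    rewrite scalerA mulrN mulVKf // scaleNr; apply/eqP.
    by rewrite -subr_eq0 opprK addrC e.
  move: e; rewrite b0 scale0r addr0 => /eqP.
  by rewrite scaler_eq0 (negPf P1n) orbF => /eqP->; rewrite row4_0.
- by rewrite ptE !scale0r !addr0 scale1r.
- by rewrite ptE !scale0r !addr0 add0r scale1r.
Qed.

End Basis.

Section LineFiber.
Variable K : closedFieldType.
Variables (n m ca cb cc cd ce cg : nat -> K).

(** The fibre over the plane of slope (p : q) of a quartic through the line. *)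
Definition line_fiber (p q : K) : {mpoly K[3]} :=
  let k (h : nat -> K) i := (h i)%:MP_[3] in
  let x := 'X_(@Ordinal 3 0 isT) in let y := 'X_(@Ordinal 3 1 isT) in
  p%:MP * bcubic (k n) x y + q%:MP * bcubic (k m) x y
  + fiber_higher_part (k ca) (k cb) (k cc) (k cd) (k ce) (k cg) p%:MP q%:MP
      x y 'X_(@Ordinal 3 2 isT).

Lemma meval_line_fiber p q x y w : (line_fiber p q).@[(row3 x y w) 0] =
  p * bcubic n x y + q * bcubic m x y + fiber_higher_part ca cb cc cd ce cg p q x y w.
Proof.
rewrite /line_fiber /fiber_higher_part /bquad /bcubic /bquartic.
by rewrite !(mevalD, mevalM, rmorphXn, mevalC) /= !mevalXU !mxE.
Qed.

End LineFiber.

Section Ramification.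
Variables (K : closedFieldType) (f : {mpoly K[4]}) (l : {vspace 'rV[K]_4}).
Variables (E : 'M[K]_4) (n m ca cb cc cd ce cg : nat -> K).
Hypothesis hE : E \in unitmx.
Hypothesis hl : forall a b c d, (pt E a b c d \in l) = (c == 0) && (d == 0).
Hypothesis hf : forall a b c d, f.@[(pt E a b c d) 0] =
    c * bcubic n a b + d * bcubic m a b + higher_part ca cb cc cd ce cg a b c d.

Lemma quartic_plane_sectionE p q x y w : f.@[(pt E x y (w * p) (w * q)) 0]
  = w * (line_fiber n m ca cb cc cd ce cg p q).@[(row3 x y w) 0].
Proof.
rewrite hf meval_line_fiber higher_part_plane; ring.
Qed.

Lemma fiber_higher_part0 p q x y :
  fiber_higher_part ca cb cc cd ce cg p q x y 0 = 0.
Proof. by rewrite /fiber_higher_part !expr0n /= !mul0r !addr0. Qed.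

(** A frame of the tangent plane differs from a standard one by a change of
    coordinates, so the index can be read off on the cubics of the pencil. *)
Lemma ramification_indexP (a b : K) (e : nat) :
  ramification_index f l (pt E a b 0 0) e ->
  exists p q, let r := line_restriction (line_fiber n m ca cb cc cd ce cg p q) in
    [/\ (p != 0) || (q != 0),
        forall x y, 'X^e %| r (row3 a b 0) (row3 x y 0)
      & ~ forall x y, 'X^(e.+1) %| r (row3 a b 0) (row3 x y 0)].
Proof.
case=> M [g [u [fib uP [[u0 ul hge] hlt]]]].
have [p [q [T [Tu nz eM _ gT]]]] := fiberP hE hl quartic_plane_sectionE fib.
have uT : u *m T = row3 a b 0.
  have [x [y [w e1]]] := row3_surj (u *m T).
  move: uP; rewrite eM mulmxA e1 row3_frame => /(pt_inj hE)[-> -> /eqP + /eqP].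
  rewrite !mulf_eq0; have [-> //|_ /= p0 q0] := eqVneq w 0.
  by rewrite p0 q0 in nz.
have preim z : (z \in frame_preim M l) = ((z *m T) 0 (@Ordinal 3 2 isT) == 0).
  rewrite /frame_preim -memv_preim lfunE /= eM mulmxA.
  have [x [y [w ->]]] := row3_surj (z *m T).
  rewrite row3_frame hl !mxE /= !mulf_eq0 -orb_andr.
  by rewrite -(negbK (_ && _)) negb_and nz orbF.
have surj x y : exists2 z, z \in frame_preim M l & z *m T = row3 x y 0.
  exists (row3 x y 0 *m invmx T); last by rewrite mulmxKV.
  by rewrite preim mulmxKV // mxE.
exists p, q; split=> //.
- move=> x y; have [z zl <-] := surj x y; rewrite -uT.
  by rewrite -(line_restriction_change gT); apply: hge.
- move=> h; apply: hlt; split=> // z; rewrite preim => zl.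
  rewrite (line_restriction_change gT) uT.
  have [x [y [w ez]]] := row3_surj (z *m T).
  by move: zl; rewrite ez mxE /= => /eqP->.
Qed.

Lemma line_fiber_on_line p q x y :
  (line_fiber n m ca cb cc cd ce cg p q).@[(row3 x y 0) 0]
  = bcubic (fun i => p * n i + q * m i) x y.
Proof. rewrite meval_line_fiber fiber_higher_part0 /bcubic; ring. Qed.

(** Index three at (1, 0) means that the binary cubic p n + q m cut out on the
    line is a nonzero multiple of y^3. *)
Lemma total_ramification1 : ramification_index f l (pt E 1 0 0 0) 3 ->
  exists p q, [/\ p * n 0%N + q * m 0%N = 0, p * n 1%N + q * m 1%N = 0,
    p * n 2%N + q * m 2%N = 0 & p * n 3%N + q * m 3%N != 0].
Proof.
case/ramification_indexP => p [q [_ h3 h4]]; exists p, q.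
pose k i := p * n i + q * m i.
have rE x y : line_restriction (line_fiber n m ca cb cc cd ce cg p q)
    (row3 1 0 0) (row3 x y 0) = Poly [:: k 0%N; 3%:R * (k 0%N * x) + k 1%N * y;
     3%:R * (k 0%N * x ^+ 2) + k 1%N * (x * y) *+ 2 + k 2%N * y ^+ 2;
     bcubic k x y].
  apply: line_restrictionE => t; rewrite row3Z row3D mulr0 addr0 line_fiber_on_line.
  rewrite horner_Poly /= /bcubic /k; ring.
move: (h3 0 1); rewrite rE => /dvdXn_coef h.
have k0 : k 0%N = 0 by have := h 0%N isT; rewrite coef_Poly.
have k1 : k 1%N = 0.
  by have := h 1%N isT; rewrite coef_Poly /= k0 mul0r mulr0 add0r mulr1.
have k2 : k 2%N = 0.
  have := h 2%N isT; rewrite coef_Poly /= k0 k1 => <-; ring.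
split=> //; apply/negP => /eqP k3; apply: h4 => x y.
rewrite rE (_ : Poly _ = 0) ?dvdp0 //; apply/polyP => i.
rewrite coef0 coef_Poly /bcubic -/(k 3%N) in k3 *; rewrite k0 k1 k2 k3.
by case: i => [|[|[|[|i]]]] //=; rewrite ?nth_nil; ring.
Qed.

Lemma total_ramification2 : ramification_index f l (pt E 0 1 0 0) 3 ->
  exists p q, [/\ p * n 3%N + q * m 3%N = 0, p * n 2%N + q * m 2%N = 0,
    p * n 1%N + q * m 1%N = 0 & p * n 0%N + q * m 0%N != 0].
Proof.
case/ramification_indexP => p [q [_ h3 h4]]; exists p, q.
pose k i := p * n i + q * m i.
have rE x y : line_restriction (line_fiber n m ca cb cc cd ce cg p q)
    (row3 0 1 0) (row3 x y 0) = Poly [:: k 3%N; 3%:R * (k 3%N * y) + k 2%N * x;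
     3%:R * (k 3%N * y ^+ 2) + k 2%N * (x * y) *+ 2 + k 1%N * x ^+ 2;
     bcubic k x y].
  apply: line_restrictionE => t; rewrite row3Z row3D mulr0 addr0 line_fiber_on_line.
  rewrite horner_Poly /= /bcubic /k; ring.
move: (h3 1 0); rewrite rE => /dvdXn_coef h.
have k3 : k 3%N = 0 by have := h 0%N isT; rewrite coef_Poly.
have k2 : k 2%N = 0.
  by have := h 1%N isT; rewrite coef_Poly /= k3 mul0r mulr0 add0r mulr1.
have k1 : k 1%N = 0.
  have := h 2%N isT; rewrite coef_Poly /= k3 k2 => <-; ring.
split=> //; apply/negP => /eqP k0; apply: h4 => x y.
rewrite rE (_ : Poly _ = 0) ?dvdp0 //; apply/polyP => i.
rewrite coef0 coef_Poly /bcubic -/(k 0%N) in k0 *; rewrite k0 k1 k2 k3.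
by case: i => [|[|[|[|i]]]] //=; rewrite ?nth_nil; ring.
Qed.

End Ramification.

(** * Hessians of the fibres *)

Section HessianForm.
Variable R : comNzRingType.

(** The determinant of a symmetric matrix and the bilinear form that it defines,
    in expanded form: identities between them are checked by expansion over
    polynomial rings. *)
Definition sym_det (h11 h12 h13 h22 h23 h33 : R) : R :=
  h11 * (h22 * h33 - h23 ^+ 2) - h12 * (h12 * h33 - h23 * h13)
  + h13 * (h12 * h23 - h22 * h13).

Definition sym_form (h11 h12 h13 h22 h23 h33 x y w x' y' w' : R) : R :=
  h11 * (x * x') + h12 * (x * y' + y * x') + h13 * (x * w' + w * x')
  + h22 * (y * y') + h23 * (y * w' + w * y') + h33 * (w * w').

Variables (ca cb cc cd ce cg : nat -> R).

(** The entries of the Hessian matrix at (x, y, w) of the residual cubic in the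
    plane of slope (p : q). *)
Definition hess11 p q (x y w : R) := 6%:R * (p * x) + 2%:R * (w * bquad ca p q).
Definition hess12 p q (x y w : R) := w * bquad cb p q.
Definition hess13 p q (x y w : R) :=
  2%:R * (x * bquad ca p q) + y * bquad cb p q + 2%:R * (w * bcubic cd p q).
Definition hess22 p q (x y w : R) := 6%:R * (q * y) + 2%:R * (w * bquad cc p q).
Definition hess23 p q (x y w : R) :=
  x * bquad cb p q + 2%:R * (y * bquad cc p q) + 2%:R * (w * bcubic ce p q).
Definition hess33 p q (x y w : R) :=
  2%:R * (x * bcubic cd p q + y * bcubic ce p q) + 6%:R * (w * bquartic cg p q).

Definition hessian p q x y w : R :=
  sym_det (hess11 p q x y w) (hess12 p q x y w) (hess13 p q x y w)
          (hess22 p q x y w) (hess23 p q x y w) (hess33 p q x y w).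

(** The rescaling moves the point (x, y, w p, w q) of space to the multiple s r of
    itself, so that the vanishing of the Hessian depends on that point only. *)
Lemma hessian_scale s r p q x y w :
  hessian (s * p) (s * q) (s * r * x) (s * r * y) (r * w)
  = s ^+ 8 * r ^+ 3 * hessian p q x y w.
Proof.
have e11 : hess11 (s * p) (s * q) (s * r * x) (s * r * y) (r * w)
    = s ^+ 2 * r * hess11 p q x y w by rewrite /hess11 /bquad; ring.
have e12 : hess12 (s * p) (s * q) (s * r * x) (s * r * y) (r * w)
    = s ^+ 2 * r * hess12 p q x y w by rewrite /hess12 /bquad; ring.
have e13 : hess13 (s * p) (s * q) (s * r * x) (s * r * y) (r * w)
    = s ^+ 3 * r * hess13 p q x y w by rewrite /hess13 /bquad /bcubic; ring.
have e22 : hess22 (s * p) (s * q) (s * r * x) (s * r * y) (r * w)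
    = s ^+ 2 * r * hess22 p q x y w by rewrite /hess22 /bquad; ring.
have e23 : hess23 (s * p) (s * q) (s * r * x) (s * r * y) (r * w)
    = s ^+ 3 * r * hess23 p q x y w by rewrite /hess23 /bquad /bcubic; ring.
have e33 : hess33 (s * p) (s * q) (s * r * x) (s * r * y) (r * w)
    = s ^+ 4 * r * hess33 p q x y w by rewrite /hess33 /bcubic /bquartic; ring.
rewrite /hessian e11 e12 e13 e22 e23 e33 /sym_det; ring.
Qed.

(** Cofactors in an expression of the quartic as c * cofactor_c + d * cofactor_d;
    on the surface the plane through (a, b, c, d) has slope
    (cofactor_d : - cofactor_c), also at points of the line. *)
Definition cofactor_c (a b c d : R) : R :=
  a ^+ 3 + a ^+ 2 * (ca 0%N * c + ca 1%N * d) + a * b * (cb 0%N * c + cb 1%N * d)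
  + b ^+ 2 * (cc 0%N * c + cc 1%N * d)
  + a * (cd 0%N * c ^+ 2 + cd 1%N * (c * d) + cd 2%N * d ^+ 2)
  + b * (ce 0%N * c ^+ 2 + ce 1%N * (c * d) + ce 2%N * d ^+ 2)
  + (cg 0%N * c ^+ 3 + cg 1%N * (c ^+ 2 * d) + cg 2%N * (c * d ^+ 2) + cg 3%N * d ^+ 3).
Definition cofactor_d (a b c d : R) : R :=
  b ^+ 3 + a ^+ 2 * (ca 2%N * d) + a * b * (cb 2%N * d) + b ^+ 2 * (cc 2%N * d)
  + a * (cd 3%N * d ^+ 2) + b * (ce 3%N * d ^+ 2) + cg 4%N * d ^+ 3.

Lemma cofactorE p q x y w :
  p * cofactor_c x y (w * p) (w * q) + q * cofactor_d x y (w * p) (w * q)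
  = p * x ^+ 3 + q * y ^+ 3 + fiber_higher_part ca cb cc cd ce cg p q x y w.
Proof.
rewrite /cofactor_c /cofactor_d /fiber_higher_part /bquad /bcubic /bquartic; ring.
Qed.

(** The Hessian of the fibre through (a, b, c, d).  Up to the rescaling of
    hessian_scale, (q a, q b, d) are the coordinates of the point in the plane of
    slope (p : q), because d = w q. *)
Definition flex_form a b c d : R :=
  let p := cofactor_d a b c d in let q := - cofactor_c a b c d in
  hessian p q (q * a) (q * b) d.

Lemma flex_form_scale t a b c d :
  flex_form (t * a) (t * b) (t * c) (t * d) = t ^+ 27 * flex_form a b c d.
Proof.
rewrite /flex_form.
have -> : cofactor_d (t * a) (t * b) (t * c) (t * d) = t ^+ 3 * cofactor_d a b c d.
  rewrite /cofactor_d; ring.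
have -> : - cofactor_c (t * a) (t * b) (t * c) (t * d) = t ^+ 3 * - cofactor_c a b c d.
  rewrite /cofactor_c; ring.
have e x : t ^+ 3 * - cofactor_c a b c d * (t * x)
    = t ^+ 3 * t * (- cofactor_c a b c d * x) by ring.
rewrite !e hessian_scale; congr (_ * _); ring.
Qed.

End HessianForm.

Section Morphism.
Variables (R S : comNzRingType) (phi : {rmorphism R -> S}).
Variables (ca cb cc cd ce cg : nat -> R).

Lemma rmorph_bquad h c d : phi (bquad h c d) = bquad (phi \o h) (phi c) (phi d).
Proof. by rewrite /bquad !(rmorphD, rmorphM, rmorphXn). Qed.

Lemma rmorph_bcubic h c d : phi (bcubic h c d) = bcubic (phi \o h) (phi c) (phi d).
Proof. by rewrite /bcubic !(rmorphD, rmorphM, rmorphXn). Qed.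

Lemma rmorph_bquartic h c d :
  phi (bquartic h c d) = bquartic (phi \o h) (phi c) (phi d).
Proof. by rewrite /bquartic !(rmorphD, rmorphM, rmorphXn). Qed.

Lemma rmorph_sym_det h11 h12 h13 h22 h23 h33 : phi (sym_det h11 h12 h13 h22 h23 h33)
  = sym_det (phi h11) (phi h12) (phi h13) (phi h22) (phi h23) (phi h33).
Proof. by rewrite /sym_det !(rmorphD, rmorphN, rmorphM, rmorphXn). Qed.

Lemma rmorph_hessian p q x y w : phi (hessian ca cb cc cd ce cg p q x y w)
  = hessian (phi \o ca) (phi \o cb) (phi \o cc) (phi \o cd) (phi \o ce)
      (phi \o cg) (phi p) (phi q) (phi x) (phi y) (phi w).
Proof.
rewrite /hessian rmorph_sym_det; congr sym_det;
  rewrite /hess11 /hess12 /hess13 /hess22 /hess23 /hess33 -?rmorph_bquad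
    -?rmorph_bcubic -?rmorph_bquartic;
  move: (bquad ca p q) (bquad cb p q) (bquad cc p q) (bcubic cd p q)
    (bcubic ce p q) (bquartic cg p q) => A B C D H G;
  by rewrite !(rmorphD, rmorphM, rmorph_nat).
Qed.

Lemma rmorph_flex_form a b c d : phi (flex_form ca cb cc cd ce cg a b c d)
  = flex_form (phi \o ca) (phi \o cb) (phi \o cc) (phi \o cd) (phi \o ce)
      (phi \o cg) (phi a) (phi b) (phi c) (phi d).
Proof.
have ec : phi (cofactor_c ca cb cc cd ce cg a b c d)
    = cofactor_c (phi \o ca) (phi \o cb) (phi \o cc) (phi \o cd) (phi \o ce)
      (phi \o cg) (phi a) (phi b) (phi c) (phi d).
  by rewrite /cofactor_c !(rmorphD, rmorphM, rmorphXn).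
have ed : phi (cofactor_d ca cb cc cd ce cg a b c d)
    = cofactor_d (phi \o ca) (phi \o cb) (phi \o cc) (phi \o cd) (phi \o ce)
      (phi \o cg) (phi a) (phi b) (phi c) (phi d).
  by rewrite /cofactor_d !(rmorphD, rmorphM, rmorphXn).
by rewrite /flex_form rmorph_hessian !rmorphM !rmorphN ec ed.
Qed.

End Morphism.

(** In the basis made of y, z and a third vector, the Gram matrix of a form
    vanishing on the span of y and z has a 2 x 2 block of zeros. *)
Lemma sym_det_isotropic_plane (K : idomainType)
    (h11 h12 h13 h22 h23 h33 y0 y1 y2 z0 z1 z2 : K) :
  let F := sym_form h11 h12 h13 h22 h23 h33 in
  F y0 y1 y2 y0 y1 y2 = 0 -> F y0 y1 y2 z0 z1 z2 = 0 -> F z0 z1 z2 z0 z1 z2 = 0 ->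
  [|| y1 * z2 - y2 * z1 != 0, y2 * z0 - y0 * z2 != 0 | y0 * z1 - y1 * z0 != 0] ->
  sym_det h11 h12 h13 h22 h23 h33 = 0.
Proof.
move=> F Fyy Fyz Fzz; pose D := sym_det h11 h12 h13 h22 h23 h33.
have gram e0 e1 e2 : D * (e0 * (y1 * z2 - y2 * z1) + e1 * (y2 * z0 - y0 * z2)
    + e2 * (y0 * z1 - y1 * z0)) ^+ 2 = 0.
  transitivity (sym_det (F y0 y1 y2 y0 y1 y2) (F y0 y1 y2 z0 z1 z2)
    (F y0 y1 y2 e0 e1 e2) (F z0 z1 z2 z0 z1 z2) (F z0 z1 z2 e0 e1 e2)
    (F e0 e1 e2 e0 e1 e2)); first by rewrite /D /F /sym_det /sym_form; ring.
  rewrite Fyy Fyz Fzz /sym_det; ring.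
have concl k : k != 0 -> D * k ^+ 2 = 0 -> D = 0.
  by move=> k0 /eqP; rewrite mulf_eq0 expf_eq0 /= (negPf k0) orbF => /eqP.
case/or3P => k0; apply: (concl _ k0); [rewrite -[RHS](gram 1 0 0) | rewrite -[RHS](gram 0 1 0) | rewrite -[RHS](gram 0 0 1)]; congr (_ * _ ^+ 2); ring.
Qed.

(** * Coefficients of a quartic for which the line is of the second kind *)

Section SecondKind.
Variables (K : closedFieldType) (f : {mpoly K[4]}) (l : {vspace 'rV[K]_4}).
Variables (E : 'M[K]_4) (ca cb cc cd ce cg : nat -> K).
Hypotheses (ch2 : 2%:R != 0 :> K) (ch3 : 3%:R != 0 :> K).
Hypothesis hE : E \in unitmx.
Hypothesis hl : forall a b c d, (pt E a b c d \in l) = (c == 0) && (d == 0).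
Hypothesis hf : forall a b c d, f.@[(pt E a b c d) 0] =
    c * a ^+ 3 + d * b ^+ 3 + higher_part ca cb cc cd ce cg a b c d.

Let n0 : nat -> K := nth 0 [:: 1].
Let m0 : nat -> K := nth 0 [:: 0; 0; 0; 1].
Let ga := line_fiber n0 m0 ca cb cc cd ce cg.

Let gaE p q x y w : (ga p q).@[(row3 x y w) 0] =
  p * x ^+ 3 + q * y ^+ 3 + fiber_higher_part ca cb cc cd ce cg p q x y w.
Proof. rewrite /ga meval_line_fiber /bcubic /n0 /m0 /=; ring. Qed.

Let hga p q x y w :
  f.@[(pt E x y (w * p) (w * q)) 0] = w * (ga p q).@[(row3 x y w) 0].
Proof. rewrite hf gaE higher_part_plane; ring. Qed.

Let form p q x y w := sym_form (hess11 ca p q x y w) (hess12 cb p q x y w)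
  (hess13 ca cb cd p q x y w) (hess22 cc p q x y w) (hess23 cb cc ce p q x y w)
  (hess33 cd ce cg p q x y w).

(** A line meeting the cubic with multiplicity three at a point is isotropic
    for the Hessian form at that point. *)
Lemma flex_hessian p q x y w x' y' w' : row3 x y w != 0 ->
  (forall k, row3 x' y' w' != k *: row3 x y w) ->
  'X^3 %| line_restriction (ga p q) (row3 x y w) (row3 x' y' w') ->
  hessian ca cb cc cd ce cg p q x y w = 0.
Proof.
move=> u0 ind dv; pose F := form p q x y w.
have e6 : 6%:R *: line_restriction (ga p q) (row3 x y w) (row3 x' y' w') =
    Poly [:: F x y w x y w; 3%:R * F x y w x' y' w'; 3%:R * F x' y' w' x' y' w';
      6%:R * (ga p q).@[(row3 x' y' w') 0]].
  apply: horner_ext => t _; rewrite hornerZ horner_line_restriction row3Z row3D.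
  rewrite horner_Poly /= !gaE /F /form /sym_form /fiber_higher_part.
  rewrite /hess11 /hess12 /hess13 /hess22 /hess23 /hess33.
  move: (bquad ca p q) (bquad cb p q) (bquad cc p q) (bcubic cd p q)
    (bcubic ce p q) (bquartic cg p q) => A B C D H G; ring.
have c6 i : (i < 3)%N ->
    (6%:R *: line_restriction (ga p q) (row3 x y w) (row3 x' y' w'))`_i = 0.
  by move=> i3; rewrite coefZ (iffLR (dvdXn_coef 3 _) dv) ?mulr0.
rewrite e6 in c6.
apply: (@sym_det_isotropic_plane _ _ _ _ _ _ _ x y w x' y' w').
- by have := c6 0%N isT; rewrite coef_Poly.
- have := c6 1%N isT; rewrite coef_Poly /= => /eqP.
  by rewrite mulf_eq0 (negPf ch3) => /eqP.
- have := c6 2%N isT; rewrite coef_Poly /= => /eqP.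
  by rewrite mulf_eq0 (negPf ch3) => /eqP.
apply/negPn/negP; rewrite !negb_or !negbK !subr_eq0 => /and3P[/eqP e1 /eqP e2 /eqP e3].
have quot (r s t u : K) : r != 0 -> r * s = u * t -> t / r * u = s.
  by move=> r0 e; rewrite mulrAC [t * u]mulrC -e mulrC mulKf.
have [x0|x0] := eqVneq x 0; last first.
  have := ind (x' / x); rewrite row3Z divfK // (quot _ _ _ _ x0 e3).
  by rewrite (quot _ _ _ _ x0 (esym e2)) eqxx.
have [y0|y0] := eqVneq y 0; last first.
  have := ind (y' / y); rewrite row3Z divfK // (quot _ _ _ _ y0 (esym e3)).
  by rewrite (quot _ _ _ _ y0 e1) eqxx.
have [w0|w0] := eqVneq w 0; last first.
  have := ind (w' / w); rewrite row3Z divfK // x0 y0 !mulr0.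
  move: e1 e2; rewrite x0 y0 !mul0r => /esym/eqP; rewrite mulf_eq0 (negPf w0) => /eqP->.
  by move=> /eqP; rewrite mulf_eq0 (negPf w0) => /eqP->; rewrite eqxx.
by rewrite x0 y0 w0 row3_0 eqxx in u0.
Qed.

Let flex_mpoly : {mpoly K[4]} :=
  let k (h : nat -> K) i := (h i)%:MP_[4] in
  flex_form (k ca) (k cb) (k cc) (k cd) (k ce) (k cg)
    (linform (X0 E)) (linform (X1 E)) (linform (X2 E)) (linform (X3 E)).

Let meval_flex_mpoly a b c d : flex_mpoly.@[(pt E a b c d) 0]
  = flex_form ca cb cc cd ce cg a b c d.
Proof.
rewrite /flex_mpoly rmorph_flex_form /= !meval_linform !dotX //.
by rewrite /flex_form /hessian /cofactor_c /cofactor_d /hess11 /hess12 /hess13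
  /hess22 /hess23 /hess33 /bquad /bcubic /bquartic /= !mevalC.
Qed.

(** The flex form is a form of degree 27 that vanishes at the inflection points of
    the smooth fibres, hence on their closure. *)
Lemma flex_form_vanishes_on_line a b : second_kind f l ->
  flex_form ca cb cc cd ce cg a b 0 0 = 0.
Proof.
move=> sk; rewrite -meval_flex_mpoly; apply: (sk _ _ 27%N).
- by rewrite hl !eqxx.
- apply: dhomogI => t v; have [a' [b' [c' [d' ->]]]] := pt_surj hE v.
  by rewrite ptZ !meval_flex_mpoly flex_form_scale.
move=> _ [H [M [g [u [fib _ [m dm [u0 um hge]] ->]]]]].
have [p [q [T [Tu nz eM _ gT]]]] := fiberP hE hl hga fib.
have [x [y [w eu]]] := row3_surj (u *m T).
have [z zm zu] : exists2 z, z \in m & z \notin <[u]>%VS.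
  apply/subvPn; apply/negP => /dimvS; rewrite dm dim_vline u0; by [].
have [x' [y' [w' ez]]] := row3_surj (z *m T).
have hess0 : hessian ca cb cc cd ce cg p q x y w = 0.
  apply: (@flex_hessian _ _ _ _ _ x' y' w'); rewrite -?eu -?ez.
  - by rewrite mulmx_free_eq0 ?row_free_unit.
  - move=> k; apply: contraNneq zu; rewrite scalemxAl => /(can_inj (mulmxK Tu)) ->.
    by rewrite memvZ ?memv_line.
  - by rewrite -(line_restriction_change gT) hge.
have gu : (ga p q).@[(row3 x y w) 0] = 0.
  have := hge _ um => e; rewrite -eu -gT -(coef0_line_restriction g u u).
  by rewrite (iffLR (dvdXn_coef 3 _) e).
rewrite /on_hypersurface eM mulmxA eu row3_frame meval_flex_mpoly.
move: gu; rewrite gaE -cofactorE /flex_form.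
set al := cofactor_c _ _ _ _ _ _ _ _ _ _; set be := cofactor_d _ _ _ _ _ _ _ _ _ _.
move=> e; have [mu [-> ->]] : exists mu, be = mu * p /\ - al = mu * q.
  case/orP: nz => nz.
    exists (be / p); rewrite divfK //; split=> //; apply: (mulfI nz).
    by rewrite mulrN -[p * al]addr0 -[X in _ + X](subrr (q * be)) addrA e; field.
  exists (- al / q); rewrite divfK //; split=> //; apply: (mulfI nz).
  by rewrite -[q * be]addr0 -[X in _ + X](subrr (p * al)) addrA [q * be + _]addrC e; field.
by rewrite [w * q]mulrC hessian_scale hess0 mulr0.
Qed.

Hypothesis sk : second_kind f l.

(** At a point (x, y) of l with x^3 = - q and y^3 = p the flex form is a multiple
    of x U + y W, where U and W are the differences of the two sides of the
    relations.  They only depend on the slope, while y can be replaced by om y for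
    a cube root of unity om; so both vanish. *)
Lemma second_kind_relations p q : p != 0 -> q != 0 ->
  3%:R * (p * q * bcubic cd p q)
    = p * (bquad cb p q * bquad cc p q) + q * bquad ca p q ^+ 2 /\
  3%:R * (p * q * bcubic ce p q)
    = p * bquad cc p q ^+ 2 + q * (bquad ca p q * bquad cb p q).
Proof.
move=> p0 q0; have [x xq] := root_of_power (- q) (isT : (0 < 3)%N).
have [y yp] := root_of_power p (isT : (0 < 3)%N).
have x0 : x != 0 by apply: contraNneq q0 => e; rewrite -oppr_eq0 -xq e expr0n.
have y0 : y != 0 by apply: contraNneq p0 => e; rewrite -yp e expr0n.
pose U := 3%:R * (p * q * bcubic cd p q)
    - (p * (bquad cb p q * bquad cc p q) + q * bquad ca p q ^+ 2).
pose W := 3%:R * (p * q * bcubic ce p q)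
    - (p * bquad cc p q ^+ 2 + q * (bquad ca p q * bquad cb p q)).
have rel y1 : y1 ^+ 3 = p -> x * U + y1 * W = 0.
  move=> y1p; have := flex_form_vanishes_on_line x y1 sk; rewrite /flex_form.
  have -> : cofactor_d ca cb cc cd ce cg x y1 0 0 = p.
    rewrite /cofactor_d -y1p; ring.
  have -> : - cofactor_c ca cb cc cd ce cg x y1 0 0 = q.
    rewrite -[q]opprK -xq /cofactor_c; ring.
  have := hessian_scale ca cb cc cd ce cg 1 q p q x y1 0.
  rewrite !mul1r mulr0 expr1n mul1r => -> /eqP.
  rewrite mulf_eq0 expf_eq0 /= (negPf q0) /= => /eqP h.
  have y10 : y1 != 0 by apply: contraNneq p0 => e; rewrite -y1p e expr0n.
  apply: (mulfI (_ : 24%:R * (x * y1) != 0)).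
    rewrite !mulf_neq0 // (_ : 24%:R = 2%:R * 2%:R * 2%:R * 3%:R) ?mulf_neq0 //.
    by rewrite -!natrM.
  rewrite mulr0 -h /U /W -[q]opprK -xq -y1p.
  rewrite /hessian /sym_det /hess11 /hess12 /hess13 /hess22 /hess23 /hess33.
  move: (bquad ca _ _) (bquad cb _ _) (bquad cc _ _) (bcubic cd _ _)
    (bcubic ce _ _) (bquartic cg _ _) => A B C D H G; ring.
have ch3' : 3%N \notin [pchar K] by rewrite inE /= ch3.
have [om [om2 om1]] := primitive_cube_root ch3'.
have om3 : om ^+ 3 = 1.
  apply/eqP; rewrite -subr_eq0; apply/eqP; rewrite -[RHS](mulr0 (om - 1)) -om2; ring.
have r1 := rel _ yp; have r2 : x * U + om * y * W = 0.
  by apply: rel; rewrite exprMn om3 mul1r.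
have W0 : W = 0.
  apply: (mulfI (_ : (om - 1) * y != 0)); first by rewrite mulf_neq0 ?subr_eq0.
  by rewrite mulr0 -[RHS](subrr 0) -{1}r2 -r1; ring.
have U0 : U = 0.
  by apply: (mulfI x0); rewrite mulr0 -r1 W0 mulr0 addr0.
by split; apply/eqP; rewrite -subr_eq0; apply/eqP.
Qed.

(** The extreme coefficients of the two relations are the squares of ca 2 and cc 0;
    once these vanish, the other coefficients express cd and ce through ca, cb and
    cc. *)
Lemma second_kind_coefficients :
  [/\ ca 2%N = 0, cc 0%N = 0,
    [/\ 3%:R * cd 0%N = ca 0%N ^+ 2 + cb 0%N * cc 1%N,
     3%:R * cd 1%N = 2%:R * (ca 0%N * ca 1%N) + cb 1%N * cc 1%N + cb 0%N * cc 2%N,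
     3%:R * cd 2%N = ca 1%N ^+ 2 + cb 2%N * cc 1%N + cb 1%N * cc 2%N
     & 3%:R * cd 3%N = cb 2%N * cc 2%N]
  & [/\ 3%:R * ce 0%N = ca 0%N * cb 0%N,
     3%:R * ce 1%N = cc 1%N ^+ 2 + ca 0%N * cb 1%N + ca 1%N * cb 0%N,
     3%:R * ce 2%N = 2%:R * (cc 1%N * cc 2%N) + ca 0%N * cb 2%N + ca 1%N * cb 1%N
     & 3%:R * ce 3%N = cc 2%N ^+ 2 + ca 1%N * cb 2%N]].
Proof.
have PD : forall t, t != 0 -> (Poly [:: ca 2%N ^+ 2;
    2%:R * (ca 1%N * ca 2%N) + cb 2%N * cc 2%N - 3%:R * cd 3%N;
    2%:R * (ca 0%N * ca 2%N) + ca 1%N ^+ 2 + cb 2%N * cc 1%N + cb 1%N * cc 2%N - 3%:R * cd 2%N;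
    2%:R * (ca 0%N * ca 1%N) + cb 2%N * cc 0%N + cb 1%N * cc 1%N + cb 0%N * cc 2%N
      - 3%:R * cd 1%N;
    ca 0%N ^+ 2 + cb 1%N * cc 0%N + cb 0%N * cc 1%N - 3%:R * cd 0%N;
    cb 0%N * cc 0%N]).[t] = 0.
  move=> t t0; have [+ _] := second_kind_relations t0 (oner_neq0 K).
  move=> /eqP; rewrite -subr_eq0 => /eqP e; rewrite horner_Poly /=.
  rewrite -[RHS]oppr0 -[in RHS]e /bquad /bcubic; ring.
have PE : forall t, t != 0 -> (Poly [:: cc 0%N ^+ 2;
    2%:R * (cc 0%N * cc 1%N) + ca 0%N * cb 0%N - 3%:R * ce 0%N;
    2%:R * (cc 0%N * cc 2%N) + cc 1%N ^+ 2 + ca 0%N * cb 1%N + ca 1%N * cb 0%N - 3%:R * ce 1%N;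
    2%:R * (cc 1%N * cc 2%N) + ca 0%N * cb 2%N + ca 1%N * cb 1%N + ca 2%N * cb 0%N
      - 3%:R * ce 2%N;
    cc 2%N ^+ 2 + ca 1%N * cb 2%N + ca 2%N * cb 1%N - 3%:R * ce 3%N;
    ca 2%N * cb 2%N]).[t] = 0.
  move=> t t0; have [_ +] := second_kind_relations (oner_neq0 K) t0.
  move=> /eqP; rewrite -subr_eq0 => /eqP e; rewrite horner_Poly /=.
  rewrite -[RHS]oppr0 -[in RHS]e /bquad /bcubic; ring.
have hD := coef_eq0_of_horner PD; have hH := coef_eq0_of_horner PE.
have a2 : ca 2%N = 0 by apply/eqP; rewrite -sqrf_eq0; apply/eqP/(hD 0%N).
have c0 : cc 0%N = 0 by apply/eqP; rewrite -sqrf_eq0; apply/eqP/(hH 0%N).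
have sub (u v : K) : u - v = 0 -> v = u by move=> /eqP; rewrite subr_eq0 => /eqP.
have [hD1 hD2 hD3 hD4] := And4 (hD 1%N) (hD 2%N) (hD 3%N) (hD 4%N).
have [hE1 hE2 hE3 hE4] := And4 (hH 1%N) (hH 2%N) (hH 3%N) (hH 4%N).
rewrite /= a2 c0 ?(mulr0, mul0r, add0r, addr0) in hD1 hD2 hD3 hD4 hE1 hE2 hE3 hE4.
split=> //; split; apply: sub => //.
Qed.

End SecondKind.

(** * The normal form of the quartic *)

Section NormalForm.
Variables (K : closedFieldType) (f : {mpoly K[4]}) (l : {vspace 'rV[K]_4}).
Variables (P1 P2 : 'rV[K]_4).
Hypotheses (ch2 : 2%:R != 0 :> K) (ch3 : 3%:R != 0 :> K).
Hypotheses (hf : f \is 4.-homog) (dl : \dim l = 2%N) (lf : subset_hypersurface l f).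
Hypotheses (P1l : P1 \in l) (P1n : P1 != 0) (P2l : P2 \in l) (P2n : P2 != 0).
Hypothesis P12 : <[P1]>%VS != <[P2]>%VS.

Let adapted (E : 'M[K]_4) := [/\ E \in unitmx, P1 = pt E 1 0 0 0, P2 = pt E 0 1 0 0
    & forall a b c d, (pt E a b c d \in l) = (c == 0) && (d == 0)].

Lemma adapted_change (E N : 'M[K]_4) (t : K -> K -> K -> K -> 'rV[K]_4) :
  adapted E -> (forall a b c d, row4 a b c d *m N = t a b c d) ->
  (forall a b c d, t a b c d = 0 -> [/\ a = 0, b = 0, c = 0 & d = 0]) ->
  t 1 0 0 0 = row4 1 0 0 0 -> t 0 1 0 0 = row4 0 1 0 0 ->
  (forall a b c d, (t a b c d *m E \in l) = (c == 0) && (d == 0)) ->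
  adapted (N *m E).
Proof.
case=> hE e1 e2 hl tN tinj t1 t2 tl.
have ptE a b c d : pt (N *m E) a b c d = t a b c d *m E.
  by rewrite /pt mulmxA tN.
split.
- rewrite unitmx_mul hE andbT -row_free_unit; apply: inj_row_free => v.
  have [a [b [c [d ->]]]] := row4_surj v; rewrite tN => /tinj[-> -> -> ->].
  by rewrite row4_0.
- by rewrite ptE t1.
- by rewrite ptE t2.
- by move=> a b c d; rewrite ptE.
Qed.

(** The last two basis vectors are taken in the planes of the two totally ramified
    fibres, on which the linear part is a multiple of a^3 and of b^3. *)
Lemma normal_linear_part :
  ramification_index f l P1 3 -> ramification_index f l P2 3 ->
  exists E ca cb cc cd ce cg, adapted E /\
    forall a b c d, f.@[(pt E a b c d) 0]
      = c * a ^+ 3 + d * b ^+ 3 + higher_part ca cb cc cd ce cg a b c d.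
Proof.
move=> r1 r2; have [E0 aE0] := basis_extending_line dl P1l P2l P1n P2n P12.
case: (aE0) => hE e1 e2 hl.
have expand E : adapted E -> exists n m ca cb cc cd ce cg, forall a b c d,
    f.@[(pt E a b c d) 0] =
    c * bcubic n a b + d * bcubic m a b + higher_part ca cb cc cd ce cg a b c d.
  case=> _ _ _ hl'; apply: quartic_through_line => // a b; apply: lf.
  by rewrite hl' !eqxx.
have [n [m [ca [cb [cc [cd [ce [cg fE]]]]]]]] := expand _ aE0.
rewrite e1 in r1; rewrite e2 in r2.
have [p [q [k0 k1 k2 k3]]] := total_ramification1 hE hl fE r1.
have [p' [q' [k3' k2' k1' k0']]] := total_ramification2 hE hl fE r2.
set k := _ + _ in k3; set k' := _ + _ in k0'.
pose N : 'M[K]_4 := \matrix_(i < 4) nth (0 : 'rV[K]_4) [:: row4 1 0 0 0;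
   row4 0 1 0 0; row4 0 0 (p' / k') (q' / k'); row4 0 0 (p / k) (q / k)] i.
pose t (a b c d : K) :=
  row4 a b (c * (p' / k') + d * (p / k)) (c * (q' / k') + d * (q / k)).
have tN a b c d : row4 a b c d *m N = t a b c d.
  rewrite row4_mul !rowK /= !row4Z !row4D /t.
  by congr row4; ring.
have tinj c d : c * (p' / k') + d * (p / k) = 0 -> c * (q' / k') + d * (q / k) = 0 ->
    c = 0 /\ d = 0.
  move=> h1 h2; split.
    transitivity ((c * (p' / k') + d * (p / k)) * n 0%N
      + (c * (q' / k') + d * (q / k)) * m 0%N); last by rewrite h1 h2; ring.
    transitivity (c * (k' / k') + d * (p * n 0%N + q * m 0%N) / k).
      by rewrite k0 mulfV //; ring.
    by rewrite /k'; ring.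
  transitivity ((c * (p' / k') + d * (p / k)) * n 3%N
      + (c * (q' / k') + d * (q / k)) * m 3%N); last by rewrite h1 h2; ring.
  transitivity (d * (k / k) + c * (p' * n 3%N + q' * m 3%N) / k').
    by rewrite k3' mulfV //; ring.
  by rewrite /k; ring.
have aE : adapted (N *m E0).
  apply: (adapted_change aE0 tN).
  - move=> a b c d; rewrite /t -row4_0 => /row4_inj[-> -> h1 h2].
    by have [-> ->] := tinj _ _ h1 h2.
  - by rewrite /t; congr row4; ring.
  - by rewrite /t; congr row4; ring.
  - move=> a b c d; rewrite -/(pt E0 _ _ _ _) hl.
    apply/andP/andP => -[/eqP h1 /eqP h2]; last by rewrite h1 h2 !mul0r addr0 eqxx.
    by have [-> ->] := tinj _ _ h1 h2; rewrite eqxx.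
have [n' [m' [ca' [cb' [cc' [cd' [ce' [cg' fE']]]]]]]] := expand _ aE.
exists (N *m E0), ca', cb', cc', cd', ce', cg'; split=> // a b c d.
have ptE c1 d1 : pt (N *m E0) a b c1 d1 = pt E0 a b (c1 * (p' / k') + d1 * (p / k))
    (c1 * (q' / k') + d1 * (q / k)) by rewrite /pt mulmxA tN.
(* The linear part is read off along the two coordinate directions. *)
have lin u v : forall r s, (forall w, f.@[(pt (N *m E0) a b (w * u) (w * v)) 0]
      = f.@[(pt E0 a b (w * r) (w * s)) 0]) ->
    u * bcubic n' a b + v * bcubic m' a b = r * bcubic n a b + s * bcubic m a b.
  move=> r s h; apply/eqP; rewrite -subr_eq0; apply/eqP.
  have P0 : forall w, w != 0 -> (Poly [:: 0;
     u * bcubic n' a b + v * bcubic m' a b - (r * bcubic n a b + s * bcubic m a b);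
     a ^+ 2 * bquad ca' u v + a * b * bquad cb' u v + b ^+ 2 * bquad cc' u v
     - (a ^+ 2 * bquad ca r s + a * b * bquad cb r s + b ^+ 2 * bquad cc r s);
     a * bcubic cd' u v + b * bcubic ce' u v - (a * bcubic cd r s + b * bcubic ce r s);
     bquartic cg' u v - bquartic cg r s]).[w] = 0.
    move=> w _; have := h w; rewrite fE fE' !higher_part_plane /fiber_higher_part.
    move=> /eqP; rewrite -subr_eq0 => /eqP e; rewrite horner_Poly /=.
    by apply: etrans e; ring.
  exact: (coef_eq0_of_horner P0 1).
have ln : bcubic n' a b = a ^+ 3.
  have := @lin 1 0 (p' / k') (q' / k').
  rewrite mul1r mul0r addr0 => ->; last first.
    by move=> w; rewrite ptE; congr (_.@[_]); congr (pt _ _ _ _ _ _); ring.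
  transitivity ((k' * a ^+ 3 + (p' * n 1%N + q' * m 1%N) * (a ^+ 2 * b)
    + (p' * n 2%N + q' * m 2%N) * (a * b ^+ 2)
    + (p' * n 3%N + q' * m 3%N) * b ^+ 3) / k'); first by rewrite /bcubic /k'; ring.
  by rewrite k1' k2' k3' !mul0r !addr0 mulrC mulKf.
have lm : bcubic m' a b = b ^+ 3.
  have := @lin 0 1 (p / k) (q / k).
  rewrite mul1r mul0r add0r => ->; last first.
    by move=> w; rewrite ptE; congr (_.@[_]); congr (pt _ _ _ _ _ _); ring.
  transitivity ((k * b ^+ 3 + (p * n 2%N + q * m 2%N) * (a * b ^+ 2)
    + (p * n 1%N + q * m 1%N) * (a ^+ 2 * b)
    + (p * n 0%N + q * m 0%N) * a ^+ 3) / k); first by rewrite /bcubic /k; ring.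
  by rewrite k0 k1 k2 !mul0r !addr0 mulrC mulKf.
by rewrite fE' ln lm.
Qed.

(** The second kind relations say that the coefficients of a^2, b^2, a and b are
    those produced by translating a by s0 c + s1 d and b by t1 c + t2 d.  The
    inverse translation removes them. *)
Theorem second_kind_normal_form :
  ramification_index f l P1 3 -> ramification_index f l P2 3 -> second_kind f l ->
  exists (E : 'M[K]_4) (B G : nat -> K), adapted E /\
    forall a b c d, f.@[(pt E a b c d) 0]
      = c * a ^+ 3 + d * b ^+ 3 + a * b * bquad B c d + bquartic G c d.
Proof.
move=> r1 r2 sk.
have [E0 [ca [cb [cc [cd [ce [cg [aE0 fE]]]]]]]] := normal_linear_part r1 r2.
case: (aE0) => hE e1 e2 hl.
have [a2 c0 [d0 d1 d2 d3] [h0 h1 h2 h3]] := second_kind_coefficients ch2 ch3 hE hl fE sk.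
pose s0 := ca 0%N / 3%:R; pose s1 := ca 1%N / 3%:R.
pose t1 := cc 1%N / 3%:R; pose t2 := cc 2%N / 3%:R.
have third (x : K) : x = 3%:R * (x / 3%:R) by rewrite mulrC divfK.
have as0 : ca 0%N = 3%:R * s0 := third _.
have as1 : ca 1%N = 3%:R * s1 := third _.
have ct1 : cc 1%N = 3%:R * t1 := third _.
have ct2 : cc 2%N = 3%:R * t2 := third _.
have {}d0 : cd 0%N = 3%:R * s0 ^+ 2 + cb 0%N * t1.
  by apply: (mulfI ch3); rewrite d0 as0 ct1; ring.
have {}d1 : cd 1%N = 6%:R * (s0 * s1) + cb 1%N * t1 + cb 0%N * t2.
  by apply: (mulfI ch3); rewrite d1 as0 as1 ct1 ct2; ring.
have {}d2 : cd 2%N = 3%:R * s1 ^+ 2 + cb 2%N * t1 + cb 1%N * t2.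
  by apply: (mulfI ch3); rewrite d2 as1 ct1 ct2; ring.
have {}d3 : cd 3%N = cb 2%N * t2.
  by apply: (mulfI ch3); rewrite d3 ct2; ring.
have {}h0 : ce 0%N = s0 * cb 0%N.
  by apply: (mulfI ch3); rewrite h0 as0; ring.
have {}h1 : ce 1%N = 3%:R * t1 ^+ 2 + s0 * cb 1%N + s1 * cb 0%N.
  by apply: (mulfI ch3); rewrite h1 as0 as1 ct1; ring.
have {}h2 : ce 2%N = 6%:R * (t1 * t2) + s0 * cb 2%N + s1 * cb 1%N.
  by apply: (mulfI ch3); rewrite h2 as0 as1 ct1 ct2; ring.
have {}h3 : ce 3%N = 3%:R * t2 ^+ 2 + s1 * cb 2%N.
  by apply: (mulfI ch3); rewrite h3 as1 ct2; ring.
pose N : 'M[K]_4 := \matrix_(i < 4) nth (0 : 'rV[K]_4) [:: row4 1 0 0 0;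
   row4 0 1 0 0; row4 (- s0) (- t1) 1 0; row4 (- s1) (- t2) 0 1] i.
pose t (a b c d : K) :=
  row4 (a - (s0 * c + s1 * d)) (b - (t1 * c + t2 * d)) c d.
have tN a b c d : row4 a b c d *m N = t a b c d.
  rewrite row4_mul !rowK /= !row4Z !row4D /t.
  by congr row4; ring.
pose r := s0 * t2 + s1 * t1.
exists (N *m E0), cb, (nth 0 [::
  cg 0%N - s0 ^+ 3 - cb 0%N * (s0 * t1);
  cg 1%N - 3%:R * (s0 ^+ 2 * s1) - t1 ^+ 3 - (cb 0%N * r + cb 1%N * (s0 * t1));
  cg 2%N - 3%:R * (s0 * s1 ^+ 2) - 3%:R * (t1 ^+ 2 * t2)
    - (cb 0%N * (s1 * t2) + cb 1%N * r + cb 2%N * (s0 * t1));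
  cg 3%N - s1 ^+ 3 - 3%:R * (t1 * t2 ^+ 2) - (cb 1%N * (s1 * t2) + cb 2%N * r);
  cg 4%N - t2 ^+ 3 - cb 2%N * (s1 * t2)]).
split.
  apply: (adapted_change aE0 tN).
  - move=> a b c d; rewrite /t -row4_0 => /row4_inj[+ + c00 d00].
    by rewrite c00 d00 !mulr0 !addr0 !subr0 => -> ->.
  - by rewrite /t; congr row4; ring.
  - by rewrite /t; congr row4; ring.
  - by move=> a b c d; rewrite -/(pt E0 _ _ _ _) hl.
move=> a b c d.
rewrite /pt mulmxA tN -/(pt E0 _ _ _ _) fE /higher_part /bquad /bcubic /bquartic /=.
rewrite a2 c0 d0 d1 d2 d3 h0 h1 h2 h3 as0 as1 ct1 ct2 /r; ring.
Qed.

End NormalForm.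

(** * An irreducibility criterion *)

Section Irreducibility.
Variables (K : closedFieldType) (n : nat).
Implicit Types (p q r F : {mpoly K[n]}) (i j : 'I_n).

(** Divisibility by 'X_j, in a form that can be checked on values. *)
Definition vanishes_on_axis j p : Prop :=
  forall v : 'rV[K]_n, v 0 j = 0 -> p.@[v 0] = 0.

Definition kill_var j : {mpoly K[n]} -> {mpoly K[n]} :=
  mmap (@mpolyC n K) (fun i => if i == j then 0 else 'X_i).
HB.instance Definition _ j := GRing.RMorphism.copy (kill_var j)
  (mmap (@mpolyC n K) (fun i => if i == j then 0 else 'X_i)).

Lemma meval_kill_var j p (v : 'rV[K]_n) :
  (kill_var j p).@[v 0] = p.@[(\row_i (if i == j then 0 else v 0 i)) 0].
Proof.
rewrite /kill_var rmorph_mmap; apply: eq_mmap => i /=; first by rewrite mevalC.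
by rewrite mxE; case: ifP => _; rewrite ?meval0 ?mevalXU.
Qed.

Lemma kill_var_eq0 j p : kill_var j p = 0 <-> vanishes_on_axis j p.
Proof.
split=> [e v vj|h].
  rewrite -[RHS](meval0 (v 0)) -e meval_kill_var; apply: meval_eq => i.
  by rewrite mxE; case: eqP => // ->.
by apply: meval_eq0 => v; rewrite meval_kill_var h // mxE eqxx.
Qed.

Lemma kill_varE j p : exists r, p = 'X_j * r + kill_var j p.
Proof.
elim/mpoly_alg_ind: p => [c|i|p q [r er] [s es]|p q [r er] [s es]].
- by exists 0; rewrite /kill_var mmapC mulr0 add0r.
- rewrite /kill_var mmapX mmap1U; case: eqP => [->|_].
    by exists 1; rewrite mulr1 addr0.
  by exists 0; rewrite mulr0 add0r.
- exists (r + s); rewrite rmorphD /= {1}er {1}es; ring.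
- exists ('X_j * r * s + r * kill_var j q + s * kill_var j p).
  rewrite rmorphM /= {1}er {1}es; ring.
Qed.

Lemma vanishes_on_axisP j p : vanishes_on_axis j p -> exists r, p = 'X_j * r.
Proof.
move/kill_var_eq0 => e; have [r er] := kill_varE j p.
by exists r; rewrite er e addr0.
Qed.

Lemma vanishes_on_axisM j p q : vanishes_on_axis j (p * q) ->
  vanishes_on_axis j p \/ vanishes_on_axis j q.
Proof.
move/kill_var_eq0/eqP; rewrite rmorphM mulf_eq0.
by case/orP => /eqP /kill_var_eq0; [left | right].
Qed.

(** The variables are prime and do not divide q, so they can be cancelled one at a
    time. *)
Lemma unit_of_dvd_variables (J : seq 'I_n) (c : K) q s : c != 0 ->
  (forall j, j \in J -> ~ vanishes_on_axis j q) ->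
  c%:MP * \prod_(j <- J) 'X_j = q * s -> q \is a GRing.unit.
Proof.
move=> c0; elim: J s => [|j J IH] s hJ.
  rewrite big_nil mulr1 => e; apply/unitrPr; exists (s * (c^-1)%:MP).
  by rewrite mulrA -e -mpolyCM mulfV.
rewrite big_cons mulrCA => e.
have : vanishes_on_axis j (q * s) by move=> v vj; rewrite -e mevalM mevalXU vj mul0r.
case/vanishes_on_axisM => [/hJ|/vanishes_on_axisP[r er]].
  by rewrite mem_head => /(_ isT).
apply: (IH r) => [k kJ|]; first by apply: hJ; rewrite in_cons kJ orbT.
apply: (@mulfI _ 'X_j); first by rewrite -msize_poly_eq0 msizeX mdeg1.
by rewrite e er mulrCA.
Qed.

Definition as_univariate i : {mpoly K[n]} -> {poly {mpoly K[n]}} :=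
  mmap (polyC \o @mpolyC n K) (fun j => if j == i then 'X else ('X_j)%:P).
HB.instance Definition _ i := GRing.RMorphism.copy (as_univariate i)
  (mmap (polyC \o @mpolyC n K) (fun j => if j == i then 'X else ('X_j)%:P)).

Lemma as_univariateX i j :
  as_univariate i 'X_j = if j == i then 'X else ('X_j)%:P.
Proof. by rewrite /as_univariate mmapX mmap1U. Qed.

Lemma as_univariateC i c : as_univariate i c%:MP = c%:MP%:P.
Proof. by rewrite /as_univariate mmapC. Qed.

Lemma as_univariateK i p : (as_univariate i p).['X_i] = p.
Proof.
rewrite -horner_evalE rmorph_mmap -[RHS]mmap_mpolyX; apply: eq_mmap => j /=.
  by rewrite horner_evalE hornerC.
by rewrite horner_evalE; case: eqP => [->|_]; rewrite ?hornerX ?hornerC.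
Qed.

(** Eisenstein's criterion for the reversed polynomial, with respect to a
    variable 'X_j that divides every coefficient but the constant one and divides
    the leading one only once: were both factors of positive degree, 'X_j would
    divide both of their leading coefficients.  A factor of degree zero is a
    unit, since it divides the leading coefficient, a product of variables none
    of which divides the constant one. *)
Lemma irreducible_reversed_eisenstein i j F (s : seq {mpoly K[n]}) (c : K)
    (J : seq 'I_n) :
  as_univariate i F = Poly s -> c != 0 -> j \in J -> uniq J ->
  last 0 s = c%:MP * \prod_(k <- J) 'X_k ->
  (forall k, k \in J -> ~ vanishes_on_axis k s`_0) ->
  (forall m, (0 < m)%N -> vanishes_on_axis j s`_m) ->
  F.@[(0 : 'rV[K]_n) 0] = 0 -> irreducible_mpoly F.
Proof.
move=> FE c0 jJ uJ slast s0 sm F0.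
have X0 k : 'X_k != 0 :> {mpoly K[n]} by rewrite -msize_poly_eq0 msizeX mdeg1.
have MPc : c%:MP != 0 :> {mpoly K[n]} by rewrite mpolyC_eq0.
have last0 : last 0 s != 0.
  by rewrite slast mulf_neq0 // prodf_seq_neq0; apply/allP => k _ /=.
have sn : s != [::] by apply: contraNneq last0 => ->.
have ps : Poly s = s :> seq _.
  case: (s) sn last0 => // a t _ h; apply: (PolyK (c := 1)).
  by move: h; rewrite /=; case: (t).
have lc : lead_coef (as_univariate i F) = last 0 s.
  by rewrite FE lead_coefE ps nth_last.
have Fn0 : F != 0.
  by apply: contraNneq last0 => F00; rewrite -lc F00 rmorph0 lead_coef0.
split=> //.
  apply/negP => /mulrV /(congr1 (meval ((0 : 'rV[K]_n) 0))).
  by rewrite mevalM F0 mul0r meval1 => /esym/eqP; rewrite oner_eq0.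
have deg0 q r : F = q * r -> (size (as_univariate i q) <= 1)%N ->
    q \is a GRing.unit.
  move=> Fqr /size1_polyC qc; set q0 := _`_0 in qc.
  have qq0 : q = q0 by rewrite -(as_univariateK i q) qc hornerC.
  have cf m : s`_m = q * (as_univariate i r)`_m.
    by rewrite -(coef_Poly s) -FE Fqr rmorphM /= qc coefCM -qq0.
  have e : c%:MP * \prod_(k <- J) 'X_k = q * (as_univariate i r)`_(size s).-1.
    by rewrite -slast -cf nth_last.
  apply: unit_of_dvd_variables e => // k kJ qk.
  by apply: (s0 k kJ) => v vk; rewrite cf mevalM qk // mul0r.
move=> q r Fqr; have [hq|hq] := leqP (size (as_univariate i q)) 1.
  by left; apply: deg0 Fqr hq.
have [hr|hr] := leqP (size (as_univariate i r)) 1.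
  by right; apply: deg0 hr; rewrite Fqr mulrC.
exfalso; pose phi := map_poly (kill_var j).
have phiF : phi (as_univariate i F) = (kill_var j s`_0)%:P.
  apply/polyP => m; rewrite coef_map_id0 ?rmorph0 // coefC FE coef_Poly.
  by case: eqP => [->//|/eqP m0]; apply/kill_var_eq0/sm; rewrite lt0n.
have phiFn : kill_var j s`_0 != 0 by apply/eqP => /kill_var_eq0; apply: s0.
have phiM : phi (as_univariate i q) * phi (as_univariate i r) = (kill_var j s`_0)%:P.
  by rewrite -phiF Fqr rmorphM /= /phi rmorphM.
have lead_killed p (p' : {poly {mpoly K[n]}}) : (1 < size (as_univariate i p))%N ->
    phi (as_univariate i p) * phi p' = (kill_var j s`_0)%:P ->
    vanishes_on_axis j (lead_coef (as_univariate i p)).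
  move=> sp e; apply/kill_var_eq0.
  rewrite lead_coefE -coef_map_id0 ?rmorph0 // -/(phi _).
  have : (size (phi (as_univariate i p)) <= 1)%N.
    have := congr1 (size \o val) e; rewrite /= size_polyC phiFn.
    have [->|n1] := eqVneq (phi (as_univariate i p)) 0; first by rewrite size_poly0.
    have [->|n2] := eqVneq (phi p') 0; first by rewrite mulr0 size_poly0.
    rewrite size_mul //; case: (size (phi p')) (size_poly_eq0 (phi p')) => [|k _].
      by rewrite (negPf n2).
    by rewrite addnS /=; case: (size _) => [|[|]].
  have sp1 : (0 < (size (as_univariate i p)).-1)%N by move: sp; case: (size _) => [|[|]].
  move=> sz; exact: nth_default (leq_trans sz sp1).
have [a ea] := vanishes_on_axisP (lead_killed _ _ hq phiM).
rewrite mulrC in phiM.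
have [b eb] := vanishes_on_axisP (lead_killed _ _ hr phiM).
have e : c%:MP * \prod_(k <- rem j J) 'X_k = 'X_j * (a * b).
  have pE : \prod_(k <- J) 'X_k = 'X_j * \prod_(k <- rem j J) 'X_k :> {mpoly K[n]}.
    by rewrite (big_rem j).
  apply: (mulfI (X0 j)); rewrite mulrCA -pE -slast -lc Fqr rmorphM /=.
  rewrite lead_coefM; transitivity (('X_j * a) * ('X_j * b)).
    by apply: f_equal2; [exact: ea | exact: eb].
  by rewrite -!mulrA; congr (_ * _); rewrite mulrCA.
have /eqP := congr1 (meval ((\row_k (if k == j then 0 else 1 : K)) 0)) e.
rewrite !mevalM mevalXU mxE eqxx mul0r mevalC rmorph_prod /= mulf_eq0 (negPf c0) /=.
apply/negP; rewrite prodf_seq_neq0; apply/allP => k; rewrite mem_rem_uniq // inE.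
by move=> /andP[/negPf kj _]; rewrite mevalXU mxE kj oner_eq0.
Qed.

End Irreducibility.

(** * The cubics p x^3 + q y^3 + b x y w + c w^3 *)

Section HesseCubics.
Variable K : closedFieldType.
Hypotheses (ch2 : 2%:R != 0 :> K) (ch3 : 3%:R != 0 :> K).

Lemma mul_power_eq0 (k z : K) n : k != 0 -> k * z ^+ n = 0 -> z = 0.
Proof.
by move=> k0 /eqP; rewrite mulf_eq0 (negPf k0) expf_eq0 => /andP[_ /eqP].
Qed.

Definition hesse_cubic (p q b c : K) : {mpoly K[3]} :=
  let x := 'X_(@Ordinal 3 0 isT) in let y := 'X_(@Ordinal 3 1 isT) in
  let w := 'X_(@Ordinal 3 2 isT) in
  p%:MP * x ^+ 3 + q%:MP * y ^+ 3 + b%:MP * (x * y * w) + c%:MP * w ^+ 3.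

Lemma meval_hesse p q b c x y w : (hesse_cubic p q b c).@[(row3 x y w) 0] =
  p * x ^+ 3 + q * y ^+ 3 + b * (x * y * w) + c * w ^+ 3.
Proof.
by rewrite /hesse_cubic !(mevalD, mevalM, rmorphXn, mevalC) /= !mevalXU !mxE.
Qed.

Lemma line_restriction_hesse p q b c x y w x' y' w' :
  line_restriction (hesse_cubic p q b c) (row3 x y w) (row3 x' y' w') = Poly
  [:: p * x ^+ 3 + q * y ^+ 3 + b * (x * y * w) + c * w ^+ 3;
      x' * (3%:R * (p * x ^+ 2) + b * (y * w)) + y' * (3%:R * (q * y ^+ 2) + b * (x * w))
      + w' * (b * (x * y) + 3%:R * (c * w ^+ 2));
      3%:R * (p * x * x' ^+ 2 + q * y * y' ^+ 2 + c * w * w' ^+ 2)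
      + b * (x * y' * w' + y * x' * w' + w * x' * y');
      p * x' ^+ 3 + q * y' ^+ 3 + b * (x' * y' * w') + c * w' ^+ 3].
Proof.
apply: line_restrictionE => t; rewrite row3Z row3D meval_hesse horner_Poly /=; ring.
Qed.

Lemma singular_hesse p q b c x y w :
  singular_point (hesse_cubic p q b c) (row3 x y w) <->
  [/\ row3 x y w != 0, 3%:R * (p * x ^+ 2) + b * (y * w) = 0,
      3%:R * (q * y ^+ 2) + b * (x * w) = 0 & b * (x * y) + 3%:R * (c * w ^+ 2) = 0].
Proof.
have gr x' y' w' : dot (row3 x' y' w') (gradient (hesse_cubic p q b c) (row3 x y w)) =
    x' * (3%:R * (p * x ^+ 2) + b * (y * w)) + y' * (3%:R * (q * y ^+ 2) + b * (x * w))
      + w' * (b * (x * y) + 3%:R * (c * w ^+ 2)).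
  by rewrite -coef1_line_restriction line_restriction_hesse coef_Poly.
split=> [[u0 _ g0]|[u0 e1 e2 e3]].
  have h x' y' w' := gr x' y' w'; rewrite g0 in h.
  split=> //.
  - by have := h 1 0 0; rewrite dot0r !mul0r !addr0 mul1r.
  - by have := h 0 1 0; rewrite dot0r !mul0r addr0 add0r mul1r.
  - by have := h 0 0 1; rewrite dot0r !mul0r !add0r mul1r.
split=> //.
  rewrite /on_hypersurface meval_hesse; apply: (mulfI ch3); rewrite mulr0.
  transitivity (x * (3%:R * (p * x ^+ 2) + b * (y * w))
    + y * (3%:R * (q * y ^+ 2) + b * (x * w)) + w * (b * (x * y) + 3%:R * (c * w ^+ 2))).
    ring.
  by rewrite e1 e2 e3 !mulr0 !addr0.
apply: dot_ext => z; have [x' [y' [w' ->]]] := row3_surj z.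
by rewrite gr e1 e2 e3 !mulr0 !addr0 dot0r.
Qed.

(** Multiplied by x, y and w, the partial derivatives say that 3 p x^3, 3 q y^3 and
    3 c w^3 all equal - b x y w.  The relation follows from the product of these
    equalities. *)
Lemma singular_hesse_discriminant p q b c : p != 0 -> q != 0 ->
  (exists u, singular_point (hesse_cubic p q b c) u) ->
  c = 0 \/ b ^+ 3 + 27%:R * (p * q * c) = 0.
Proof.
move=> p0 q0 [u]; have [x [y [w ->]]] := row3_surj u.
move=> /singular_hesse[u0 e1 e2 e3].
have [->|c0] := eqVneq c 0; [by left | right].
set s := b * (x * y * w).
have h1 : 3%:R * (p * x ^+ 3) = - s.
  by apply/eqP; rewrite -addr_eq0 -[X in _ == X](mulr0 x) -e1 /s; apply/eqP; ring.
have h2 : 3%:R * (q * y ^+ 3) = - s.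
  by apply/eqP; rewrite -addr_eq0 -[X in _ == X](mulr0 y) -e2 /s; apply/eqP; ring.
have h3 : 3%:R * (c * w ^+ 3) = - s.
  by apply/eqP; rewrite -addr_eq0 -[X in _ == X](mulr0 w) -e3 /s; apply/eqP; ring.
have cube0 (k z : K) : k != 0 -> 3%:R * (k * z ^+ 3) = 0 -> z = 0.
  by move=> k0; rewrite mulrA; apply: mul_power_eq0; rewrite mulf_neq0.
have [xyw|xyw] := eqVneq (x * y * w) 0.
  rewrite /s xyw mulr0 oppr0 in h1 h2 h3.
  by move: u0; rewrite (cube0 _ _ p0 h1) (cube0 _ _ q0 h2) (cube0 _ _ c0 h3) row3_0 eqxx.
apply: (mulfI (_ : (x * y * w) ^+ 3 != 0)); first by rewrite expf_neq0.
transitivity (s ^+ 3 + (3%:R * (p * x ^+ 3)) * (3%:R * (q * y ^+ 3))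
   * (3%:R * (c * w ^+ 3))); first by rewrite /s; ring.
rewrite h1 h2 h3; ring.
Qed.

(** For w = 0 the partial derivatives in x and y reduce to 3 p x^2 and 3 q y^2. *)
Lemma singular_hesse_on_line p q b c x y : (p != 0) || (q != 0) ->
  singular_point (hesse_cubic p q b c) (row3 x y 0) -> p = 0 /\ q != 0 \/ q = 0 /\ p != 0.
Proof.
move=> pq /singular_hesse[]; rewrite row3_neq0 eqxx orbF !mulr0 !addr0 ![3%:R * (_ * _ ^+ 2)]mulrA.
move=> u0 h1 h2 _.
have [p0|p0] := eqVneq p 0; first by left; rewrite p0 eqxx in pq.
have [q0|q0] := eqVneq q 0; first by right.
have x0 : x = 0 by apply: mul_power_eq0 h1; rewrite mulf_neq0.
have y0 : y = 0 by apply: mul_power_eq0 h2; rewrite mulf_neq0.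
by rewrite x0 y0 eqxx in u0.
Qed.

(** A line other than w = 0 on the cubic cuts w = 0 in a root of p x^3 + q y^3
    = 0, and passes through a point with w = 1.  In the expansion of the cubic
    along it the coefficient of every power of the parameter vanishes. *)
Lemma line_on_hesse_cubic p q b c x y x' y' : p != 0 -> q != 0 -> row3 x y 0 != 0 ->
  (forall t, (hesse_cubic p q b c).@[(row3 (x' + t * x) (y' + t * y) 1) 0] = 0) ->
  b ^+ 3 + 27%:R * (p * q * c) = 0.
Proof.
move=> p0 q0 u0 h.
have lr : line_restriction (hesse_cubic p q b c) (row3 x' y' 1) (row3 x y 0) = 0.
  by apply: line_restrictionE => t; rewrite row3Z row3D mulr0 addr0 h horner0.
move: lr; rewrite line_restriction_hesse => lr.
have cf i := congr1 (fun P : {poly K} => P`_i) lr.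
have {cf} [] := And4 (cf 0%N) (cf 1%N) (cf 2%N) (cf 3%N).
rewrite !coef_Poly !coef0 /= => e0 e1 e2 e3.
have {}e3 : q * y ^+ 3 = - (p * x ^+ 3).
  by apply/eqP; rewrite -addr_eq0 -e3; apply/eqP; ring.
have x0 : x != 0.
  apply/eqP => x0; move: u0; rewrite row3_neq0 eqxx orbF x0 eqxx /=.
  apply/negP; rewrite negbK; move: e3; rewrite x0 expr0n /= mulr0 oppr0 => /(mul_power_eq0 q0) ->; exact: eqxx.
(* The point with y' = 0 on the line has first coordinate r / y. *)
pose r := x' * y - y' * x.
have r2 : 3%:R * (p * x * r) = - (b * y ^+ 2).
  apply: (mulfI x0); apply/eqP; rewrite -subr_eq0; apply/eqP.
  transitivity (y * (3%:R * (p * x' * x ^+ 2 + q * y' * y ^+ 2 + c * 1 * 0 ^+ 2) +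
     b * (x' * y * 0 + y' * x * 0 + 1 * x * y)) - 3%:R * y' * (q * y ^+ 3 + p * x ^+ 3)).
    by rewrite /r; ring.
  by rewrite e2 e3; ring.
have r0 : p * r ^+ 3 + c * y ^+ 3 = 0.
  transitivity (y ^+ 3 * (p * x' ^+ 3 + q * y' ^+ 3 + b * (x' * y' * 1) + c * 1 ^+ 3)
    - y' * y ^+ 2 * (x * (3%:R * (p * x' ^+ 2) + b * (y' * 1))
      + y * (3%:R * (q * y' ^+ 2) + b * (x' * 1)) + 0 * (b * (x' * y') + 3%:R * (c * 1 ^+ 2)))
    + y' ^+ 2 * y * (3%:R * (p * x' * x ^+ 2 + q * y' * y ^+ 2 + c * 1 * 0 ^+ 2) +
     b * (x' * y * 0 + y' * x * 0 + 1 * x * y)) - y' ^+ 3 * (q * y ^+ 3 + p * x ^+ 3)).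
    by rewrite /r; ring.
  by rewrite e0 e1 e2 e3; ring.
have y0 : y != 0.
  apply: contraNneq x0 => y0; apply/eqP; move/esym/eqP: e3.
  by rewrite y0 expr0n /= mulr0 oppr_eq0 => /eqP /(mul_power_eq0 p0).
apply: (mulfI (_ : y ^+ 6 != 0)); first by rewrite expf_neq0.
rewrite mulr0.
transitivity (27%:R * (p * q * y ^+ 3) * (p * r ^+ 3 + c * y ^+ 3)
  - 27%:R * p ^+ 2 * r ^+ 3 * (q * y ^+ 3 + p * x ^+ 3)
  + ((b * y ^+ 2) ^+ 3 + (3%:R * (p * x * r)) ^+ 3)); first by ring.
rewrite r0 r2 e3; ring.
Qed.

(** Three concurrent lines form a cone, which is invariant under translation by
    its vertex. *)
Lemma type_IV_vertex (g : {mpoly K[3]}) : kodaira_type g IV ->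
  exists2 z : 'rV[K]_3, z != 0 & forall u : 'rV[K]_3, g.@[(z + u) 0] = g.@[u 0].
Proof.
case=> c1 [c2 [c3 [[_ _ ->] nz]]].
exists (vpick (hyperplane c1 :&: hyperplane c2 :&: hyperplane c3)%VS).
  by rewrite vpick0.
move=> u; have := memv_pick (hyperplane c1 :&: hyperplane c2 :&: hyperplane c3)%VS.
rewrite !memv_cap !mem_hyperplane => /andP[/andP[/eqP h1 /eqP h2] /eqP h3].
by rewrite !mevalM !meval_linform !dotDl h1 h2 h3 !add0r.
Qed.

(** The mixed second differences of the cubic at a vertex z give b z = 0. *)
Lemma hesse_vertex p q b c (z : 'rV[K]_3) : z != 0 ->
  (forall u : 'rV[K]_3, (hesse_cubic p q b c).@[(z + u) 0]
     = (hesse_cubic p q b c).@[u 0]) -> b = 0.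
Proof.
have [x [y [w ->]]] := row3_surj z => z0 h.
pose F x1 y1 w1 := p * (x + x1) ^+ 3 + q * (y + y1) ^+ 3
  + b * ((x + x1) * (y + y1) * (w + w1)) + c * (w + w1) ^+ 3.
have {}h x1 y1 w1 : F x1 y1 w1 =
    p * x1 ^+ 3 + q * y1 ^+ 3 + b * (x1 * y1 * w1) + c * w1 ^+ 3.
  by rewrite /F; have := h (row3 x1 y1 w1); rewrite row3D !meval_hesse.
have bx : b * x = 0.
  transitivity (F 0 1 1 - F 0 0 1 - F 0 1 0 + F 0 0 0); first by rewrite /F; ring.
  by rewrite !h; ring.
have b_y : b * y = 0.
  transitivity (F 1 0 1 - F 0 0 1 - F 1 0 0 + F 0 0 0); first by rewrite /F; ring.
  by rewrite !h; ring.
have bw : b * w = 0.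
  transitivity (F 1 1 0 - F 1 0 0 - F 0 1 0 + F 0 0 0); first by rewrite /F; ring.
  by rewrite !h; ring.
move: z0; rewrite row3_neq0 => nz; apply/eqP; move: bx b_y bw.
move=> /eqP + /eqP + /eqP; rewrite !mulf_eq0; case: (b == 0) => //=.
by move=> /eqP x0 /eqP y0 /eqP w0; rewrite x0 y0 w0 eqxx in nz.
Qed.

End HesseCubics.

(** * Cubics that split into three lines *)

Section ThreeLines.
Variables (K : closedFieldType) (om al de ep : K).
Hypotheses (ch3 : 3%:R != 0 :> K) (om2 : om ^+ 2 + om + 1 = 0) (om1 : om != 1).

(** The factor X + z Y + z^2 W of X^3 + Y^3 + W^3 - 3 X Y W, for X = al x, Y = de y,
    W = ep w and z a cube root of unity. *)
Definition tri_form z : 'cV[K]_3 := col3 al (z * de) (z ^+ 2 * ep).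

Lemma om_cube : om ^+ 3 = 1.
Proof.
by apply/eqP; rewrite -subr_eq0; apply/eqP; rewrite -[RHS](mulr0 (om - 1)) -om2; ring.
Qed.

Lemma om_sq_neq1 : om ^+ 2 != 1.
Proof.
by apply: contraNneq om1 => h; apply/eqP; rewrite -om_cube exprS h mulr1.
Qed.

Lemma om_sq_neq : om ^+ 2 != om.
Proof.
have om0 : om != 0 by apply/eqP => e; move: om2; rewrite e expr0n /= !add0r => /eqP; rewrite oner_eq0.
by apply: contraNneq om1 => h; apply/eqP/(mulfI om0); rewrite mulr1 -expr2.
Qed.

Definition unity_roots : seq K := [:: 1; om; om ^+ 2].

Lemma unity_roots_uniq : uniq unity_roots.
Proof.
by rewrite /= !inE negb_or eq_sym om1 eq_sym om_sq_neq1 eq_sym om_sq_neq.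
Qed.

Lemma unity_roots_cube z : z \in unity_roots -> z ^+ 3 = 1.
Proof.
rewrite !inE => /or3P[] /eqP->; rewrite ?expr1n ?om_cube //.
by rewrite exprAC om_cube expr1n.
Qed.

Lemma dot_tri_form z x y w :
  dot (row3 x y w) (tri_form z) = al * x + z * de * y + z ^+ 2 * ep * w.
Proof. by rewrite dot_row3; ring. Qed.

Lemma prod_tri_form x y w :
  \prod_(z <- unity_roots) dot (row3 x y w) (tri_form z) =
  (al * x) ^+ 3 + (de * y) ^+ 3 + (ep * w) ^+ 3 - 3%:R * (al * x * (de * y) * (ep * w)).
Proof.
rewrite !big_cons big_nil !dot_tri_form mulr1.
have e : om * (1 + om) = -1.
  by apply/eqP; rewrite -addr_eq0 -om2; apply/eqP; ring.
have e2 : om ^+ 2 = - (1 + om).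
  by apply/eqP; rewrite -addr_eq0 -om2; apply/eqP; ring.
have e4 : (om ^+ 2) ^+ 2 = om by rewrite -exprM exprS om_cube mulr1.
set A := al * x.
rewrite e4 e2 !expr1n !mul1r.
transitivity ((A + de * y + ep * w) * (A ^+ 2 - A * (de * y) - A * (ep * w)
  - (om * (1 + om)) * ((de * y) ^+ 2 + (ep * w) ^+ 2)
  + (2%:R * (om * (1 + om)) + 1) * (de * y * (ep * w)))); first by ring.
rewrite e; ring.
Qed.

Lemma hesse_tri : hesse_cubic (al ^+ 3) (de ^+ 3) (- (3%:R * (al * de * ep))) (ep ^+ 3)
  = linform (tri_form 1) * linform (tri_form om) * linform (tri_form (om ^+ 2)).
Proof.
apply: meval_inj => u; have [x [y [w ->]]] := row3_surj u.
rewrite meval_hesse !mevalM !meval_linform.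
have := prod_tri_form x y w; rewrite !big_cons big_nil mulr1 mulrA => ->; ring.
Qed.

Hypothesis two_nonzero :
  [|| (al != 0) && (de != 0), (al != 0) && (ep != 0) | (de != 0) && (ep != 0)].

Lemma tri_form_neq0 z : z \in unity_roots -> tri_form z != 0.
Proof.
move=> /unity_roots_cube z3; have z0 : z != 0.
  by apply/eqP => e; move: z3; rewrite e expr0n /= => /esym/eqP; rewrite oner_eq0.
have z20 : z ^+ 2 != 0 by rewrite expf_neq0.
rewrite col3_neq0 (mulf_eq0 z) (mulf_eq0 (z ^+ 2)) (negPf z0) (negPf z20) /=.
by move: two_nonzero; case: (al == 0); case: (de == 0); case: (ep == 0).
Qed.

Lemma tri_form_separated z z' : z \in unity_roots -> z' \in unity_roots -> z != z' ->
  exists x y w, dot (row3 x y w) (tri_form z) = 0 /\ dot (row3 x y w) (tri_form z') != 0.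
Proof.
move=> zu zu' zz'; have z3 := unity_roots_cube zu; have z3' := unity_roots_cube zu'.
have sq : z ^+ 2 - z' ^+ 2 != 0.
  rewrite subr_eq0; apply: contraNneq zz' => e; apply/eqP.
  by rewrite -[z]mulr1 -z3 -exprS (exprM z 2 2) e -exprM exprS z3' mulr1.
have nz (t : K) : t ^+ 3 = 1 -> t != 0.
  by move=> h; apply/eqP => e; move: h; rewrite e expr0n /= => /esym/eqP; rewrite oner_eq0.
have zd : z - z' != 0 by rewrite subr_eq0.
have [z0 z0'] := (nz _ z3, nz _ z3').
case/or3P: two_nonzero => /andP[h1 h2].
- exists (z * de), (- al), 0; rewrite !dot_tri_form; split; first by ring.
  by rewrite (_ : _ + _ = (z - z') * (al * de)) ?mulf_neq0 //; ring.
- exists (z ^+ 2 * ep), 0, (- al); rewrite !dot_tri_form; split; first by ring.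
  by rewrite (_ : _ + _ = (z ^+ 2 - z' ^+ 2) * (al * ep)) ?mulf_neq0 //; ring.
- exists 0, (z ^+ 2 * ep), (- (z * de)); rewrite !dot_tri_form; split; first by ring.
  by rewrite (_ : _ + _ = z * z' * (z - z') * (de * ep)) ?mulf_neq0 //; ring.
Qed.

Lemma tri_hyperplanes_uniq :
  uniq [:: hyperplane (tri_form 1); hyperplane (tri_form om); hyperplane (tri_form (om ^+ 2))].
Proof.
rewrite -[X in uniq X]/[seq hyperplane (tri_form z) | z <- unity_roots].
rewrite map_inj_in_uniq ?unity_roots_uniq // => z z' zu zu' e.
apply/eqP/negPn/negP => /(tri_form_separated zu zu')[x [y [w [h0 h1]]]].
by move: h1; rewrite -mem_hyperplane -e mem_hyperplane h0 eqxx.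
Qed.

Lemma hesse_three_lines : three_lines
  (hesse_cubic (al ^+ 3) (de ^+ 3) (- (3%:R * (al * de * ep))) (ep ^+ 3))
  (tri_form 1) (tri_form om) (tri_form (om ^+ 2)).
Proof.
split; [|exact: tri_hyperplanes_uniq|exact: hesse_tri].
by split; apply: tri_form_neq0; rewrite !inE eqxx ?orbT.
Qed.

Lemma hesse_tri_IV : al * de * ep = 0 -> kodaira_type
  (hesse_cubic (al ^+ 3) (de ^+ 3) (- (3%:R * (al * de * ep))) (ep ^+ 3)) IV.
Proof.
move=> e0; exists (tri_form 1), (tri_form om), (tri_form (om ^+ 2)).
split; first exact: hesse_three_lines.
have cap x y w : row3 x y w != 0 -> al * x = 0 -> de * y = 0 -> ep * w = 0 ->
    (hyperplane (tri_form 1) :&: hyperplane (tri_form om)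
      :&: hyperplane (tri_form (om ^+ 2)))%VS != 0%VS.
  move=> u0 h1 h2 h3; apply: contraNneq u0 => e.
  rewrite -memv0 -e !memv_cap !mem_hyperplane !dot_tri_form h1 -!mulrA h2 h3.
  by rewrite !mulr0 !addr0 eqxx.
move/eqP: e0; rewrite !mulf_eq0 => /orP[/orP[]|] /eqP h.
- by apply: (cap 1 0 0); rewrite ?row3_neq0 ?oner_eq0 ?h ?mulr0 ?mul0r ?orbT.
- by apply: (cap 0 1 0); rewrite ?row3_neq0 ?oner_eq0 ?h ?mulr0 ?mul0r ?orbT.
- by apply: (cap 0 0 1); rewrite ?row3_neq0 ?oner_eq0 ?h ?mulr0 ?mul0r ?orbT.
Qed.

Lemma hesse_tri_I3 : al * de * ep != 0 -> kodaira_type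
  (hesse_cubic (al ^+ 3) (de ^+ 3) (- (3%:R * (al * de * ep))) (ep ^+ 3)) I3.
Proof.
move=> e0; exists (tri_form 1), (tri_form om), (tri_form (om ^+ 2)).
split; first exact: hesse_three_lines.
apply/eqP; rewrite -subv0; apply/subvP => u.
rewrite !memv_cap !mem_hyperplane; have [x [y [w ->]]] := row3_surj u.
rewrite !dot_tri_form !expr1n !mul1r => /andP[/andP[/eqP h1 /eqP h2] /eqP h3].
move: e0; rewrite !mulf_eq0 !negb_or => /andP[/andP[a0 d0] p0].
have e2 : om ^+ 2 = - (1 + om).
  by apply/eqP; rewrite -addr_eq0 -om2; apply/eqP; ring.
have e4 : (om ^+ 2) ^+ 2 = om by rewrite -exprM exprS om_cube mulr1.
rewrite e4 e2 in h2 h3.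
have x0 : x = 0.
  apply: (mulfI (_ : 3%:R * al != 0)); first by rewrite mulf_neq0.
  by rewrite mulr0 -[RHS](addr0 0) -{1}h1 -[X in _ + X](addr0 0) -{1}h2 -h3; ring.
have w0 : w = 0.
  have d : (om - om ^+ 2) * ep != 0.
    by rewrite mulf_neq0 // subr_eq0 eq_sym om_sq_neq.
  apply: (mulfI d); rewrite mulr0 e2.
  rewrite x0 mulr0 add0r in h1 h2.
  by rewrite -[RHS](subr0 0) -{1}(mulr0 om) -{1}h1 -h2; ring.
have y0 : y = 0.
  by apply: (mulfI d0); rewrite mulr0 -h1 x0 w0 !mulr0 addr0 add0r.
by rewrite x0 y0 w0 row3_0 mem0v.
Qed.

End ThreeLines.

(** * Segre decompositions and fibres of type IV of the normal form *)

Section NormalFormFibers.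
Variables (K : closedFieldType) (f : {mpoly K[4]}) (l : {vspace 'rV[K]_4}).
Variables (E : 'M[K]_4) (B G : nat -> K).
Hypotheses (ch2 : 2%:R != 0 :> K) (ch3 : 3%:R != 0 :> K).
Hypothesis hE : E \in unitmx.
Hypothesis hl : forall a b c d, (pt E a b c d \in l) = (c == 0) && (d == 0).
Hypothesis fE : forall a b c d, f.@[(pt E a b c d) 0]
  = c * a ^+ 3 + d * b ^+ 3 + a * b * bquad B c d + bquartic G c d.

Definition nf_fiber p q := hesse_cubic p q (bquad B p q) (bquartic G p q).

Lemma nf_fiberE p q x y w :
  f.@[(pt E x y (w * p) (w * q)) 0] = w * (nf_fiber p q).@[(row3 x y w) 0].
Proof. by rewrite fE meval_hesse /bquad /bquartic; ring. Qed.

(** Type IV makes B vanish at the slope of the plane, and a vertex on l makes this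
    slope one of the two totally ramified ones. *)
Lemma IV_fiber_singular_onP H : IV_fiber_singular_on f l H ->
  (H = plane E 0 1 /\ B 2%N = 0) \/ (H = plane E 1 0 /\ B 0%N = 0).
Proof.
case=> M [g [fib tIV [u sing ul]]].
have [p [q [T [Tu nz eM -> gT]]]] := fiberP hE hl nf_fiberE fib.
have b0 : bquad B p q = 0.
  have [z z0 hz] := type_IV_vertex tIV.
  apply: (@hesse_vertex K p q _ (bquartic G p q) (z *m T)).
    by rewrite mulmx_free_eq0 ?row_free_unit.
  move=> v; have -> : v = (v *m invmx T) *m T by rewrite mulmxKV.
  by rewrite -mulmxDl -!gT hz.
have [x [y [w eu]]] := row3_surj (u *m T).
have w0 : w = 0.
  move: ul; rewrite eM mulmxA eu row3_frame hl !mulf_eq0 -orb_andr.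
  by rewrite -(negbK (_ && _)) negb_and nz orbF => /eqP.
move/(singular_point_change Tu gT): sing; rewrite eu w0 => sing.
case: (singular_hesse_on_line ch3 nz sing) => -[p0 q0].
  left; split; first by apply/eqP; rewrite eq_plane ?oner_eq0 ?orbT // p0 mul0r mulr0 q0 orbT eqxx.
  move: b0; rewrite p0 /bquad mul0r expr0n /= !mulr0 !add0r => /eqP.
  by rewrite mulf_eq0 expf_eq0 (negPf q0) orbF => /eqP.
right; split; first by apply/eqP; rewrite eq_plane ?oner_eq0 // p0 mul0r mulr0 q0 eqxx.
move: b0; rewrite p0 /bquad mulr0 expr0n /= !mulr0 !addr0 => /eqP.
by rewrite mulf_eq0 expf_eq0 (negPf q0) orbF => /eqP.
Qed.

Lemma two_IV_fibers H1 H2 : H1 != H2 -> IV_fiber_singular_on f l H1 ->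
  IV_fiber_singular_on f l H2 -> B 0%N = 0 /\ B 2%N = 0.
Proof.
move=> n12 /IV_fiber_singular_onP[] [e1 h1] /IV_fiber_singular_onP[] [e2 h2] //.
  by rewrite e1 e2 eqxx in n12.
by rewrite e1 e2 eqxx in n12.
Qed.

Lemma form_through_line (c : 'cV[K]_4) : (l <= hyperplane c)%VS ->
  forall x y a b, dot (pt E x y a b) c =
    a * dot (pt E 0 0 1 0) c + b * dot (pt E 0 0 0 1) c.
Proof.
move=> /subvP lc x y a b.
have -> : pt E x y a b = pt E x y 0 0 + a *: pt E 0 0 1 0 + b *: pt E 0 0 0 1.
  by rewrite !ptZ !ptD; congr pt; ring.
have /eqP h : dot (pt E x y 0 0) c == 0 by rewrite -mem_hyperplane lc // hl eqxx.
by rewrite !dotDl !dotZl h add0r.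
Qed.

Lemma product_of_forms_through_line (L : 4.-tuple 'cV[K]_4) :
  (forall c, c \in L -> (l <= hyperplane c)%VS) ->
  exists h, forall x y a b, \prod_(c <- L) dot (pt E x y a b) c = bquartic h a b.
Proof.
case: L => -[|c1 [|c2 [|c3 [|c4 []]]]] //= sz hc.
pose m c := dot (pt E 0 0 1 0) c; pose n c := dot (pt E 0 0 0 1) c.
exists (nth 0 [:: m c1 * m c2 * m c3 * m c4;
  n c1 * m c2 * m c3 * m c4 + m c1 * n c2 * m c3 * m c4 + m c1 * m c2 * n c3 * m c4
    + m c1 * m c2 * m c3 * n c4;
  n c1 * n c2 * m c3 * m c4 + n c1 * m c2 * n c3 * m c4 + n c1 * m c2 * m c3 * n c4
    + m c1 * n c2 * n c3 * m c4 + m c1 * n c2 * m c3 * n c4 + m c1 * m c2 * n c3 * n c4;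
  m c1 * n c2 * n c3 * n c4 + n c1 * m c2 * n c3 * n c4 + n c1 * n c2 * m c3 * n c4
    + n c1 * n c2 * n c3 * m c4;
  n c1 * n c2 * n c3 * n c4]) => x y a b.
rewrite [RHS]/bquartic /= !big_cons big_nil !(@form_through_line _ _ x y a b);
  try by apply: hc; rewrite !inE eqxx ?orbT.
by rewrite -!/(m _) -!/(n _); ring.
Qed.

Lemma lines_meeting_l m : \dim m = 2%N -> meets_line l m ->
  exists x y, row3 x y 0 != 0 /\ pt E x y 0 0 \in m.
Proof.
move=> dm [ml cap]; have := memv_pick (m :&: l)%VS.
have : vpick (m :&: l)%VS != 0 by rewrite vpick0.
have [x [y [c [d ->]]]] := pt_surj hE (vpick (m :&: l)%VS).
rewrite memv_cap hl pt_eq0 // => nz /andP[mm /andP[/eqP c0 /eqP d0]].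
exists x, y; rewrite -{2}c0 -{2}d0; split=> //.
by move: nz; rewrite c0 d0 row3_neq0 !eqxx !andbT orbF negb_and.
Qed.

(** In the plane of slope (p : q) the quartic S has a point with y = 0 off l; the
    line of S through it lies in that plane, because it meets l. *)
Lemma segre_relation S L : segre_decomposition f l S L ->
  exists a h, [/\ a != 0,
    forall x y c d, S.@[(pt E x y c d) 0]
      = a * (c * x ^+ 3 + d * y ^+ 3 + x * y * bquad B c d
             + bquartic (fun i => G i - h i) c d),
    forall x y c d, \prod_(u <- L) dot (pt E x y c d) u = a * bquartic h c d
    & forall p q, p != 0 -> q != 0 ->
        bquad B p q ^+ 3 + 27%:R * (p * q * bquartic (fun i => G i - h i) p q) = 0].
Proof.
case=> _ lines cL capL [a a0 fS].
have lL c : c \in L -> (l <= hyperplane c)%VS.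
  by move=> cl; rewrite -capL (big_rem c) //= capvSl.
have [h' hh'] := product_of_forms_through_line lL.
pose h i := h' i / a; have h'E c d : bquartic h' c d = a * bquartic h c d.
  have k i : h' i = a * h i by rewrite /h mulrC divfK.
  by rewrite /bquartic !k; ring.
have SE x y c d : S.@[(pt E x y c d) 0]
      = a * (c * x ^+ 3 + d * y ^+ 3 + x * y * bquad B c d
             + bquartic (fun i => G i - h i) c d).
  have := congr1 (meval ((pt E x y c d) 0)) fS.
  rewrite mevalZ mevalD rmorph_prod /=.
  under eq_bigr => u _ do rewrite meval_linform.
  rewrite hh' h'E fE => e; apply: (addIr (a * bquartic h c d)).
  by rewrite -e /bquartic; ring.
exists a, h; split=> //; first by move=> x y c d; rewrite hh' h'E.
move=> p q p0 q0; set c' := bquartic _ p q.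
have [x' xe] := root_of_power (- (c' / p)) (isT : (0 < 3)%N).
have Sv : S.@[(pt E x' 0 p q) 0] = 0.
  by rewrite SE xe -/c' mulrN mulrCA mulfV // mulr1; ring.
have v0 : pt E x' 0 p q != 0 by rewrite pt_eq0 // (negPf p0) !andbF.
have [m [dm vm mS ml]] := lines _ v0 Sv.
have [x [y [u0 um]]] := lines_meeting_l dm ml.
apply: (@line_on_hesse_cubic _ p q _ c' x y x' 0) => // t.
apply: (mulfI a0); rewrite mulr0.
have : S.@[(pt E x' 0 p q + t *: pt E x y 0 0) 0] = 0.
  by apply: mS; rewrite memvD ?memvZ.
rewrite ptZ ptD !mulr0 !addr0 SE -/c' meval_hesse => e; apply: etrans e; ring.
Qed.

(** As a polynomial in p / q, B^3 has a constant and a leading term, of degree six,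
    that 27 p q H lacks.  So B is a multiple of p q, and H is determined by B. *)
Lemma segre_coefficients (H : nat -> K) :
  (forall p q, p != 0 -> q != 0 ->
    bquad B p q ^+ 3 + 27%:R * (p * q * bquartic H p q) = 0) ->
  [/\ B 0%N = 0, B 2%N = 0 & forall c d,
     27%:R * bquartic H c d = - (B 1%N ^+ 3 * (c ^+ 2 * d ^+ 2))].
Proof.
move=> h; have nz27 : 27%:R != 0 :> K.
  by rewrite (_ : 27%:R = 3%:R * 3%:R * 3%:R) ?mulf_neq0 // -!natrM.
have B2 : B 2%N = 0.
  have P0 : forall t, t != 0 -> (Poly [:: B 2%N ^+ 3;
      3%:R * B 2%N ^+ 2 * B 1%N + 27%:R * H 4%N;
      3%:R * B 2%N ^+ 2 * B 0%N + 3%:R * B 2%N * B 1%N ^+ 2 + 27%:R * H 3%N;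
      6%:R * B 2%N * B 1%N * B 0%N + B 1%N ^+ 3 + 27%:R * H 2%N;
      3%:R * B 2%N * B 0%N ^+ 2 + 3%:R * B 1%N ^+ 2 * B 0%N + 27%:R * H 1%N;
      3%:R * B 1%N * B 0%N ^+ 2 + 27%:R * H 0%N; B 0%N ^+ 3]).[t] = 0.
    move=> t t0; rewrite horner_Poly /=.
    by apply: etrans (h t 1 t0 (oner_neq0 K)); rewrite /bquad /bquartic; ring.
  by have /= /eqP := coef_eq0_of_horner P0 0; rewrite expf_eq0 => /eqP.
have P0 : forall t, t != 0 -> (Poly [:: 27%:R * H 4%N; 27%:R * H 3%N;
      B 1%N ^+ 3 + 27%:R * H 2%N; 3%:R * B 1%N ^+ 2 * B 0%N + 27%:R * H 1%N;
      3%:R * B 1%N * B 0%N ^+ 2 + 27%:R * H 0%N; B 0%N ^+ 3]).[t] = 0.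
  move=> t t0; rewrite horner_Poly /=; apply: (mulfI t0); rewrite mulr0.
  by apply: etrans (h t 1 t0 (oner_neq0 K)); rewrite /bquad /bquartic B2; ring.
have cf := coef_eq0_of_horner P0.
have B0 : B 0%N = 0 by have /= /eqP := cf 5%N; rewrite expf_eq0 => /eqP.
split=> // c d; have /= h4 := cf 0%N; have /= h3 := cf 1%N; have /= h2 := cf 2%N.
have /= h1 := cf 3%N; have /= h0 := cf 4%N.
rewrite B0 ?expr0n /= ?mulr0 ?add0r in h0 h1.
transitivity (27%:R * H 0%N * c ^+ 4 + 27%:R * H 1%N * (c ^+ 3 * d)
  + (B 1%N ^+ 3 + 27%:R * H 2%N) * (c ^+ 2 * d ^+ 2)
  + 27%:R * H 3%N * (c * d ^+ 3) + 27%:R * H 4%N * d ^+ 4 - B 1%N ^+ 3 * (c ^+ 2 * d ^+ 2)).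
  by rewrite /bquartic; ring.
by rewrite h0 h1 h2 h3 h4 !mul0r !add0r.
Qed.

End NormalFormFibers.

(** * The quartic c a^3 + d b^3 + 3 ga a b c d + G(c, d) *)

Section BinaryQuartics.
Variable K : closedFieldType.

Definition bquartic_dc (h : nat -> K) c d := 4%:R * h 0%N * c ^+ 3
  + 3%:R * h 1%N * (c ^+ 2 * d) + 2%:R * h 2%N * (c * d ^+ 2) + h 3%N * d ^+ 3.
Definition bquartic_dd (h : nat -> K) c d := h 1%N * c ^+ 3
  + 2%:R * h 2%N * (c ^+ 2 * d) + 3%:R * h 3%N * (c * d ^+ 2) + 4%:R * h 4%N * d ^+ 3.

(** A repeated root is recorded as a common zero of the partial derivatives, since
    it is by these that it gives rise to singular points of quartics. *)
Lemma bquartic_factorization (h : nat -> K) : h 4%N != 0 ->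
  exists rs : seq K, [/\ size rs = 4%N,
    forall c d, bquartic h c d = h 4%N * \prod_(r <- rs) (d - r * c)
  & uniq rs \/ exists r, bquartic_dc h 1 r = 0 /\ bquartic_dd h 1 r = 0].
Proof.
move=> h4; have [r1 [r2 [r3 [r4 [e3 e2 e1 e0]]]]] :=
  binary_quartic_roots (h 0%N) (h 1%N) (h 2%N) (h 3%N) h4.
exists [:: r1; r2; r3; r4]; split=> //.
  by move=> c d; rewrite !big_cons big_nil /bquartic e0 e1 e2 e3; ring.
have [u|e] := boolP (uniq [:: r1; r2; r3; r4]); [by left | right].
move: e; rewrite /= !inE !negb_and !negbK !orbF => e.
have [r [s [t [rE sE]]]] : exists r s t, (forall c d, bquartic_dc h c d =
    - (h 4%N * (d - r * c) * (2%:R * r * (d - s * c) * (d - t * c)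
       + (d - r * c) * (s * (d - t * c) + t * (d - s * c))))) /\
    (forall c d, bquartic_dd h c d = h 4%N * (d - r * c) *
       (2%:R * (d - s * c) * (d - t * c) + (d - r * c) * ((d - t * c) + (d - s * c)))).
  have two (r s t : K) : (r1 = r /\ r2 = r /\ r3 = s /\ r4 = t) \/
     (r1 = r /\ r3 = r /\ r2 = s /\ r4 = t) \/ (r1 = r /\ r4 = r /\ r2 = s /\ r3 = t) \/
     (r2 = r /\ r3 = r /\ r1 = s /\ r4 = t) \/ (r2 = r /\ r4 = r /\ r1 = s /\ r3 = t) \/
     (r3 = r /\ r4 = r /\ r1 = s /\ r2 = t) ->
     exists r s t, (forall c d, bquartic_dc h c d =
    - (h 4%N * (d - r * c) * (2%:R * r * (d - s * c) * (d - t * c)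
       + (d - r * c) * (s * (d - t * c) + t * (d - s * c))))) /\
    (forall c d, bquartic_dd h c d = h 4%N * (d - r * c) *
       (2%:R * (d - s * c) * (d - t * c) + (d - r * c) * ((d - t * c) + (d - s * c)))).
    move=> cases; exists r, s, t; rewrite /bquartic_dc /bquartic_dd e0 e1 e2 e3.
    by move: cases => [|[|[|[|[|]]]]] [-> [-> [-> ->]]]; split=> c d; ring.
  case/orP: e => [/or3P[]|/orP[/orP[]|]] /eqP e; subst.
  - by apply: (two r2 r3 r4); left.
  - by apply: (two r3 r2 r4); right; left.
  - by apply: (two r4 r2 r3); right; right; left.
  - by apply: (two r3 r1 r4); right; right; right; left.
  - by apply: (two r4 r1 r3); right; right; right; right; left.
  - by apply: (two r4 r1 r2); right; right; right; right; right.
by exists r; rewrite rE sE mulr1 subrr mulr0 !mul0r oppr0.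
Qed.

End BinaryQuartics.

Section SpecialQuartic.
Variables (K : closedFieldType) (f : {mpoly K[4]}) (E : 'M[K]_4) (ga : K) (G : nat -> K).
Hypotheses (ch2 : 2%:R != 0 :> K) (ch3 : 3%:R != 0 :> K).
Hypothesis hE : E \in unitmx.
Hypothesis fE : forall a b c d, f.@[(pt E a b c d) 0]
  = c * a ^+ 3 + d * b ^+ 3 + 3%:R * ga * (a * b * (c * d)) + bquartic G c d.

Lemma dot_gradient_special a b c d a' b' c' d' :
  dot (pt E a' b' c' d') (gradient f (pt E a b c d)) =
  a' * (3%:R * (c * (a ^+ 2 + ga * (b * d)))) + b' * (3%:R * (d * (b ^+ 2 + ga * (a * c))))
  + c' * (a ^+ 3 + 3%:R * ga * (a * b * d) + bquartic_dc G c d)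
  + d' * (b ^+ 3 + 3%:R * ga * (a * b * c) + bquartic_dd G c d).
Proof.
rewrite -coef1_line_restriction.
pose A := a%:P + a' *: 'X; pose B := b%:P + b' *: 'X.
pose C := c%:P + c' *: 'X; pose D := d%:P + d' *: 'X.
rewrite (@line_restrictionE _ _ _ _ _ (C * A ^+ 3 + D * B ^+ 3
   + (3%:R * ga) *: (A * B * (C * D)) + bquartic (fun i => (G i)%:P) C D)); last first.
  move=> t; rewrite ptZ ptD fE /bquartic /A /B /C /D.
  by rewrite !(hornerD, hornerM, hornerZ, horner_exp, hornerC, hornerX); ring.
have coef1M (P Q : {poly K}) : (P * Q)`_1 = P`_0 * Q`_1 + P`_1 * Q`_0.
  by rewrite coefM !big_ord_recl big_ord0 addr0.
rewrite /bquartic !(exprS _ 3) !(exprS _ 2) !expr2.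
rewrite !(coefD, coefZ, coef1M, coef0M, coefC, coefX) /=.
rewrite /bquartic_dc /bquartic_dd; ring.
Qed.

Lemma singular_special a b c d : singular_point f (pt E a b c d) <->
  [/\ pt E a b c d != 0, c * (a ^+ 2 + ga * (b * d)) = 0, d * (b ^+ 2 + ga * (a * c)) = 0,
      a ^+ 3 + 3%:R * ga * (a * b * d) + bquartic_dc G c d = 0
    & b ^+ 3 + 3%:R * ga * (a * b * c) + bquartic_dd G c d = 0].
Proof.
have gr := dot_gradient_special a b c d.
split=> [[v0 _ g0]|[v0 e1 e2 e3 e4]].
  rewrite g0 in gr; split=> //.
  - by apply: (mulfI ch3); have := gr 1 0 0 0; rewrite dot0r !mul0r !addr0 mul1r mulr0.
  - by apply: (mulfI ch3); have := gr 0 1 0 0; rewrite dot0r !mul0r !addr0 add0r mul1r mulr0.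
  - by have := gr 0 0 1 0; rewrite dot0r !mul0r addr0 !add0r mul1r.
  - by have := gr 0 0 0 1; rewrite dot0r !mul0r !add0r mul1r.
rewrite e1 e2 e3 e4 in gr.
split=> //.
  rewrite /on_hypersurface fE; apply: (mulfI (_ : 4%:R != 0)).
    by rewrite (_ : 4%:R = 2%:R * 2%:R) ?mulf_neq0 // -natrM.
  rewrite mulr0; transitivity (3%:R * a * (c * (a ^+ 2 + ga * (b * d)))
    + 3%:R * b * (d * (b ^+ 2 + ga * (a * c)))
    + c * (a ^+ 3 + 3%:R * ga * (a * b * d) + bquartic_dc G c d)
    + d * (b ^+ 3 + 3%:R * ga * (a * b * c) + bquartic_dd G c d)).
    by rewrite /bquartic /bquartic_dc /bquartic_dd; ring.
  by rewrite e1 e2 e3 e4; ring.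
apply: dot_ext => z; have [a' [b' [c' [d' ->]]]] := pt_surj hE z.
by rewrite gr dot0r !mulr0 !addr0.
Qed.

Hypothesis smooth : smooth_hypersurface f.

Lemma special_nonsingular a b c d : pt E a b c d != 0 ->
  c * (a ^+ 2 + ga * (b * d)) = 0 -> d * (b ^+ 2 + ga * (a * c)) = 0 ->
  a ^+ 3 + 3%:R * ga * (a * b * d) + bquartic_dc G c d = 0 ->
  b ^+ 3 + 3%:R * ga * (a * b * c) + bquartic_dd G c d <> 0.
Proof. by move=> h0 h1 h2 h3 h4; apply: (smooth (v := pt E a b c d)); apply/singular_special. Qed.

Lemma special_G0 : G 0%N != 0.
Proof.
apply/negP => /eqP g0; have [b be] := root_of_power (- G 1%N) (isT : (0 < 3)%N).
apply: (@special_nonsingular 0 b 1 0).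
- by rewrite pt_eq0 // oner_eq0 !andbF.
- by rewrite expr0n /=; ring.
- by rewrite mul0r.
- by rewrite /bquartic_dc g0; ring.
- by rewrite be /bquartic_dd; ring.
Qed.

Lemma special_G4 : G 4%N != 0.
Proof.
apply/negP => /eqP g0; have [a ae] := root_of_power (- G 3%N) (isT : (0 < 3)%N).
apply: (@special_nonsingular a 0 0 1).
- by rewrite pt_eq0 // oner_eq0 !andbF.
- by rewrite mul0r.
- by rewrite expr0n /=; ring.
- by rewrite ae /bquartic_dc; ring.
- by rewrite /bquartic_dd g0; ring.
Qed.

(** The product of the equations of the planes over which the fibre splits into
    lines, apart from the two ramified ones. *)
Definition split_form (i : nat) : K := G i + (if i == 2%N then ga ^+ 3 else 0).

Lemma bquartic_split_form c d :
  bquartic split_form c d = bquartic G c d + ga ^+ 3 * (c ^+ 2 * d ^+ 2).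
Proof. by rewrite /bquartic /split_form /=; ring. Qed.

(** The difference of f and of the product of the four planes is singular at the
    points (- ga s t^2, - ga s^2 t, s^3, t^3), one in each plane of the pencil up to
    the choice of cube roots; in a plane that counts twice, f has the same gradient
    there. *)
Lemma split_roots : exists rs : seq K, [/\ size rs = 4%N, uniq rs,
  0 \notin rs
  & forall c d, bquartic split_form c d = G 4%N * \prod_(r <- rs) (d - r * c)].
Proof.
have h4 : split_form 4 != 0 by rewrite /split_form addr0 special_G4.
have [rs [sz rsE ur]] := bquartic_factorization h4.
have e4 : split_form 4 = G 4%N by rewrite /split_form addr0.
exists rs; split=> //; last by move=> c d; rewrite rsE e4.
  case: ur => // -[r [hc hd]]; have [t te] := root_of_power r (isT : (0 < 3)%N).
  exfalso; apply: (@special_nonsingular (- ga * t ^+ 2) (- ga * t) 1 r).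
  - by rewrite pt_eq0 // oner_eq0 !andbF.
  - by rewrite -te; ring.
  - by rewrite -te; ring.
  - apply: etrans hc; rewrite /bquartic_dc /split_form /= -te; ring.
  - apply: etrans hd; rewrite /bquartic_dd /split_form /= -te; ring.
apply/negP => r0; have := special_G0; have := rsE 1 0.
rewrite (big_rem 0) //= mul0r subr0 mul0r mulr0 => e.
have <- : bquartic split_form 1 0 = G 0%N by rewrite /bquartic /split_form /=; ring.
by rewrite e eqxx.
Qed.

Lemma constant_term_roots : exists ss : seq K, [/\ size ss = 4%N, uniq ss,
  0 \notin ss & forall c d, bquartic G c d = G 4%N * \prod_(r <- ss) (d - r * c)].
Proof.
have [rs [sz rsE ur]] := bquartic_factorization special_G4.
exists rs; split=> //.
  case: ur => // -[r [hc hd]]; exfalso; apply: (@special_nonsingular 0 0 1 r).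
  - by rewrite pt_eq0 // oner_eq0 !andbF.
  - by ring.
  - by ring.
  - by rewrite hc; ring.
  - by rewrite hd; ring.
apply/negP => r0; have := special_G0; have := rsE 1 0.
rewrite (big_rem 0) //= mul0r subr0 mul0r mulr0 => e.
have <- : bquartic G 1 0 = G 0%N by rewrite /bquartic; ring.
by rewrite e eqxx.
Qed.

Definition splits p q := (p * q == 0) || (bquartic split_form p q == 0).

(** With these parameters the fibre is the product of the three forms tri_form.
    When p q = 0, any cube root ep will do; otherwise the vanishing of split_form
    says that - ga al^2 de^2 is one. *)
Lemma split_cube_roots p q : (p != 0) || (q != 0) -> splits p q ->
  exists al de ep, [/\ al ^+ 3 = p, de ^+ 3 = q, ep ^+ 3 = bquartic G p q,
    al * de * ep = - (ga * (p * q))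
  & [|| (al != 0) && (de != 0), (al != 0) && (ep != 0) | (de != 0) && (ep != 0)]].
Proof.
move=> pq sp; have [al ale] := root_of_power p (isT : (0 < 3)%N).
have [de dee] := root_of_power q (isT : (0 < 3)%N).
have nz (x y : K) : x ^+ 3 = y -> y != 0 -> x != 0.
  by move=> <-; rewrite expf_eq0.
have z (x : K) : x ^+ 3 = 0 -> x = 0 by move=> /eqP; rewrite expf_eq0 => /eqP.
have [p0|p0] := eqVneq p 0.
  have q0 : q != 0 by rewrite p0 eqxx in pq.
  have [ep epe] := root_of_power (bquartic G p q) (isT : (0 < 3)%N).
  have g0 : bquartic G p q != 0.
    rewrite p0 (_ : bquartic G 0 q = G 4%N * q ^+ 4); last by rewrite /bquartic; ring.
    by rewrite mulf_neq0 ?special_G4 ?expf_neq0.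
  exists al, de, ep; split=> //; last by rewrite (nz _ _ dee q0) (nz _ _ epe g0) !orbT.
  by rewrite (z al) ?ale // p0; ring.
have [q0|q0] := eqVneq q 0.
  have [ep epe] := root_of_power (bquartic G p q) (isT : (0 < 3)%N).
  have g0 : bquartic G p q != 0.
    rewrite q0 (_ : bquartic G p 0 = G 0%N * p ^+ 4); last by rewrite /bquartic; ring.
    by rewrite mulf_neq0 ?special_G0 ?expf_neq0.
  exists al, de, ep; split=> //; last by rewrite (nz _ _ ale p0) (nz _ _ epe g0) !orbT.
  by rewrite (z de) ?dee // q0; ring.
exists al, de, (- (ga * (al ^+ 2 * de ^+ 2))); split=> //.
- move: sp; rewrite /splits mulf_eq0 (negPf p0) (negPf q0) /= bquartic_split_form.
  rewrite addr_eq0 => /eqP->; rewrite -ale -dee; ring.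
- by rewrite -ale -dee; ring.
- by rewrite (nz _ _ ale p0) (nz _ _ dee q0).
Qed.

Variable l : {vspace 'rV[K]_4}.
Hypothesis hl : forall a b c d, (pt E a b c d \in l) = (c == 0) && (d == 0).

Definition special_fiber p q := hesse_cubic p q (3%:R * ga * (p * q)) (bquartic G p q).

Lemma special_fiberE p q x y w :
  f.@[(pt E x y (w * p) (w * q)) 0] = w * (special_fiber p q).@[(row3 x y w) 0].
Proof. by rewrite fE meval_hesse /bquartic; ring. Qed.

Lemma special_plane_fiber p q : (p != 0) || (q != 0) ->
  fiber f l (plane E p q) (frame E p q) (special_fiber p q).
Proof. exact: (plane_fiber hE hl special_fiberE). Qed.

Lemma special_fiber_tri p q al de ep : al ^+ 3 = p -> de ^+ 3 = q ->
  ep ^+ 3 = bquartic G p q -> al * de * ep = - (ga * (p * q)) ->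
  special_fiber p q = hesse_cubic (al ^+ 3) (de ^+ 3) (- (3%:R * (al * de * ep))) (ep ^+ 3).
Proof.
by move=> e1 e2 e3 e4; rewrite e1 e2 e3 e4 /special_fiber mulrN opprK !mulrA.
Qed.

Lemma singular_fiberP H : singular_fiber f l H <->
  exists p q, [/\ (p != 0) || (q != 0), H = plane E p q
    & splits p q || (bquartic G p q == 0)].
Proof.
split=> [[M [g [fib [u sing]]]]|[p [q [pq -> sp]]]].
  have [p [q [T [Tu nz eM -> gT]]]] := fiberP hE hl special_fiberE fib.
  exists p, q; split=> //; rewrite /splits mulf_eq0.
  have [//|p0] := eqVneq p 0; have [//|q0] := eqVneq q 0; rewrite /= bquartic_split_form.
  have := @singular_hesse_discriminant _ ch3 _ _ (3%:R * ga * (p * q)) (bquartic G p q) p0 q0.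
  case; first by exists (u *m T); apply/(singular_point_change Tu gT).
    by move=> ->; rewrite eqxx orbT.
  move=> e; apply/orP; left; apply/eqP.
  apply: (mulfI (_ : 27%:R * (p * q) != 0)).
    by rewrite !mulf_neq0 // (_ : 27%:R = 3%:R * 3%:R * 3%:R) ?mulf_neq0 // -!natrM.
  by rewrite mulr0; apply: etrans e; ring.
exists (frame E p q), (special_fiber p q); split; first exact: special_plane_fiber.
have [hs|hs] := boolP (splits p q).
  have [al [de [ep [e1 e2 e3 e4 two]]]] := split_cube_roots pq hs.
  rewrite (special_fiber_tri e1 e2 e3 e4).
  (* The cubic X^3 + Y^3 + W^3 - 3 X Y W is singular at X = Y = W. *)
  exists (row3 (de * ep) (al * ep) (al * de)); apply/singular_hesse => //.
  split; try by ring.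
  rewrite row3_neq0 !mulf_eq0 !negb_or; move: two.
  by case: (al == 0); case: (de == 0); case: (ep == 0).
rewrite (negPf hs) /= in sp; exists (row3 0 0 1); apply/singular_hesse => //.
rewrite (eqP sp) row3_neq0 oner_eq0 !orbT; split=> //; ring.
Qed.

Variable om : K.
Hypotheses (om2 : om ^+ 2 + om + 1 = 0) (om1 : om != 1).

Lemma fiber_type_IV p q : (p != 0) || (q != 0) -> splits p q -> ga * (p * q) = 0 ->
  fiber_type f l (plane E p q) IV.
Proof.
move=> pq sp g0; exists (frame E p q), (special_fiber p q); split.
  exact: special_plane_fiber.
have [al [de [ep [e1 e2 e3 e4 two]]]] := split_cube_roots pq sp.
rewrite (special_fiber_tri e1 e2 e3 e4); apply: (hesse_tri_IV om2 om1 two).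
by rewrite e4 g0 oppr0.
Qed.

Lemma fiber_type_I3 p q : p != 0 -> q != 0 -> splits p q -> ga != 0 ->
  fiber_type f l (plane E p q) I3.
Proof.
move=> p0 q0 sp g0; have pq : (p != 0) || (q != 0) by rewrite p0.
exists (frame E p q), (special_fiber p q); split; first exact: special_plane_fiber.
have [al [de [ep [e1 e2 e3 e4 two]]]] := split_cube_roots pq sp.
rewrite (special_fiber_tri e1 e2 e3 e4); apply: (hesse_tri_I3 ch3 om2 om1 two).
by rewrite e4 oppr_eq0 !mulf_neq0.
Qed.

(** The three lines meet at (de ep, al ep, al de), where al de vanishes. *)
Lemma ramified_IV_fiber p q : (p != 0) || (q != 0) -> p * q = 0 ->
  IV_fiber_singular_on f l (plane E p q).
Proof.
move=> pq pq0; exists (frame E p q), (special_fiber p q).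
have sp : splits p q by rewrite /splits pq0 eqxx.
have [al [de [ep [e1 e2 e3 e4 two]]]] := split_cube_roots pq sp.
have t0 : al * de * ep = 0 by rewrite e4 pq0 mulr0 oppr0.
split; first exact: special_plane_fiber.
  by rewrite (special_fiber_tri e1 e2 e3 e4); apply: (hesse_tri_IV om2 om1 two).
have ad : al * de = 0.
  have /eqP : (al * de) ^+ 3 = 0 by rewrite exprMn e1 e2.
  by rewrite expf_eq0 => /eqP.
exists (row3 (de * ep) (al * ep) (al * de)); last first.
  by rewrite row3_frame ad !mul0r hl !eqxx.
rewrite (special_fiber_tri e1 e2 e3 e4); apply/singular_hesse => //.
split; try by ring.
rewrite row3_neq0 !mulf_eq0 !negb_or; move: two.
by case: (al == 0); case: (de == 0); case: (ep == 0).
Qed.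

End SpecialQuartic.

(** * Nodal fibres *)

Section NodalFiber.
Variables (K : closedFieldType) (p q b : K).
Hypotheses (p0 : p != 0) (q0 : q != 0) (b0 : b != 0).

(** The cubic has degree one in w, with coefficient b x y, and neither x nor y
    divides the rest. *)
Lemma irreducible_nodal_hesse : irreducible_mpoly (hesse_cubic p q b 0).
Proof.
pose o0 := @Ordinal 3 0 isT; pose o1 := @Ordinal 3 1 isT; pose o2 := @Ordinal 3 2 isT.
apply: (@irreducible_reversed_eisenstein K 3 o2 o0 _
  [:: p%:MP * 'X_o0 ^+ 3 + q%:MP * 'X_o1 ^+ 3; b%:MP * ('X_o0 * 'X_o1)] b [:: o0; o1]) => //.
- rewrite /hesse_cubic /= !cons_poly_def polyC0.
  rewrite !(rmorphD, rmorphM, rmorphXn) /= !as_univariateX !as_univariateC /=.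
  by rewrite mpolyC0 ?polyC0; ring.
- by rewrite !big_cons big_nil mulr1.
- move=> k; rewrite !inE => /orP[] /eqP -> /=.
    move/(_ (row3 0 1 0)); rewrite !mxE => /(_ erefl).
    rewrite !(mevalD, mevalM, rmorphXn, mevalC) /= !mevalXU !mxE /= => e.
    by case/eqP: q0; apply: etrans e; ring.
  move/(_ (row3 1 0 0)); rewrite !mxE => /(_ erefl).
  rewrite !(mevalD, mevalM, rmorphXn, mevalC) /= !mevalXU !mxE /= => e.
  by case/eqP: p0; apply: etrans e; ring.
- case=> [//|[|m]] _ v v0 /=; last by rewrite nth_nil meval0.
  by rewrite !mevalM mevalXU v0 mul0r mulr0.
- rewrite -row3_0 meval_hesse; ring.
Qed.

Lemma node_nodal_hesse : node (hesse_cubic p q b 0) (row3 0 0 1).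
Proof.
have lr x y w : line_restriction (hesse_cubic p q b 0) (row3 0 0 1) (row3 x y w)
  = Poly [:: 0; 0; b * (x * y); p * x ^+ 3 + q * y ^+ 3 + b * (x * y * w)].
  apply: line_restrictionE => t; rewrite row3Z row3D meval_hesse horner_Poly /=; ring.
have nz (x y w : K) : [|| x != 0, y != 0 | w != 0] -> col3 x y w != 0 by rewrite col3_neq0.
pose c1 : 'cV[K]_3 := col3 1 0 0; pose c2 : 'cV[K]_3 := col3 0 1 0.
have c1n : c1 != 0 by apply: nz; rewrite oner_eq0.
have c2n : c2 != 0 by apply: nz; rewrite oner_eq0 orbT.
have cone x y w : b * (x * y) = 0 ->
    'X^3 %| line_restriction (hesse_cubic p q b 0) (row3 0 0 1) (row3 x y w).
  by move=> e; rewrite lr e; apply/dvdXn_coef => -[|[|[|//]]] _; rewrite coef_Poly.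
have u0 : row3 0 0 1 != 0 :> 'rV[K]_3 by rewrite row3_neq0 oner_eq0 !orbT.
split.
  split=> //; first by rewrite /on_hypersurface meval_hesse; ring.
  apply: dot_ext => z; have [x [y [w ->]]] := row3_surj z.
  by rewrite -coef1_line_restriction lr coef_Poly dot0r.
exists (hyperplane c1), (hyperplane c2); split.
  apply/eqP => e; have : row3 0 1 0 \in hyperplane c1.
    by rewrite mem_hyperplane dot_row3 !mul0r mulr0 !addr0.
  by rewrite e mem_hyperplane dot_row3 !mul0r mulr1 addr0 add0r oner_eq0.
move=> m; split=> [[dm [_ um hge]]|].
  have [|c cs mc] := @subv_hyperplane_of_prod _ _ m [:: c1; c2].
    move=> v vm; have := hge v vm; have [x [y [w ->]]] := row3_surj v.
    rewrite lr => /dvdXn_coef /(_ 2%N isT); rewrite coef_Poly /= => /eqP.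
    rewrite mulf_eq0 (negPf b0) /= => /eqP xy.
    by rewrite !big_cons big_nil !dot_row3 !mulr0 !mulr1 !addr0 add0r.
  have eqm c' : c' != 0 -> (m <= hyperplane c')%VS -> m = hyperplane c'.
    by move=> n h; apply/eqP; rewrite eqEdim h dim_hyperplane // dm.
  by move: cs mc; rewrite !inE => /orP[] /eqP -> mc; [left | right]; apply: eqm.
case=> ->; rewrite /cone_line dim_hyperplane //; split=> //; split=> //.
- by rewrite mem_hyperplane dot_row3 !mulr0 mul0r !addr0.
- move=> z; have [x [y [w ->]]] := row3_surj z.
  rewrite mem_hyperplane dot_row3 !mulr0 mulr1 !addr0 => /eqP->.
  by apply: cone; rewrite mul0r mulr0.
- by rewrite mem_hyperplane dot_row3 !mulr0 mul0r !addr0.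
- move=> z; have [x [y [w ->]]] := row3_surj z.
  rewrite mem_hyperplane dot_row3 !mulr0 mulr1 addr0 add0r => /eqP->.
  by apply: cone; rewrite !mulr0.
Qed.

End NodalFiber.

(** * The ruled quartic *)

Section RuledQuartic.
Variables (K : closedFieldType) (E : 'M[K]_4) (ga : K).
Hypothesis hE : E \in unitmx.

(** With this coefficient of c^2 d^2 the splitting condition holds in every plane
    of the pencil. *)
Definition ruled_quartic : {mpoly K[4]} :=
  linform (X2 E) * linform (X0 E) ^+ 3 + linform (X3 E) * linform (X1 E) ^+ 3
  + (3%:R * ga)%:MP * (linform (X0 E) * linform (X1 E) * (linform (X2 E) * linform (X3 E)))
  - (ga ^+ 3)%:MP * (linform (X2 E) ^+ 2 * linform (X3 E) ^+ 2).

Lemma meval_ruled_quartic a b c d : ruled_quartic.@[(pt E a b c d) 0] =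
  c * a ^+ 3 + d * b ^+ 3 + 3%:R * ga * (a * b * (c * d)) - ga ^+ 3 * (c ^+ 2 * d ^+ 2).
Proof.
by rewrite /ruled_quartic !(mevalD, mevalN, mevalM, rmorphXn, mevalC) /=
  !meval_linform !dotX.
Qed.

Lemma ruled_quartic_homog : ruled_quartic \is 4.-homog.
Proof.
apply: dhomogI => t v; have [a [b [c [d ->]]]] := pt_surj hE v.
by rewrite ptZ !meval_ruled_quartic; ring.
Qed.

Definition ruled_binary (i : nat) : K := if i == 2%N then - ga ^+ 3 else 0.

Lemma ruled_quartic_special a b c d : ruled_quartic.@[(pt E a b c d) 0] =
  c * a ^+ 3 + d * b ^+ 3 + 3%:R * ga * (a * b * (c * d)) + bquartic ruled_binary c d.
Proof. rewrite meval_ruled_quartic /bquartic /ruled_binary /=; ring. Qed.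

Lemma lin_substM (T : 'M[K]_4) (p q : {mpoly K[4]}) :
  lin_subst T (p * q) = lin_subst T p * lin_subst T q.
Proof. by apply: meval_inj => v; rewrite mevalM !meval_lin_subst mevalM. Qed.

Lemma lin_subst_unit (T : 'M[K]_4) (p : {mpoly K[4]}) :
  p \is a GRing.unit -> lin_subst T p \is a GRing.unit.
Proof.
move=> /unitrPr[q e]; apply/unitrPr; exists (lin_subst T q).
rewrite -lin_substM e; apply: meval_inj => v.
by rewrite meval_lin_subst !meval1.
Qed.

Lemma lin_substK (T : 'M[K]_4) (p : {mpoly K[4]}) : T \in unitmx ->
  lin_subst (invmx T) (lin_subst T p) = p.
Proof. by move=> Tu; apply: meval_inj => v; rewrite !meval_lin_subst mulmxKV. Qed.

(** In the variable a the quartic is c a^3 + 3 ga b c d a + (d b^3 - ga^3 c^2 d^2),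
    and c divides every coefficient but the constant one. *)
Lemma irreducible_ruled_quartic : irreducible_mpoly ruled_quartic.
Proof.
pose o0 := @Ordinal 4 0 isT; pose o1 := @Ordinal 4 1 isT.
pose o2 := @Ordinal 4 2 isT; pose o3 := @Ordinal 4 3 isT.
pose F : {mpoly K[4]} := 'X_o2 * 'X_o0 ^+ 3 + 'X_o3 * 'X_o1 ^+ 3
  + (3%:R * ga)%:MP * ('X_o0 * 'X_o1 * ('X_o2 * 'X_o3))
  - (ga ^+ 3)%:MP * ('X_o2 ^+ 2 * 'X_o3 ^+ 2).
have FE : lin_subst E ruled_quartic = F.
  apply: meval_inj => v; have [a [b [c [d ->]]]] := row4_surj v.
  rewrite meval_lin_subst -/(pt E a b c d) meval_ruled_quartic /F.
  by rewrite !(mevalD, mevalN, mevalM, rmorphXn, mevalC) /= !mevalXU !mxE.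
have [Fn0 FnU Firr] : irreducible_mpoly F.
  apply: (@irreducible_reversed_eisenstein K 4 o0 o2 _
    [:: 'X_o3 * 'X_o1 ^+ 3 - (ga ^+ 3)%:MP * ('X_o2 ^+ 2 * 'X_o3 ^+ 2);
        (3%:R * ga)%:MP * ('X_o1 * ('X_o2 * 'X_o3)); 0; 'X_o2] 1 [:: o2]) => //.
  - rewrite /F /= !cons_poly_def polyC0.
    rewrite !(rmorphD, rmorphN, rmorphM, rmorphXn) /= !as_univariateX !as_univariateC /=.
    by rewrite ?polyC0; ring.
  - exact: oner_neq0.
  - by rewrite big_cons big_nil mulr1 mul1r.
  - move=> k; rewrite !inE => /eqP -> /= /(_ (row4 0 1 0 1)); rewrite !mxE => /(_ erefl).
    rewrite !(mevalD, mevalN, mevalM, rmorphXn, mevalC) /= !mevalXU !mxE /=.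
    by move=> e; case/eqP: (oner_neq0 K); apply: etrans e; ring.
  - case=> [//|[|[|[|m]]]] _ v v0 /=; rewrite ?nth_nil ?meval0 //.
      have e : ('X_o2).@[v 0] = 0 by rewrite mevalXU.
      by rewrite !mevalM e mul0r !mulr0.
    by rewrite mevalXU.
  - rewrite -row4_0 /F !(mevalD, mevalN, mevalM, rmorphXn, mevalC) /= !mevalXU !mxE /=; ring.
have back p : lin_subst E p \is a GRing.unit -> p \is a GRing.unit.
  by move=> /(lin_subst_unit (invmx E)); rewrite lin_substK.
split.
- apply: contraNneq Fn0 => e; rewrite -FE e; apply/eqP/meval_inj => v.
  by rewrite meval_lin_subst !meval0.
- by apply/negP => /(lin_subst_unit E); rewrite FE; apply/negP.
- move=> q r e; have : F = lin_subst E q * lin_subst E r by rewrite -lin_substM -e FE.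
  by case/Firr => /back; [left | right].
Qed.

(** A cone is invariant under translation by its vertex w.  The quartic contains l,
    so it vanishes on w + l, which forces w to lie on l; as it also contains the
    points (0 : 0 : 1 : 0) and (0 : 0 : 0 : 1), this gives w = 0. *)
Lemma ruled_quartic_not_cone : ~ cone_over_plane_curve ruled_quartic.
Proof.
case=> H [w [d [q [_ wH _ _ SE]]]]; apply: (negP wH).
have shift (v : 'rV[K]_4) : ruled_quartic.@[v 0] = 0 -> ruled_quartic.@[(v + w) 0] = 0.
  move=> /SE[c [cH cq vc]]; apply/SE; exists c; split=> //.
  by rewrite memvD // (subvP (addvSl _ _)) ?memv_line.
have [w0 [w1 [w2 [w3 ew]]]] := pt_surj hE w; rewrite ew in shift.
have S0 a b : ruled_quartic.@[(pt E (a - w0) (b - w1) 0 0 + pt E w0 w1 w2 w3) 0] = 0.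
  by apply: shift; rewrite meval_ruled_quartic; ring.
pose F a b := w2 * a ^+ 3 + w3 * b ^+ 3 + 3%:R * ga * (a * b * (w2 * w3))
  - ga ^+ 3 * (w2 ^+ 2 * w3 ^+ 2).
have F0 a b : F a b = 0.
  by have := S0 a b; rewrite ptD !subrK !add0r meval_ruled_quartic.
have e2 : w2 = 0.
  transitivity (F 1 0 - F 0 0); last by rewrite !F0 subrr.
  by rewrite /F; ring.
have e3 : w3 = 0.
  transitivity (F 0 1 - F 0 0); last by rewrite !F0 subrr.
  by rewrite /F; ring.
have cube0 (x : K) : x ^+ 3 = 0 -> x = 0 by move=> /eqP; rewrite expf_eq0 => /eqP.
have e0 : w0 = 0.
  have : ruled_quartic.@[(pt E 0 0 1 0 + pt E w0 w1 w2 w3) 0] = 0.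
    by apply: shift; rewrite meval_ruled_quartic; ring.
  rewrite ptD meval_ruled_quartic e2 e3 => e.
  by apply: cube0; apply: etrans e; ring.
have e1 : w1 = 0.
  have : ruled_quartic.@[(pt E 0 0 0 1 + pt E w0 w1 w2 w3) 0] = 0.
    by apply: shift; rewrite meval_ruled_quartic; ring.
  rewrite ptD meval_ruled_quartic e2 e3 => e.
  by apply: cube0; apply: etrans e; ring.
by rewrite ew e0 e1 e2 e3 pt0 mem0v.
Qed.

(** The rulings: in the plane of slope (s^3 : t^3) the residual cubic has the form
    X^3 + Y^3 + W^3 - 3 X Y W, of which X + Y + W is a factor. *)
Definition ruling s t : {vspace 'rV[K]_4} :=
  plane_line E (s ^+ 3) (t ^+ 3) s t (- (ga * (s ^+ 2 * t ^+ 2))).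

Lemma cube_slope_neq0 (s t : K) : (s != 0) || (t != 0) -> (s ^+ 3 != 0) || (t ^+ 3 != 0).
Proof. by rewrite !expf_eq0. Qed.

Lemma mem_ruling s t x y w : (s != 0) || (t != 0) ->
  (pt E x y (w * s ^+ 3) (w * t ^+ 3) \in ruling s t)
  = (s * x + t * y == ga * (s ^+ 2 * t ^+ 2) * w).
Proof.
move=> st; rewrite mem_plane_line ?cube_slope_neq0 //.
by rewrite mulNr subr_eq0.
Qed.

Lemma mem_rulingP s t v : (s != 0) || (t != 0) -> v \in ruling s t ->
  exists x y w, v = pt E x y (w * s ^+ 3) (w * t ^+ 3) /\
    s * x + t * y = ga * (s ^+ 2 * t ^+ 2) * w.
Proof.
move=> st vm; have vp : v \in plane E (s ^+ 3) (t ^+ 3).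
  exact: (subvP (plane_line_sub _ _ _ _ _ _) _ vm).
have [x [y [w e]]] := mem_planeP hE (cube_slope_neq0 st) vp.
by exists x, y, w; split=> //; apply/eqP; rewrite -mem_ruling // -e.
Qed.

Lemma dim_ruling s t : (s != 0) || (t != 0) -> \dim (ruling s t) = 2%N.
Proof.
move=> st; apply: dim_plane_line => //; first exact: cube_slope_neq0.
by rewrite col3_neq0 orbA st.
Qed.

Lemma ruling_sub s t : (s != 0) || (t != 0) -> subset_hypersurface (ruling s t) ruled_quartic.
Proof.
move=> st v /(mem_rulingP st)[x [y [w [-> e]]]].
rewrite /on_hypersurface meval_ruled_quartic.
set Z := ga * (s ^+ 2 * t ^+ 2) * w in e.
transitivity (w * (s * x + t * y - Z) * ((s * x) ^+ 2 + (t * y) ^+ 2 + Z ^+ 2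
   - s * x * (t * y) + s * x * Z + t * y * Z)); first by rewrite /Z; ring.
by rewrite e subrr mulr0 mul0r.
Qed.

Variable om : K.
Hypotheses (ch2 : 2%:R != 0 :> K) (ch3 : 3%:R != 0 :> K).
Hypotheses (om2 : om ^+ 2 + om + 1 = 0) (om1 : om != 1).

(** A point (a : b) of l is on the ruling of parameter (b : - a).  For the other
    points the equation is a product of three forms tri_form, and the cube root of
    unity of the vanishing one is absorbed in t. *)
Lemma ruling_through (v : 'rV[K]_4) : v != 0 -> ruled_quartic.@[v 0] = 0 ->
  exists s t, (s != 0) || (t != 0) /\ v \in ruling s t.
Proof.
have [a [b [c [d ->]]]] := pt_surj hE v; rewrite pt_eq0 // meval_ruled_quartic => v0 Sv.
have [c0|cd] := boolP ((c == 0) && (d == 0)).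
  case/andP: c0 => /eqP c0 /eqP d0; rewrite c0 d0 in v0 *.
  exists b, (- a); have st : (b != 0) || (- a != 0).
    by rewrite oppr_eq0 orbC -negb_and; move: v0; rewrite !eqxx !andbT.
  split=> //; rewrite -[X in pt E _ _ X _](mul0r (b ^+ 3)).
  rewrite -[X in pt E _ _ _ X](mul0r ((- a) ^+ 3)) mem_ruling //.
  by apply/eqP; ring.
rewrite negb_and in cd.
have [s se] := root_of_power c (isT : (0 < 3)%N).
have [t te] := root_of_power d (isT : (0 < 3)%N).
have := prod_tri_form s t (- (ga * (s ^+ 2 * t ^+ 2))) om2 a b 1.
have -> : (s * a) ^+ 3 + (t * b) ^+ 3 + (- (ga * (s ^+ 2 * t ^+ 2)) * 1) ^+ 3 -
   3%:R * (s * a * (t * b) * (- (ga * (s ^+ 2 * t ^+ 2)) * 1)) = 0.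
  by apply: etrans Sv; rewrite -se -te; ring.
move=> /eqP; rewrite prodf_seq_eq0 => /hasP[z zu /= /eqP].
rewrite dot_tri_form => e; have z3 := unity_roots_cube om2 zu.
have z0 : z != 0.
  by apply/eqP => z0; move: z3; rewrite z0 expr0n /= => /esym/eqP; rewrite oner_eq0.
have st : (s != 0) || (z * t != 0).
  by move: cd; rewrite -se -te !expf_eq0 /= mulf_eq0 (negPf z0).
exists s, (z * t); split=> //.
have -> : pt E a b c d = pt E a b (1 * s ^+ 3) (1 * (z * t) ^+ 3).
  by rewrite exprMn z3 se te !mul1r.
rewrite mem_ruling // -subr_eq0; apply/eqP; apply: etrans e; ring.
Qed.

Lemma ruled_quartic_ruled : ruled_surface ruled_quartic.
Proof.
split; [exact: irreducible_ruled_quartic | | exact: ruled_quartic_not_cone].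
move=> v v0 Sv; have [s [t [st vm]]] := ruling_through v0 Sv.
by exists (ruling s t); split=> //; [exact: dim_ruling | exact: ruling_sub].
Qed.

Variable l : {vspace 'rV[K]_4}.
Hypothesis hl : forall a b c d, (pt E a b c d \in l) = (c == 0) && (d == 0).

Lemma ruling_foot s t : (s != 0) || (t != 0) -> pt E t (- s) 0 0 \in ruling s t.
Proof.
move=> st; rewrite -[X in pt E _ _ X _](mul0r (s ^+ 3)).
rewrite -[X in pt E _ _ _ X](mul0r (t ^+ 3)) mem_ruling //.
by apply/eqP; ring.
Qed.

Lemma ruling_meets s t : (s != 0) || (t != 0) -> meets_line l (ruling s t).
Proof.
move=> st; split.
  apply/eqP => e.
  have : pt E (ga / 2%:R * (s * t ^+ 2)) (ga / 2%:R * (s ^+ 2 * t)) (1 * s ^+ 3) (1 * t ^+ 3)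
      \in ruling s t.
    rewrite mem_ruling //; apply/eqP; rewrite mulr1.
    transitivity ((2%:R / 2%:R) * (ga * (s ^+ 2 * t ^+ 2))); first by ring.
    by rewrite mulfV // mul1r.
  rewrite e hl !mul1r !expf_eq0 /=; apply/negP.
  by rewrite negb_and.
apply/negP => /eqP e; have : pt E t (- s) 0 0 \in (ruling s t :&: l)%VS.
  by rewrite memv_cap ruling_foot // hl eqxx.
by rewrite e memv0 pt_eq0 // oppr_eq0 !eqxx !andbT andbC -[_ && _]negbK negb_and st.
Qed.

Lemma ruled_quartic_meeting_lines : union_of_lines (meets_line l) ruled_quartic.
Proof.
move=> v v0 Sv; have [s [t [st vm]]] := ruling_through v0 Sv.
by exists (ruling s t); split=> //; [exact: dim_ruling | exact: ruling_sub | exact: ruling_meets].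
Qed.

(** Four points of a twisted cubic are linearly independent. *)
Lemma twisted_cubic_spans (A : 'rV[K]_4 -> Prop) (m : {vspace 'rV[K]_4}) :
  is_twisted_cubic A -> (forall v, v != 0 -> A v -> v \in m) -> m = fullv.
Proof.
case=> B Bu AB Am; apply/eqP; rewrite eqEsubv subvf; apply/subvP => v _.
have rowE (s t : K) :
    (\row_(j < 4) (s ^+ (3 - j) * t ^+ j)) = row4 (s ^+ 3) (s ^+ 2 * t) (s * t ^+ 2) (t ^+ 3).
  by apply/matrixP => i [[|[|[|[|//]]]] hj]; rewrite !mxE /= ?expr0 ?expr1 ?mulr1 ?mul1r.
have mem s t : row4 (s ^+ 3) (s ^+ 2 * t) (s * t ^+ 2) (t ^+ 3) *m B \in m.
  have [->|nz] := eqVneq (row4 (s ^+ 3) (s ^+ 2 * t) (s * t ^+ 2) (t ^+ 3) *m B) 0.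
    by rewrite mem0v.
  by apply: Am => //; apply/AB => //; exists 1, s, t; rewrite rowE scale1r.
have comb (x1 x2 x3 x4 : K) : x1 *: (row4 (1 ^+ 3) (1 ^+ 2 * 0) (1 * 0 ^+ 2) (0 ^+ 3) *m B)
    + x2 *: (row4 (0 ^+ 3) (0 ^+ 2 * 1) (0 * 1 ^+ 2) (1 ^+ 3) *m B)
    + x3 *: (row4 (1 ^+ 3) (1 ^+ 2 * 1) (1 * 1 ^+ 2) (1 ^+ 3) *m B)
    + x4 *: (row4 (1 ^+ 3) (1 ^+ 2 * (-1)) (1 * (-1) ^+ 2) ((-1) ^+ 3) *m B) \in m.
  by rewrite !memvD // memvZ.
have [a [b [c [d e]]]] := row4_surj (v *m invmx B).
have -> : v = row4 a b c d *m B by rewrite -e mulmxKV.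
have [h1 [h2 [-> ->]]] : exists h1 h2, b = h1 - h2 /\ c = h1 + h2.
  exists ((b + c) / 2%:R), ((c - b) / 2%:R); split.
    by apply: (mulfI ch2); rewrite mulrBr ![2%:R * (_ / _)]mulrC !divfK //; ring.
  by apply: (mulfI ch2); rewrite mulrDr ![2%:R * (_ / _)]mulrC !divfK //; ring.
have := comb (a - (h1 + h2)) (d - (h1 - h2)) h1 h2.
rewrite !scalemxAl -!mulmxDl !row4Z !row4D.
set r := row4 _ _ _ _; suff -> : r = row4 a (h1 - h2) (h1 + h2) d by [].
by rewrite /r; congr row4; ring.
Qed.

Lemma line_not_twisted_cubic (A : 'rV[K]_4 -> Prop) : is_line A -> ~ is_twisted_cubic A.
Proof.
case=> m dm mA tA; have e : m = fullv by apply: twisted_cubic_spans tA _ => v v0 /(mA v v0).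
by move: dm; rewrite e dimvf /dim /= mul1n.
Qed.

Lemma singular_ruled_quartic a b c d : singular_point ruled_quartic (pt E a b c d) <->
  [/\ pt E a b c d != 0, c * (a ^+ 2 + ga * (b * d)) = 0, d * (b ^+ 2 + ga * (a * c)) = 0,
      a ^+ 3 + 3%:R * ga * (a * b * d) - 2%:R * ga ^+ 3 * (c * d ^+ 2) = 0
    & b ^+ 3 + 3%:R * ga * (a * b * c) - 2%:R * ga ^+ 3 * (c ^+ 2 * d) = 0].
Proof.
have dc : bquartic_dc ruled_binary c d = - (2%:R * ga ^+ 3 * (c * d ^+ 2)).
  by rewrite /bquartic_dc /ruled_binary /=; ring.
have dd : bquartic_dd ruled_binary c d = - (2%:R * ga ^+ 3 * (c ^+ 2 * d)).
  by rewrite /bquartic_dd /ruled_binary /=; ring.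
by rewrite -dc -dd; apply: (singular_special ch2 ch3 hE ruled_quartic_special).
Qed.

(** The curve is (- ga s t^2 : - ga s^2 t : s^3 : t^3).  Of the cube roots s of c
    only the one compatible with a and t gives the point; it is r below. *)
Lemma singular_twisted_cubic : ga != 0 -> is_twisted_cubic (singular_point ruled_quartic).
Proof.
move=> g0; pose N : 'M[K]_4 := \matrix_(i < 4) nth (0 : 'rV[K]_4)
  [:: row4 0 0 1 0; row4 0 (- ga) 0 0; row4 (- ga) 0 0 0; row4 0 0 0 1] i.
have NE x1 x2 x3 x4 : row4 x1 x2 x3 x4 *m N = row4 (- ga * x3) (- ga * x2) x1 x4.
  by rewrite row4_mul !rowK /= !row4Z !row4D; congr row4; ring.
exists (N *m E).
  rewrite unitmx_mul hE andbT -row_free_unit; apply: inj_row_free => v.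
  have [x1 [x2 [x3 [x4 ->]]]] := row4_surj v.
  rewrite NE -row4_0 => /row4_inj[/eqP + /eqP + -> ->].
  by rewrite !mulf_eq0 oppr_eq0 (negPf g0) => /eqP -> /eqP ->.
have curve (k s t : K) : k *: ((\row_(j < 4) (s ^+ (3 - j) * t ^+ j)) *m (N *m E)) =
    pt E (k * (- ga * (s * t ^+ 2))) (k * (- ga * (s ^+ 2 * t))) (k * s ^+ 3) (k * t ^+ 3).
  rewrite mulmxA; have -> : (\row_(j < 4) (s ^+ (3 - j) * t ^+ j)) =
      row4 (s ^+ 3) (s ^+ 2 * t) (s * t ^+ 2) (t ^+ 3).
    by apply/matrixP => i [[|[|[|[|//]]]] hj]; rewrite !mxE /= ?expr0 ?expr1 ?mulr1 ?mul1r.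
  by rewrite NE -/(pt E _ _ _ _) ptZ.
move=> v v0; split=> [|[k [s [t]]]]; last first.
  rewrite curve => e; rewrite e in v0 *; apply/singular_ruled_quartic; split=> //; ring.
have [a [b [c [d ev]]]] := pt_surj hE v; rewrite {}ev in v0 * => /singular_ruled_quartic[_ e1 e2 e3 e4].
suff [s [t [-> -> -> ->]]] : exists s t, [/\ a = - ga * (s * t ^+ 2),
    b = - ga * (s ^+ 2 * t), c = s ^+ 3 & d = t ^+ 3].
  by exists 1, s, t; rewrite curve !mul1r.
have pow0 (x : K) n : x ^+ n = 0 -> x = 0 by move=> /eqP; rewrite expf_eq0 => /andP[_ /eqP].
have [t te] := root_of_power d (isT : (0 < 3)%N).
have [s se] := root_of_power c (isT : (0 < 3)%N).
have [c0|c0] := eqVneq c 0.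
  have b0 : b = 0 by apply: (@pow0 _ 3); apply: etrans e4; rewrite c0; ring.
  have a0 : a = 0 by apply: (@pow0 _ 3); apply: etrans e3; rewrite c0 b0; ring.
  by exists 0, t; rewrite a0 b0 c0 te; split=> //; ring.
have [d0|d0] := eqVneq d 0.
  have a0 : a = 0 by apply: (@pow0 _ 3); apply: etrans e3; rewrite d0; ring.
  have b0 : b = 0 by apply: (@pow0 _ 3); apply: etrans e4; rewrite d0 a0; ring.
  by exists s, 0; rewrite a0 b0 d0 se; split=> //; ring.
have t0 : t != 0 by apply: contraNneq d0 => t0; rewrite -te t0 expr0n.
have f1 : a ^+ 2 = - (ga * (b * d)).
  by apply/eqP; rewrite -addr_eq0; move/eqP: e1; rewrite mulf_eq0 (negPf c0).
have f2 : b ^+ 2 = - (ga * (a * c)).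
  by apply/eqP; rewrite -addr_eq0; move/eqP: e2; rewrite mulf_eq0 (negPf d0).
have gt : - ga * t ^+ 2 != 0 by rewrite mulf_neq0 ?oppr_eq0 ?expf_neq0.
pose r := a / (- ga * t ^+ 2).
have ar : a = - ga * (r * t ^+ 2) by rewrite mulrCA /r divfK.
have br : b = - ga * (r ^+ 2 * t).
  apply: (mulfI (_ : - (ga * d) != 0)); first by rewrite oppr_eq0 mulf_neq0.
  transitivity (a ^+ 2); first by rewrite f1; ring.
  by rewrite ar -te; ring.
exists r, t; split=> //.
have r0 : r != 0.
  apply/eqP => r0; move: e3; rewrite ar br r0 => e.
  have /eqP : 2%:R * ga ^+ 3 * (c * d ^+ 2) = 0.
    by apply/eqP; rewrite -oppr_eq0; apply/eqP; apply: etrans e; ring.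
  by apply/negP; apply: mulf_neq0; apply: mulf_neq0 => //; apply: expf_neq0.
have a0 : a != 0.
  rewrite ar; apply: mulf_neq0; first by rewrite oppr_eq0.
  by apply: mulf_neq0 => //; apply: expf_neq0.
apply: (mulfI (_ : - ga * a != 0)); first by rewrite mulf_neq0 ?oppr_eq0.
transitivity (b ^+ 2); first by rewrite f2; ring.
by rewrite ar br; ring.
Qed.

Lemma singular_line : ga = 0 -> is_line (singular_point ruled_quartic).
Proof.
move=> g0; pose m := (<[pt E 0 0 1 0]> + <[pt E 0 0 0 1]>)%VS.
have mE a b c d : (pt E a b c d \in m) = (a == 0) && (b == 0).
  apply/memv_addP/andP => [[_ /vlineP[x ->] [_ /vlineP[y ->]]]|[/eqP-> /eqP->]].
    by rewrite !ptZ ptD !mulr0 !addr0 => /(pt_inj hE)[-> ->]; rewrite eqxx.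
  exists (c *: pt E 0 0 1 0); first by rewrite memvZ ?memv_line.
  exists (d *: pt E 0 0 0 1); first by rewrite memvZ ?memv_line.
  by rewrite !ptZ ptD; congr pt; ring.
exists m.
  rewrite dimv_disjoint_sum ?dim_vline ?pt_eq0 // ?oner_eq0 ?andbF //.
  apply/eqP; rewrite -subv0; apply/subvP => v; rewrite memv_cap => /andP[].
  move=> /vlineP[x ->] /vlineP[y]; rewrite !ptZ !mulr0 !mulr1.
  by move=> /(pt_inj hE)[_ _ -> _]; rewrite pt0 mem0v.
move=> v v0; have [a [b [c [d ev]]]] := pt_surj hE v; rewrite {}ev in v0 *.
rewrite mE; split=> [/singular_ruled_quartic[_ _ _ e3 e4]|/andP[/eqP a0 /eqP b0]].
  have e (x : K) : x ^+ 3 = 0 -> x == 0 by move=> /eqP; rewrite expf_eq0.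
  by apply/andP; split; apply: e; [apply: etrans e3 | apply: etrans e4]; rewrite g0; ring.
by apply/singular_ruled_quartic; split=> //; rewrite a0 b0 g0; ring.
Qed.

End RuledQuartic.

(** * Triplets of coplanar lines meeting l *)

Section LinesOfSpecialQuartic.
Variables (K : closedFieldType) (f : {mpoly K[4]}) (E : 'M[K]_4) (ga : K) (G : nat -> K).
Variables (l : {vspace 'rV[K]_4}) (om : K).
Hypotheses (ch2 : 2%:R != 0 :> K) (ch3 : 3%:R != 0 :> K).
Hypotheses (om2 : om ^+ 2 + om + 1 = 0) (om1 : om != 1).
Hypothesis hE : E \in unitmx.
Hypothesis hl : forall a b c d, (pt E a b c d \in l) = (c == 0) && (d == 0).
Hypothesis dl : \dim l = 2%N.
Hypothesis fE : forall a b c d, f.@[(pt E a b c d) 0]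
  = c * a ^+ 3 + d * b ^+ 3 + 3%:R * ga * (a * b * (c * d)) + bquartic G c d.
Hypothesis smooth : smooth_hypersurface f.

Lemma tangent_space_on_line x y :
  tangent_space f (pt E x y 0 0) = plane E (y ^+ 3) (- x ^+ 3).
Proof.
apply/vspaceP => v; have [a [b [c [d ->]]]] := pt_surj hE v.
rewrite [RHS]mem_plane // -[RHS]subr_eq0.
rewrite [LHS]mem_hyperplane (dot_gradient_special fE).
rewrite (_ : _ + _ = - (- x ^+ 3 * c - y ^+ 3 * d)) ?oppr_eq0 //.
by rewrite /bquartic_dc /bquartic_dd; ring.
Qed.

Lemma line_in_tangent_space P (m : {vspace 'rV[K]_4}) : P \in m -> subset_hypersurface m f ->
  (m <= tangent_space f P)%VS.
Proof.
move=> Pm mf; apply/subvP => v vm; rewrite /tangent_space mem_hyperplane.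
rewrite -coef1_line_restriction (@line_restrictionE _ _ _ _ _ 0) ?coef0 // => t.
by rewrite horner0; apply: mf; rewrite memvD ?memvZ.
Qed.

Lemma dim_tangent_space P : P \in l -> P != 0 -> \dim (tangent_space f P) = 3%N.
Proof.
have [x [y [c [d ->]]]] := pt_surj hE P; rewrite hl pt_eq0 //.
move=> /andP[/eqP-> /eqP->] nz; rewrite tangent_space_on_line dim_plane //.
by rewrite oppr_eq0 !expf_eq0 /= orbC -negb_and; move: nz; rewrite eqxx !andbT.
Qed.

Lemma l_sub_plane p q : (l <= plane E p q)%VS.
Proof.
apply/subvP => v; have [x [y [c [d ->]]]] := pt_surj hE v.
by rewrite hl mem_plane // => /andP[/eqP-> /eqP->]; rewrite !mulr0.
Qed.

Lemma plane_through_l H : \dim H = 3%N -> (l <= H)%VS ->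
  exists p q, (p != 0) || (q != 0) /\ H = plane E p q.
Proof.
move=> dH lH; have /subvPn[v vH] : ~~ (H <= l)%VS.
  by apply/negP => /dimvS; rewrite dH dl.
have [x [y [p [q ev]]]] := pt_surj hE v; rewrite {}ev in vH *; rewrite hl negb_and => pq.
exists p, q; split=> //; apply/esym/eqP; rewrite eqEdim dim_plane // dH leqnn andbT.
apply/subvP => u /(mem_planeP hE pq)[x' [y' [w ->]]].
have -> : pt E x' y' (w * p) (w * q) = w *: pt E x y p q + pt E (x' - w * x) (y' - w * y) 0 0.
  by rewrite ptZ ptD; congr pt; ring.
by rewrite memvD ?memvZ // (subvP lH) // hl eqxx.
Qed.

Definition line_meeting_l m := [/\ \dim m = 2%N, subset_hypersurface m f & meets_line l m].

Lemma dim_add_meeting m : line_meeting_l m -> \dim (m + l) = 3%N.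
Proof.
case=> dm _ [ml cap]; have := dimv_sum_cap m l; rewrite dm dl => e.
have c1 : (0 < \dim (m :&: l))%N by rewrite lt0n dimv_eq0.
have c2 : (\dim (m :&: l) < 2)%N.
  rewrite ltnNge; apply/negP => h; case/negP: ml.
  have e1 : (m :&: l)%VS = m by apply/eqP; rewrite eqEdim capvSl dm.
  by rewrite eqEdim dm dl leqnn andbT -e1 capvSr.
by move: e c1 c2; case: (\dim (m :&: l)) => [//|[|//]]; rewrite addn1 => -[].
Qed.

(** A plane containing two lines of the quartic that meet l contains l itself:
    otherwise both lines pass through the point of l in the plane, and they span
    with l the tangent plane there. *)
Lemma plane_of_two_lines_contains_l H m1 m2 : \dim H = 3%N -> m1 != m2 ->
  line_meeting_l m1 -> line_meeting_l m2 -> (m1 <= H)%VS -> (m2 <= H)%VS -> (l <= H)%VS.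
Proof.
move=> dH m12 [d1 f1 [n1 c1]] [d2 f2 [n2 c2]] s1 s2.
have [lH|lH] := boolP (l <= H)%VS; first by [].
have dcap : (\dim (l :&: H) <= 1)%N.
  rewrite leqNgt; apply/negP => h; case/negP: lH.
  by rewrite -(_ : (l :&: H)%VS = l) ?capvSr //; apply/eqP; rewrite eqEdim capvSl dl.
pose P := vpick (m1 :&: l)%VS; pose P' := vpick (m2 :&: l)%VS.
have Pn : P != 0 by rewrite vpick0.
have Pn' : P' != 0 by rewrite vpick0.
have := memv_pick (m1 :&: l)%VS; rewrite -/P memv_cap => /andP[Pm1 Pl].
have := memv_pick (m2 :&: l)%VS; rewrite -/P' memv_cap => /andP[Pm2' Pl'].
have lP : (l :&: H)%VS = <[P]>%VS.
  apply/esym/eqP; rewrite eqEdim dim_vline Pn dcap andbT -memvE memv_cap Pl.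
  exact: (subvP s1).
have Pm2 : P \in m2.
  have : P' \in (l :&: H)%VS by rewrite memv_cap Pl' (subvP s2).
  rewrite lP => /vlineP[k ek]; move: Pm2'; rewrite ek => /(memvZ k^-1).
  rewrite scalerA mulVf ?scale1r //; apply: contraNneq Pn' => k0.
  by rewrite ek k0 scale0r.
have sub : (m1 + m2 <= tangent_space f P)%VS by rewrite subv_add !line_in_tangent_space.
have d12 : (2 < \dim (m1 + m2))%N.
  rewrite ltnNge; apply/negP => h; case/negP: m12.
  have e1 : m1 = (m1 + m2)%VS by apply/eqP; rewrite eqEdim addvSl d1.
  have e2 : m2 = (m1 + m2)%VS by apply/eqP; rewrite eqEdim addvSr d2.
  by rewrite e1 -e2.
have e1 : (m1 + m2)%VS = tangent_space f P by apply/eqP; rewrite eqEdim sub dim_tangent_space.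
have e2 : (m1 + m2)%VS = H by apply/eqP; rewrite eqEdim subv_add s1 s2 dH.
case/negP: lH; rewrite -e2 e1; move: Pl; have [x [y [c [d ->]]]] := pt_surj hE P.
rewrite hl => /andP[/eqP-> /eqP->]; rewrite tangent_space_on_line; exact: l_sub_plane.
Qed.

Lemma line_splits m p q : (p != 0) || (q != 0) -> line_meeting_l m ->
  (m <= plane E p q)%VS -> splits ga G p q.
Proof.
move=> pq [dm fm ml] mp; rewrite /splits mulf_eq0.
have [//|p0] := eqVneq p 0; have [//|q0] := eqVneq q 0; rewrite /= bquartic_split_form.
have [x [y [u0 um]]] := lines_meeting_l hE hl dm ml.
have /subvPn[v vm vl] : ~~ (m <= l)%VS.
  by apply/negP => h; case: ml => /negP[]; rewrite eqEdim h dm dl.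
have := subvP mp _ vm => /(mem_planeP hE pq)[x' [y' [w ev]]].
have w0 : w != 0 by apply: contraNneq vl => w0; rewrite ev hl w0 !mul0r eqxx.
have v1 : pt E (x' / w) (y' / w) (1 * p) (1 * q) \in m.
  rewrite (_ : pt _ _ _ _ _ = w^-1 *: v) ?memvZ // ev ptZ.
  by congr pt; rewrite ?mulrA ?mulVf // mulrC.
have e : (3%:R * ga * (p * q)) ^+ 3 + 27%:R * (p * q * bquartic G p q) = 0.
  apply: (@line_on_hesse_cubic _ p q _ _ x y (x' / w) (y' / w)) => // t.
  have := fm (pt E (x' / w) (y' / w) (1 * p) (1 * q) + t *: pt E x y 0 0).
  rewrite memvD ?memvZ // => /(_ isT); rewrite /on_hypersurface ptZ ptD !mulr0 !addr0.
  by rewrite (special_fiberE fE) mul1r.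
apply/eqP; apply: (mulfI (_ : 27%:R * (p * q) != 0)).
  by rewrite !mulf_neq0 // (_ : 27%:R = 3%:R * 3%:R * 3%:R) ?mulf_neq0 // -!natrM.
by rewrite mulr0; apply: etrans e; ring.
Qed.

(** They are the zero sets of the three linear factors of the fibre. *)
Lemma three_lines_in_plane p q : (p != 0) || (q != 0) -> splits ga G p q ->
  exists T : {fset {vspace 'rV[K]_4}}, #|` T|%fset = 3%N /\
    forall m, m \in T <-> line_meeting_l m /\ (m <= plane E p q)%VS.
Proof.
move=> pq sp.
have [al [de [ep [e1 e2 e3 e4 two]]]] := split_cube_roots ch2 ch3 hE fE smooth pq sp.
pose line z := plane_line E p q al (z * de) (z ^+ 2 * ep).
have mline z x y w : (pt E x y (w * p) (w * q) \in line z)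
    = (dot (row3 x y w) (tri_form al de ep z) == 0).
  by rewrite mem_plane_line // dot_tri_form.
have dline z : z \in unity_roots om -> \dim (line z) = 2%N.
  by move=> zu; apply: dim_plane_line => //; exact: (tri_form_neq0 om2 two zu).
have fprod x y w : (special_fiber ga G p q).@[(row3 x y w) 0] =
    \prod_(z <- unity_roots om) dot (row3 x y w) (tri_form al de ep z).
  by rewrite (special_fiber_tri e1 e2 e3 e4) meval_hesse prod_tri_form //; ring.
have zn z : z \in unity_roots om -> z != 0.
  move=> /(unity_roots_cube om2) z3; apply/eqP => z0.
  by move: z3; rewrite z0 expr0n /= => /esym/eqP; rewrite oner_eq0.
have ade : (al != 0) || (de != 0).
  by move: two; case: (al == 0); case: (de == 0).
have notl z : z \in unity_roots om -> line z != l.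
  move=> zu; apply/eqP => e.
  have h x y : pt E x y (0 * p) (0 * q) \in line z by rewrite e hl !mul0r eqxx.
  have := h 1 0; have := h 0 1; rewrite !mline !dot_tri_form !mulr0 !addr0 !mulr1 add0r.
  rewrite mulf_eq0 (negPf (zn _ zu)) /= => /eqP d0 /eqP a0.
  by move: ade; rewrite d0 a0 eqxx.
have linj : {in unity_roots om &, injective line}.
  move=> z z' zu zu' e; apply/eqP/negPn/negP.
  move=> /(tri_form_separated om2 two zu zu')[x [y [w [h0 h1]]]].
  by case/negP: h1; rewrite -mline -e mline h0.
exists [fset m in [seq line z | z <- unity_roots om]]%fset; split.
  rewrite card_fseq undup_id ?size_map // map_inj_in_uniq //.
  exact: unity_roots_uniq.
move=> m; rewrite in_fset; split=> [/mapP[z zu ->]|[[dm fm [ml mcap]] mp]].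
  split; last exact: plane_line_sub.
  split; first exact: dline.
    move=> v vm; have vp : v \in plane E p q.
      exact: (subvP (plane_line_sub hE p q al (z * de) (z ^+ 2 * ep)) _ vm).
    have [x [y [w ev]]] := mem_planeP hE pq vp; move: vm; rewrite ev mline => /eqP h.
    rewrite /on_hypersurface (special_fiberE fE) fprod (big_rem z) //= h.
    by rewrite mul0r mulr0.
  split; first exact: notl.
  have pz : pt E (z * de) (- al) (0 * p) (0 * q) \in line z.
    by rewrite mline dot_tri_form; apply/eqP; ring.
  apply/negP => /eqP c0.
  have : pt E (z * de) (- al) (0 * p) (0 * q) \in (line z :&: l)%VS.
    by rewrite memv_cap pz hl !mul0r eqxx.
  rewrite c0 memv0 pt_eq0 // oppr_eq0 mulf_eq0 (negPf (zn _ zu)) /= => /and3P[/eqP d0 /eqP a0 _].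
  by move: ade; rewrite d0 a0 eqxx.
(* Pull m back to the coordinates of the plane: it lies on the union of the line
   w = 0, that is l, and of the three lines of the fibre. *)
pose F := linfun (mulmxr (frame E p q) : 'rV[K]_3 -> 'rV[K]_4).
have Fm : (F @: (F @^-1: m))%VS = m.
  by rewrite lpreimK //; have [_ -> _] := plane_frame hE hl pq.
have prod0 u : u \in (F @^-1: m)%VS -> \prod_(c <- col3 0 0 1 ::
    [seq tri_form al de ep z | z <- unity_roots om]) dot u c = 0.
  have [x [y [w ->]]] := row3_surj u.
  set s := [seq _ | _ <- _].
  rewrite -memv_preim lfunE /= row3_frame => um; rewrite big_cons big_map.
  by rewrite dot_row3 !mulr0 !add0r mulr1 -fprod -(special_fiberE fE); apply: fm.
have [c cs mc] := subv_hyperplane_of_prod prod0.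
move: cs; rewrite in_cons => /orP[/eqP ec|/mapP[z zu ec]].
  case/negP: ml; rewrite eqEdim dm dl leqnn andbT -Fm.
  apply/subvP => _ /memv_imgP[u /(subvP mc) uc ->]; move: uc.
  have [x [y [w ->]]] := row3_surj u.
  rewrite ec mem_hyperplane dot_row3 !mulr0 !add0r mulr1 => /eqP ->.
  by rewrite lfunE /= row3_frame hl !mul0r eqxx.
apply/mapP; exists z => //; apply/eqP; rewrite eqEdim dm dline // leqnn andbT -Fm.
by rewrite /line /plane_line -/(tri_form al de ep z) -ec; apply: limgS.
Qed.

Lemma finite_choice (A B : Type) (P : A -> B -> Prop) (b0 : B) (s : seq A) :
  (forall x, exists y, P x y) -> exists t, size t = size s /\
    forall i x0, (i < size s)%N -> P (nth x0 s i) (nth b0 t i).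
Proof.
move=> h; elim: s => [|x s [t [st tP]]]; first by exists [::].
have [y xy] := h x; exists (y :: t); split; first by rewrite /= st.
by case=> [|i] x0 //= /tP.
Qed.

(** The plane of a triplet contains l, by plane_of_two_lines_contains_l, and its
    fibre splits, by line_splits; so the triplet consists of all the lines of
    three_lines_in_plane. *)
Lemma triplets_of_slopes (sl : seq (K * K)) :
  (forall x, x \in sl -> (x.1 != 0) || (x.2 != 0) /\ splits ga G x.1 x.2) ->
  (forall p q, (p != 0) || (q != 0) -> splits ga G p q ->
     exists2 x, x \in sl & plane E p q = plane E x.1 x.2) ->
  uniq [seq plane E x.1 x.2 | x <- sl] ->
  triplets_in_planes f l [seq plane E x.1 x.2 | x <- sl].
Proof.
move=> slP slc slu.
pose Q x (T : {fset {vspace 'rV[K]_4}}) := x \in sl -> #|` T|%fset = 3%N /\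
    forall m, m \in T <-> line_meeting_l m /\ (m <= plane E x.1 x.2)%VS.
have [x|tr [st trP]] := @finite_choice _ _ Q fset0 sl.
  have [xs|xs] := boolP (x \in sl); last by exists fset0 => h; rewrite h in xs.
  have [pq sp] := slP _ xs; have [T TP] := three_lines_in_plane pq sp.
  by exists T.
have trQ i : (i < size sl)%N -> #|` nth fset0 tr i|%fset = 3%N /\
    forall m, m \in nth fset0 tr i <->
      line_meeting_l m /\ (m <= nth 0%VS [seq plane E x.1 x.2 | x <- sl] i)%VS.
  move=> il; rewrite (nth_map (0, 0)) //.
  by have := trP i (0, 0) il (mem_nth _ il).
have ex3 (T : {fset {vspace 'rV[K]_4}}) : #|` T|%fset = 3%N ->
    exists m1 m2, [/\ m1 \in T, m2 \in T & m1 != m2].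
  move=> c3; have u := fset_uniq T; have {c3} sz : size (enum_fset T) = 3%N by [].
  have memT m : m \in enum_fset T -> m \in T by [].
  case e : (enum_fset T) u sz memT => [|m1 [|m2 s]] //= u _ memT; exists m1, m2.
  split; [by apply: memT; rewrite mem_head | by apply: memT; rewrite !inE eqxx orbT |].
  by move: u; rewrite !inE negb_or => /andP[/andP[]].
exists tr; rewrite size_map; split=> //.
- apply/(uniqP fset0) => i j; rewrite !inE st => il jl eij.
  have [c3 mi] := trQ i il; have [_ mj] := trQ j jl; rewrite -eij in mj.
  have [m [_ [mT _ _]]] := ex3 _ c3.
  have [lm m_i] := (mi m).1 mT; have [_ m_j] := (mj m).1 mT.
  apply/eqP; rewrite -(nth_uniq 0%VS _ _ slu) ?size_map //.
  have d3 k : (k < size sl)%N -> (m <= nth 0%VS [seq plane E x.1 x.2 | x <- sl] k)%VS ->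
      (m + l)%VS = nth 0%VS [seq plane E x.1 x.2 | x <- sl] k.
    move=> kl; rewrite (nth_map (0, 0)) // => mk; apply/eqP.
    rewrite eqEdim subv_add mk l_sub_plane dim_add_meeting //.
    by have [pq _] := slP _ (mem_nth (0, 0) kl); rewrite dim_plane.
  by rewrite -(d3 i) // -(d3 j).
- move=> T; split=> [/(nthP fset0)[i]|[c3 Tm [H dH TH]]].
    rewrite st => il <-; have [c3 mi] := trQ i il.
    split=> // [m /mi[]//|]; exists (nth 0%VS [seq plane E x.1 x.2 | x <- sl] i).
      by rewrite (nth_map (0, 0)) // dim_plane //; case: (slP _ (mem_nth (0, 0) il)).
    by move=> m /mi[].
  have [m1 [m2 [t1 t2 m12]]] := ex3 _ c3.
  have lH := plane_of_two_lines_contains_l dH m12 (Tm _ t1) (Tm _ t2) (TH _ t1) (TH _ t2).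
  have [p [q [pq eH]]] := plane_through_l dH lH.
  have sp : splits ga G p q by apply: (line_splits pq (Tm _ t1)); rewrite -eH TH.
  have [x xs ex] := slc p q pq sp.
  apply/(nthP fset0); exists (index x sl); first by rewrite st index_mem.
  have il : (index x sl < size sl)%N by rewrite index_mem.
  have [c3' mi] := trQ _ il; apply/esym/eqP; rewrite eqEfcard c3 c3' leqnn andbT.
  apply/fsubsetP => m mT; apply/mi; split; first exact: Tm.
  by rewrite (nth_map (0, 0)) // nth_index // -ex -eH TH.
- by move=> i il m; have [_ mi] := trQ i il; case/mi.
Qed.

End LinesOfSpecialQuartic.

(** * The surface swept out by Segre's lines *)

Section SquareFree.
Variables (K : closedFieldType).

Lemma irreducible_squarefree (n : nat) (p : {mpoly K[n]}) :
  irreducible_mpoly p -> squarefree_mpoly p.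
Proof.
case=> _ _ irr q r; rewrite expr2 -mulrA => /irr[//|].
by rewrite unitrM => /andP[].
Qed.

Lemma squarefree_mulX (n : nat) (j : 'I_n) (p : {mpoly K[n]}) :
  ~ vanishes_on_axis j p -> squarefree_mpoly p -> squarefree_mpoly ('X_j * p).
Proof.
move=> np sp q r e; have X0 : 'X_j != 0 :> {mpoly K[n]}.
  by rewrite -msize_poly_eq0 msizeX mdeg1.
have : vanishes_on_axis j (q * (q * r)).
  by move=> v vj; rewrite mulrA -expr2 -e mevalM mevalXU vj mul0r.
have bad : ~ vanishes_on_axis j q.
  move=> /vanishes_on_axisP[s es]; apply: np => v vj.
  have /(mulfI X0) -> : 'X_j * p = 'X_j * ('X_j * (s ^+ 2 * r)) by rewrite e es; ring.
  by rewrite mevalM mevalXU vj mul0r.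
case/vanishes_on_axisM => // /vanishes_on_axisM[] // /vanishes_on_axisP[s es].
by apply: (sp q s); apply: (mulfI X0); rewrite e es mulrCA.
Qed.

Lemma squarefree_lin_subst (T : 'M[K]_4) (p : {mpoly K[4]}) : T \in unitmx ->
  squarefree_mpoly (lin_subst T p) -> squarefree_mpoly p.
Proof.
move=> Tu sp q r e; rewrite -(lin_substK q Tu); apply: lin_subst_unit.
by apply: (sp _ (lin_subst T r)); rewrite e expr2 !lin_substM -expr2.
Qed.

End SquareFree.

Section SegreQuartic.
Variables (K : closedFieldType) (f : {mpoly K[4]}) (E : 'M[K]_4) (ga : K) (G : nat -> K).
Variables (l : {vspace 'rV[K]_4}) (om : K).
Hypotheses (ch2 : 2%:R != 0 :> K) (ch3 : 3%:R != 0 :> K).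
Hypotheses (om2 : om ^+ 2 + om + 1 = 0) (om1 : om != 1).
Hypothesis hE : E \in unitmx.
Hypothesis hl : forall a b c d, (pt E a b c d \in l) = (c == 0) && (d == 0).
Hypothesis dl : \dim l = 2%N.
Hypothesis fE : forall a b c d, f.@[(pt E a b c d) 0]
  = c * a ^+ 3 + d * b ^+ 3 + 3%:R * ga * (a * b * (c * d)) + bquartic G c d.
Hypothesis smooth : smooth_hypersurface f.

Lemma gradient_P1 : gradient f (pt E 1 0 0 0) = X2 E.
Proof.
apply: dot_ext => v; have [a [b [c [d ->]]]] := pt_surj hE v.
rewrite (dot_gradient_special fE) dotX2 // /bquartic_dc /bquartic_dd; ring.
Qed.

Lemma gradient_P2 : gradient f (pt E 0 1 0 0) = X3 E.
Proof.
apply: dot_ext => v; have [a [b [c [d ->]]]] := pt_surj hE v.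
rewrite (dot_gradient_special fE) dotX3 // /bquartic_dc /bquartic_dd; ring.
Qed.

Lemma tangent_P1 : tangent_space f (pt E 1 0 0 0) = plane E 0 1.
Proof.
rewrite (tangent_space_on_line hE fE) expr0n expr1n /=; apply/eqP.
by rewrite eq_plane // ?oppr_eq0 ?oner_eq0 ?orbT // mulr0 mul0r eqxx.
Qed.

Lemma tangent_P2 : tangent_space f (pt E 0 1 0 0) = plane E 1 0.
Proof.
rewrite (tangent_space_on_line hE fE) expr0n expr1n /= oppr0; apply/eqP.
by rewrite eq_plane // ?oner_eq0 ?orbT // mulr0 mul0r eqxx.
Qed.

(** The quartic is irreducible and contains neither of the two planes. *)
Lemma squarefree_sextic :
  squarefree_mpoly (linform (X2 E) * linform (X3 E) * ruled_quartic E ga).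
Proof.
pose o2 := @Ordinal 4 2 isT; pose o3 := @Ordinal 4 3 isT.
apply: (squarefree_lin_subst hE).
have SE a b c d : (lin_subst E (ruled_quartic E ga)).@[(row4 a b c d) 0] =
    c * a ^+ 3 + d * b ^+ 3 + 3%:R * ga * (a * b * (c * d)) - ga ^+ 3 * (c ^+ 2 * d ^+ 2).
  by rewrite meval_lin_subst -/(pt E a b c d) meval_ruled_quartic.
have -> : lin_subst E (linform (X2 E) * linform (X3 E) * ruled_quartic E ga) =
    'X_o2 * ('X_o3 * lin_subst E (ruled_quartic E ga)).
  apply: meval_inj => v; have [a [b [c [d ->]]]] := row4_surj v.
  rewrite meval_lin_subst -/(pt E a b c d) !mevalM !meval_linform dotX2 // dotX3 //.
  by rewrite SE meval_ruled_quartic // !mevalXU !mxE /=; ring.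
apply: squarefree_mulX.
  move=> /(_ (row4 0 1 0 1)); rewrite mevalM mevalXU SE !mxE => /(_ erefl) /= e.
  by case/eqP: (oner_neq0 K); apply: etrans e; ring.
apply: squarefree_mulX.
  move=> /(_ (row4 1 0 1 0)); rewrite SE !mxE => /(_ erefl) /= e.
  by case/eqP: (oner_neq0 K); apply: etrans e; ring.
apply: irreducible_squarefree.
have [Sn SU Sirr] := irreducible_ruled_quartic ga hE.
have back (p : {mpoly K[4]}) : p = lin_subst (invmx E) (lin_subst E p).
  by rewrite lin_substK.
split.
- apply: contraNneq Sn => e; rewrite [ruled_quartic _ _]back e.
  by apply/eqP/meval_inj => v; rewrite meval_lin_subst !meval0.
- by apply/negP => /(lin_subst_unit (invmx E)); rewrite -back; apply/negP.
- move=> q r e; have Ei : invmx E \in unitmx by rewrite unitmx_inv.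
  have unsub (p : {mpoly K[4]}) : lin_subst (invmx E) p \is a GRing.unit ->
      p \is a GRing.unit.
    by move=> /(lin_subst_unit (invmx (invmx E))); rewrite lin_substK.
  have := back (ruled_quartic E ga); rewrite e lin_substM => /Sirr.
  by case=> /unsub; [left | right].
Qed.

(** The last hypothesis expresses tangency: its conclusion is the linear term of
    the fibre at (x, y, 0), up to the factor 3. *)
Lemma segre_line_intro x y p q al de ep : (p != 0) || (q != 0) ->
  row3 x y 0 != 0 -> q * y ^+ 3 = - (p * x ^+ 3) -> col3 al de ep != 0 ->
  al * x + de * y = 0 ->
  (forall x' y' w', al * x' + de * y' + ep * w' = 0 ->
     p * x ^+ 2 * x' + q * y ^+ 2 * y' + ga * (p * q) * (x * y) * w' = 0) ->
  segre_lines f l (plane_line E p q al de ep).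
Proof.
move=> pq u0 e c0 ex h.
have xy : (x != 0) || (y != 0) by move: u0; rewrite row3_neq0 eqxx orbF.
have tH : tangent_space f (pt E x y 0 0) = plane E p q.
  rewrite (tangent_space_on_line hE fE); apply/eqP; rewrite eq_plane // oppr_eq0.
  rewrite !expf_eq0 /= orbC xy /=; apply/eqP.
  by rewrite [y ^+ 3 * q]mulrC e mulNr mulrC.
exists (pt E x y 0 0), (frame E p q), (special_fiber ga G p q), (row3 x y 0).
have uP : row3 x y 0 *m frame E p q = pt E x y 0 0 by rewrite row3_frame !mul0r.
rewrite tH; split.
- exact: dim_plane_line.
- rewrite hl eqxx pt_eq0 // !eqxx !andbT; split=> //.
  by rewrite negb_and.
- exact: plane_line_sub.
- by split=> //; apply: (special_plane_fiber hE fE hl).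
split=> //.
  rewrite /frame_preim -memv_preim lfunE /= row3_frame mem_plane_line //.
  by rewrite mulr0 addr0 ex eqxx.
move=> z; have [x' [y' [w' ->]]] := row3_surj z.
rewrite /frame_preim -memv_preim lfunE /= row3_frame mem_plane_line // => /eqP m.
apply/dvdXn_coef => -[|[|//]] _; rewrite line_restriction_hesse coef_Poly /=.
  by rewrite e; ring.
by apply: etrans (etrans (congr1 (fun t => 3%:R * t) (h _ _ _ m)) (mulr0 _)); ring.
Qed.

(** Unless P is one of the two ramification points, tangency determines the line,
    which turns out to be a ruling of the quartic. *)
Lemma surface_S8_sub v : surface_S8 f l v ->
  (linform (X2 E) * linform (X3 E) * ruled_quartic E ga).@[v 0] = 0.
Proof.
case=> m [P [M [g [u [dm [Pl P0] mT [fib uP] [u0 um hge]]]]]] vm.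
have [x [y [c0 [d0 eP]]]] := pt_surj hE P; rewrite {}eP in Pl P0 mT fib uP.
move: Pl P0 mT fib uP; rewrite hl pt_eq0 // => /andP[/eqP-> /eqP->].
rewrite (tangent_space_on_line hE fE) eqxx !andbT => xy mT fib uP.
have [p [q [T [Tu pq eM eH gT]]]] := fiberP hE hl (special_fiberE fE) fib.
have [[_ ME _] _] := fib.
have : v \in limg (linfun (mulmxr M : 'rV[K]_3 -> 'rV[K]_4)) by rewrite ME (subvP mT).
case/memv_imgP => z _ ev; rewrite lfunE /= in ev.
have := hge z; rewrite /frame_preim -memv_preim lfunE /= -ev => /(_ vm).
rewrite (line_restriction_change gT).
have uT : u *m T = row3 x y 0.
  have [x1 [y1 [w1 e1]]] := row3_surj (u *m T).
  move: uP; rewrite eM mulmxA e1 row3_frame => /(pt_inj hE)[-> -> /eqP + /eqP].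
  rewrite !mulf_eq0; have [-> //|_ /= p0 q0] := eqVneq w1 0.
  by rewrite p0 q0 in pq.
have [x' [y' [w' ez]]] := row3_surj (z *m T).
rewrite uT ez => /dvdXn_coef /(_ 1%N isT); rewrite line_restriction_hesse coef_Poly /= => tg.
rewrite ev eM mulmxA ez row3_frame !mevalM !meval_linform dotX2 // dotX3 //.
rewrite meval_ruled_quartic //.
have /esym/eqP : q * y ^+ 3 = - (p * x ^+ 3).
  have : plane E p q == plane E (y ^+ 3) (- x ^+ 3) by rewrite eH.
  rewrite eq_plane //; last by rewrite oppr_eq0 !expf_eq0 /= orbC -negb_and.
  by rewrite mulrN => /andP[_ /eqP].
have [->|p0] := eqVneq p 0; first by move=> _; rewrite mulr0 !mul0r.
have [->|q0] := eqVneq q 0; first by move=> _; rewrite mulr0 mulr0 mul0r.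
move=> /eqP rel.
have y0 : y != 0.
  apply/eqP => y0; move: rel xy; rewrite y0 expr0n /= mulr0 => /eqP.
  rewrite oppr_eq0 => /eqP /(mul_power_eq0 p0) ->; by rewrite eqxx.
have x0 : x != 0.
  apply/eqP => x0; move: rel; rewrite x0 expr0n /= mulr0 oppr0 => /esym.
  by move=> /(mul_power_eq0 q0) /eqP; rewrite (negPf y0).
pose k := p / y ^+ 3.
have pk : p = k * y ^+ 3 by rewrite /k divfK ?expf_neq0.
have qk : q = - (k * x ^+ 3).
  apply: (mulIf (_ : y ^+ 3 != 0)); first by rewrite expf_neq0.
  by rewrite -rel pk; ring.
have kn : k != 0 by rewrite /k mulf_neq0 ?invr_eq0 ?expf_neq0.
(* The tangency condition, up to a nonzero factor. *)
have D : ga * (k * x ^+ 2 * y ^+ 2 * w') = y * x' - x * y'.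
  apply: (mulfI (_ : 3%:R * (k * (x ^+ 2 * y ^+ 2)) != 0)).
    by apply: mulf_neq0 => //; apply: mulf_neq0 => //; apply: mulf_neq0; apply: expf_neq0.
  apply/eqP; rewrite -subr_eq0 -oppr_eq0; apply/eqP; apply: etrans tg.
  by rewrite pk qk; ring.
suff -> : w' * p * x' ^+ 3 + w' * q * y' ^+ 3 + 3%:R * ga * (x' * y' * (w' * p * (w' * q)))
    - ga ^+ 3 * ((w' * p) ^+ 2 * (w' * q) ^+ 2) = 0 by rewrite mulr0.
transitivity (w' * k * ((y * x') ^+ 3 - (x * y') ^+ 3
   - 3%:R * (y * x' * (x * y')) * (ga * (k * x ^+ 2 * y ^+ 2 * w'))
   - (ga * (k * x ^+ 2 * y ^+ 2 * w')) ^+ 3)); first by rewrite pk qk; ring.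
by rewrite D; ring.
Qed.

Lemma sub_surface_S8 (v : 'rV[K]_4) : v != 0 ->
  (linform (X2 E) * linform (X3 E) * ruled_quartic E ga).@[v 0] = 0 -> surface_S8 f l v.
Proof.
move=> v0 /eqP; rewrite !mevalM !meval_linform !mulf_eq0 => cases.
have [a [b [c [d ev]]]] := pt_surj hE v.
(* Any line through the singular point of a ramified fibre will do; this form
   defines one through v. *)
have through (a' b' : K) : exists de ep, [/\ (de != 0) || (ep != 0) & de * a' + ep * b' = 0].
  have [a0|a0] := eqVneq a' 0.
    by exists 1, 0; rewrite oner_eq0 a0; split=> //; ring.
  by exists b', (- a'); rewrite oppr_eq0 a0 orbT; split=> //; ring.
case/orP: cases => [/orP[]|/eqP Sv].
- rewrite ev dotX2 // => /eqP c0; have [de [ep [nz e]]] := through b d.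
  exists (plane_line E 0 1 0 de ep).
    apply: (@segre_line_intro 1 0) => //; rewrite ?oner_eq0 ?orbT ?row3_neq0 ?oner_eq0 //.
    + by rewrite expr0n /=; ring.
    + by rewrite col3_neq0 nz orbT.
    + by ring.
    + by move=> x' y' w' _; rewrite expr0n /=; ring.
  rewrite c0 -[X in pt E _ _ X _](mulr0 d) -[X in pt E _ _ _ X](mulr1 d).
  by rewrite mem_plane_line ?oner_eq0 ?orbT // mul0r add0r e.
- rewrite ev dotX3 // => /eqP d0; have [al [ep [nz e]]] := through a c.
  exists (plane_line E 1 0 al 0 ep).
    apply: (@segre_line_intro 0 1) => //; rewrite ?oner_eq0 ?orbT ?row3_neq0 ?oner_eq0 ?orbT //.
    + by rewrite expr0n /=; ring.
    + by rewrite col3_neq0 eqxx.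
    + by ring.
    + by move=> x' y' w' _; rewrite expr0n /=; ring.
  rewrite d0 -[X in pt E _ _ X _](mulr1 c) -[X in pt E _ _ _ X](mulr0 c).
  by rewrite mem_plane_line ?oner_eq0 // mul0r addr0 e.
have [s [t [st vm]]] := ruling_through hE om2 v0 Sv.
exists (ruling E ga s t) => //.
apply: (@segre_line_intro t (- s)) => //.
- exact: cube_slope_neq0.
- by rewrite row3_neq0 oppr_eq0 eqxx orbF orbC.
- by ring.
- by rewrite col3_neq0 orbA st.
- by ring.
- move=> x' y' w' e.
  transitivity (s ^+ 2 * t ^+ 2 * (s * x' + t * y' + - (ga * (s ^+ 2 * t ^+ 2)) * w')).
    by ring.
  by rewrite e mulr0.
Qed.

Lemma reduced_surface_S8 : reduced_surface (surface_S8 f l) 6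
  (linform (gradient f (pt E 1 0 0 0)) * linform (gradient f (pt E 0 1 0 0))
     * ruled_quartic E ga).
Proof.
rewrite gradient_P1 gradient_P2; split; last first.
- by move=> v v0; split; [exact: sub_surface_S8 | exact: surface_S8_sub].
- exact: squarefree_sextic.
apply: dhomogI => t v; rewrite !mevalM !meval_linform !dotZl.
by rewrite (dhomog_meval _ _ (ruled_quartic_homog ga hE)); ring.
Qed.

(** * Existence and uniqueness of the Segre decomposition *)

Variable rs : seq K.
Hypotheses (rs_size : size rs = 4%N) (rs_uniq : uniq rs) (rs0 : 0 \notin rs).
Hypothesis rsE : forall c d,
  bquartic (split_form ga G) c d = G 4%N * \prod_(r <- rs) (d - r * c).

Let G4 : G 4%N != 0 := special_G4 ch2 ch3 hE fE smooth.

(** The leading coefficient G 4 is put into one of the forms, so that the product is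
    exact. *)
Lemma segre_planes : exists L : 4.-tuple 'cV[K]_4,
  [/\ forall c, c \in L -> c != 0,
      [seq hyperplane c | c <- L] = [seq plane E 1 r | r <- rs],
      (\bigcap_(c <- L) hyperplane c)%VS = l
    & forall a b c d, \prod_(u <- L) dot (pt E a b c d) u = bquartic (split_form ga G) c d].
Proof.
case: rs rs_size rs_uniq rsE => [|r1 [|r2 [|r3 [|r4 []]]]] // _ ru rE.
pose L := [tuple G 4%N *: plane_form E 1 r1; plane_form E 1 r2; plane_form E 1 r3;
  plane_form E 1 r4].
have n1 r : plane_form E 1 r != 0 by rewrite plane_form_neq0 // oner_eq0.
have hG : hyperplane (G 4%N *: plane_form E 1 r1) = plane E 1 r1.
  apply/vspaceP => v; rewrite /plane !mem_hyperplane dotZr mulf_eq0.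
  by rewrite (negPf G4).
exists L; split.
- by move=> c; rewrite !inE => /or4P[] /eqP->; rewrite ?n1 // scaler_eq0 negb_or G4 n1.
- by rewrite /= hG.
- rewrite !big_cons big_nil hG capvf; apply/vspaceP => v.
  have [a [b [c [d ->]]]] := pt_surj hE v; rewrite hl !memv_cap !mem_plane // !mul1r.
  apply/idP/andP => [/and4P[/eqP h1 /eqP h2 _ _]|[/eqP-> /eqP->]]; last by rewrite !mulr0 eqxx.
  have r12 : r1 - r2 != 0.
    by move: ru; rewrite /= !inE !negb_or subr_eq0 => /andP[/andP[]].
  have c0 : c = 0 by apply: (mulfI r12); rewrite mulrBl h1 h2 subrr mulr0.
  by rewrite -h1 c0 mulr0 eqxx.
- move=> a b c d; rewrite rE !big_cons !big_nil dotZr !dot_plane_form //; ring.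
Qed.

Lemma special_is_segre (L : 4.-tuple 'cV[K]_4) : (forall c, c \in L -> c != 0) ->
  (\bigcap_(c <- L) hyperplane c)%VS = l ->
  (forall a b c d, \prod_(u <- L) dot (pt E a b c d) u = bquartic (split_form ga G) c d) ->
  segre_decomposition f l (1 *: ruled_quartic E ga) L.
Proof.
move=> Ln Lcap Lprod; rewrite scale1r; have [Sn _ _] := irreducible_ruled_quartic ga hE.
split=> //.
- by split=> //; exact: ruled_quartic_homog.
- exact: (ruled_quartic_meeting_lines hE ch2 om2 hl).
exists 1; rewrite ?oner_eq0 // scale1r; apply: meval_inj => v.
have [a [b [c [d ->]]]] := pt_surj hE v.
rewrite fE mevalD meval_ruled_quartic // rmorph_prod /=.
under eq_bigr => u _ do rewrite meval_linform.
by rewrite Lprod bquartic_split_form; ring.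
Qed.

(** The relation of segre_relation determines the part of S of degree four in
    (c, d), and then the product of the planes, hence the planes. *)
Lemma segre_unique (L : 4.-tuple 'cV[K]_4) :
  (forall c, c \in L -> c != 0) ->
  (forall a b c d, \prod_(u <- L) dot (pt E a b c d) u = bquartic (split_form ga G) c d) ->
  forall S Lhat, segre_decomposition f l S Lhat ->
  (exists2 a : K, a != 0 & S = a *: ruled_quartic E ga) /\
  [seq hyperplane c | c <- Lhat] =i [seq hyperplane c | c <- L].
Proof.
move=> Ln Lprod S Lhat dec.
pose B (i : nat) : K := if i == 1%N then 3%:R * ga else 0.
have fB a b c d : f.@[(pt E a b c d) 0]
    = c * a ^+ 3 + d * b ^+ 3 + a * b * bquad B c d + bquartic G c d.
  by rewrite fE /bquad /B /=; ring.
have [a [h [a0 SE LhE rel]]] := segre_relation hE hl fB dec.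
have [_ _ rel'] := segre_coefficients ch3 rel.
have nz27 : 27%:R != 0 :> K.
  by rewrite (_ : 27%:R = 3%:R * 3%:R * 3%:R) ?mulf_neq0 // -!natrM.
have Gh c d : bquartic (fun i => G i - h i) c d = - (ga ^+ 3 * (c ^+ 2 * d ^+ 2)).
  by apply: (mulfI nz27); rewrite rel' /B /=; ring.
split.
  exists a => //; apply: meval_inj => v; have [x [y [c [d ->]]]] := pt_surj hE v.
  by rewrite SE Gh mevalZ meval_ruled_quartic // /bquad /B /=; ring.
have prods v : \prod_(u <- Lhat) dot v u = a * \prod_(u <- L) dot v u.
  have [x [y [c [d ->]]]] := pt_surj hE v; rewrite LhE Lprod bquartic_split_form.
  congr (_ * _); transitivity (bquartic G c d - bquartic (fun i => G i - h i) c d).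
    by rewrite /bquartic; ring.
  by rewrite Gh opprK.
have [_ _ Lhn _ _] := dec.
have sub (L1 L2 : 4.-tuple 'cV[K]_4) : (forall c, c \in L1 -> c != 0) ->
    (forall c, c \in L2 -> c != 0) ->
    (forall v, \prod_(u <- L1) dot v u = 0 -> \prod_(u <- L2) dot v u = 0) ->
    {subset [seq hyperplane c | c <- L1] <= [seq hyperplane c | c <- L2]}.
  move=> n1 n2 z _ /mapP[c cL1 ->].
  have [|c' cL2 cc'] := @subv_hyperplane_of_prod _ _ (hyperplane c) L2.
    move=> v; rewrite mem_hyperplane => /eqP vc; apply: z.
    by rewrite (big_rem c) //= vc mul0r.
  by apply/mapP; exists c' => //; apply: hyperplane_sub => //; [exact: n1 | exact: n2].
move=> H; apply/idP/idP; apply: sub => // v; rewrite prods.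
  by move=> /eqP; rewrite mulf_eq0 (negPf a0) => /eqP.
by move=> ->; rewrite mulr0.
Qed.

(** * Planes with a singular fibre, and types of the fibration *)

Definition split_slopes : seq (K * K) := [:: (0, 1), (1, 0) & [seq (1, r) | r <- rs]].

Lemma plane_slope1 p q : p != 0 -> plane E p q = plane E 1 (q / p).
Proof.
move=> p0; apply/eqP; rewrite eq_plane // ?oner_eq0 // p0 /= mulr1.
by rewrite mulrC divfK.
Qed.

Lemma plane_slope0 q : q != 0 -> plane E 0 q = plane E 0 1.
Proof.
by move=> q0; apply/eqP; rewrite eq_plane // ?oner_eq0 ?orbT // q0 orbT mulr0 mul0r eqxx.
Qed.

Lemma split_slopesP x : x \in split_slopes ->
  (x.1 != 0) || (x.2 != 0) /\ splits ga G x.1 x.2.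
Proof.
rewrite !inE => /or3P[/eqP->|/eqP->|/mapP[r rr ->]] /=.
- by rewrite oner_eq0 orbT /splits mul0r eqxx.
- by rewrite oner_eq0 /splits mulr0 eqxx.
rewrite oner_eq0 /splits rsE (big_rem r) //= mulr1 subrr mul0r mulr0 eqxx orbT.
by [].
Qed.

Lemma root_slope (h : nat -> K) (ts : seq K) p q : p != 0 ->
  (forall c d, bquartic h c d = G 4%N * \prod_(r <- ts) (d - r * c)) ->
  bquartic h p q = 0 -> q / p \in ts.
Proof.
move=> p0 hts /eqP; rewrite hts mulf_eq0 (negPf G4) /= prodf_seq_eq0.
move=> /hasP[r rt /= /eqP e]; rewrite (_ : q / p = r) //.
by apply: (mulIf p0); rewrite divfK //; apply/eqP; rewrite -subr_eq0 e.
Qed.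

Lemma split_slopes_complete p q : (p != 0) || (q != 0) -> splits ga G p q ->
  exists2 x, x \in split_slopes & plane E p q = plane E x.1 x.2.
Proof.
move=> pq sp; have [p0|p0] := eqVneq p 0.
  rewrite p0 eqxx in pq; exists (0, 1); rewrite ?inE ?eqxx //= p0.
  exact: plane_slope0.
rewrite plane_slope1 //; have [q0|q0] := eqVneq q 0.
  by exists (1, 0); rewrite ?inE ?eqxx ?orbT //= q0 mul0r.
exists (1, q / p) => //; rewrite !inE; apply/or3P/Or33/mapP; exists (q / p) => //.
move: sp; rewrite /splits mulf_eq0 (negPf p0) (negPf q0) => /eqP.
exact: root_slope.
Qed.

Lemma plane1_inj : injective (plane E 1).
Proof.
move=> r s /eqP; rewrite eq_plane // ?oner_eq0 // mulr1 mul1r => /andP[_ /eqP //].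
Qed.

Lemma slope_planes_uniq (ts : seq K) : uniq ts -> 0 \notin ts ->
  uniq [:: plane E 0 1, plane E 1 0 & [seq plane E 1 r | r <- ts]].
Proof.
move=> tu t0; rewrite /= inE negb_or -andbA; apply/and4P; split.
- by rewrite eq_plane ?oner_eq0 // mulr1 mul0r oner_eq0 andbF.
- by apply/mapP => -[r _ /eqP]; rewrite eq_plane ?oner_eq0 // mulr1 mul0r oner_eq0 andbF.
- apply/mapP => -[r rt /plane1_inj e]; by rewrite e rt in t0.
- by rewrite map_inj_uniq //; exact: plane1_inj.
Qed.

Lemma map_split_slopes : [seq plane E x.1 x.2 | x <- split_slopes] =
  [:: plane E 0 1, plane E 1 0 & [seq plane E 1 r | r <- rs]].
Proof. by rewrite /= -map_comp. Qed.

Lemma special_triplets : triplets_in_planes f l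
  [:: plane E 0 1, plane E 1 0 & [seq plane E 1 r | r <- rs]].
Proof.
rewrite -map_split_slopes; apply: (triplets_of_slopes ch2 ch3 om2 om1 hE hl dl fE smooth).
- exact: split_slopesP.
- exact: split_slopes_complete.
- by rewrite map_split_slopes slope_planes_uniq.
Qed.

Lemma singular_fiber_slope p q : (p != 0) || (q != 0) ->
  splits ga G p q || (bquartic G p q == 0) -> singular_fiber f l (plane E p q).
Proof.
by move=> pq h; apply/(singular_fiberP ch2 ch3 hE fE smooth hl); exists p, q.
Qed.

Lemma slope_splits r : r \in rs -> splits ga G 1 r.
Proof.
by move=> rr; case: (@split_slopesP (1, r)) => //; rewrite !inE (map_f (pair 1)) ?orbT.
Qed.

Lemma fibration_type_6IV : ga = 0 -> fibration_type f l (nseq 6 IV).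
Proof.
move=> g0; exists [:: plane E 0 1, plane E 1 0 & [seq plane E 1 r | r <- rs]].
have slope x : x \in split_slopes -> fiber_type f l (plane E x.1 x.2) IV.
  move=> /split_slopesP[pq sp].
  by apply: (fiber_type_IV ch2 ch3 hE fE smooth hl om2 om1) => //; rewrite g0 mul0r.
split.
- exact: slope_planes_uniq.
- by rewrite /= size_map rs_size.
- move=> H; rewrite -map_split_slopes; split=> [/mapP[x xs ->]|].
    by have [pq sp] := split_slopesP xs; apply: singular_fiber_slope => //; rewrite sp.
  move=> /(singular_fiberP ch2 ch3 hE fE smooth hl)[p [q [pq -> sp]]].
  have sp' : splits ga G p q.
    case/orP: sp => // /eqP Gpq; rewrite /splits bquartic_split_form Gpq g0.
    by rewrite expr0n /= mul0r addr0 eqxx orbT.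
  by have [x xs ->] := split_slopes_complete pq sp'; apply: (map_f (fun x => plane E x.1 x.2)).
- move=> i i6; rewrite -map_split_slopes nth_nseq i6 (nth_map (0, 0)).
    by apply/slope/mem_nth; rewrite /= size_map rs_size.
  by rewrite /= size_map rs_size.
Qed.

(** The fibres over the roots of G are nodal.  These roots are not among those of
    split_form, from which G differs by ga^3 c^2 d^2. *)
Lemma fibration_type_I3_I1 : ga != 0 ->
  fibration_type f l (nseq 2 IV ++ nseq 4 I3 ++ nseq 4 I1).
Proof.
move=> g0; have [ss [ss_size ss_uniq ss0 ssE]] := constant_term_roots ch2 ch3 hE fE smooth.
have G1 s : s \in ss -> bquartic G 1 s = 0.
  by move=> sss; rewrite ssE (big_rem s) //= mulr1 subrr mul0r mulr0.
have Gsplit r : r != 0 -> bquartic G 1 r = 0 -> bquartic (split_form ga G) 1 r != 0.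
  by move=> r0 e; rewrite bquartic_split_form e add0r expr1n mul1r mulf_neq0 ?expf_neq0.
have disj : ~~ has (mem rs) ss.
  apply/hasPn => s sss; apply/negP => srs.
  have s0 : s != 0 by apply: contraNneq ss0 => <-.
  have := Gsplit s s0 (G1 s sss); rewrite rsE (big_rem s) //= mulr1 subrr mul0r mulr0.
  by rewrite eqxx.
exists [:: plane E 0 1, plane E 1 0 & [seq plane E 1 r | r <- rs ++ ss]].
split.
- apply: slope_planes_uniq; first by rewrite cat_uniq rs_uniq ss_uniq disj.
  by rewrite mem_cat negb_or rs0 ss0.
- by rewrite /= size_map size_cat rs_size ss_size.
- have mem H : (H \in [:: plane E 0 1, plane E 1 0 & [seq plane E 1 r | r <- rs ++ ss]]) =
      (H \in [seq plane E x.1 x.2 | x <- split_slopes]) || (H \in [seq plane E 1 r | r <- ss]).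
    by rewrite map_split_slopes map_cat !inE mem_cat !orbA.
  move=> H; rewrite mem; split=> [/orP[/mapP[x xs ->]|/mapP[s sss ->]]|].
  + by have [pq sp] := split_slopesP xs; apply: singular_fiber_slope => //; rewrite sp.
  + by apply: singular_fiber_slope; rewrite ?oner_eq0 // G1 // eqxx orbT.
  move=> /(singular_fiberP ch2 ch3 hE fE smooth hl)[p [q [pq -> /orP[sp|/eqP Gpq]]]].
    by have [x xs ->] := split_slopes_complete pq sp; rewrite (map_f (fun x => plane E x.1 x.2)).
  have [p0|p0] := eqVneq p 0.
    have sp : splits ga G p q by rewrite /splits p0 mul0r eqxx.
    by have [x xs ->] := split_slopes_complete pq sp; rewrite (map_f (fun x => plane E x.1 x.2)).
  by apply/orP; right; rewrite plane_slope1 //; apply/map_f/(root_slope p0 ssE).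
move=> i i10.
case: i i10 => [|[|i]] i10.
- by apply: (fiber_type_IV ch2 ch3 hE fE smooth hl om2 om1);
    rewrite ?oner_eq0 ?orbT // /splits mul0r ?mulr0 ?eqxx.
- by apply: (fiber_type_IV ch2 ch3 hE fE smooth hl om2 om1);
    rewrite ?oner_eq0 ?orbT // /splits mulr0 ?mulr0 ?eqxx.
rewrite /= (nth_map 0); last by rewrite size_cat rs_size ss_size.
have ti : nth IV [:: I3; I3; I3; I3; I1; I1; I1; I1] i = if (i < 4)%N then I3 else I1.
  by move: i10; do 8! (case: i => [//|i]).
rewrite ti nth_cat rs_size; case: ifP => i4.
  have rr : nth 0 rs i \in rs by rewrite mem_nth // rs_size.
  apply: (fiber_type_I3 ch2 ch3 hE fE smooth hl om2 om1); rewrite ?oner_eq0 ?slope_splits //.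
  by apply: contraNneq rs0 => <-.
have i44 : (i - 4 < 4)%N by rewrite ltn_subLR // leqNgt i4.
have sss : nth 0 ss (i - 4) \in ss by rewrite mem_nth // ss_size.
set s := nth 0 ss (i - 4) in sss *; have s0 : s != 0 by apply: contraNneq ss0 => <-.
exists (frame E 1 s), (special_fiber ga G 1 s); split.
  by apply: (special_plane_fiber hE fE hl); rewrite oner_eq0.
rewrite /special_fiber G1 //; have b0 : 3%:R * ga * (1 * s) != 0.
  by rewrite mul1r !mulf_neq0.
split; first exact: (irreducible_nodal_hesse (oner_neq0 K) s0 b0).
by exists (row3 0 0 1); exact: node_nodal_hesse.
Qed.

(** Both types list the same planes. *)
Lemma fibration_type_size (t t' : seq kodaira) :
  fibration_type f l t -> fibration_type f l t' -> size t = size t'.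
Proof.
case=> s [us <- sE _] [s' [us' <- sE' _]]; apply: perm_size.
by apply: uniq_perm => // H; apply/idP/idP => h; [apply/sE'/sE | apply/sE/sE'].
Qed.

(** Each of the four conditions decides whether ga vanishes: there are six or ten
    singular fibres, and a twisted cubic spans the space while a line does not. *)
Lemma fibration_types_singular_locus :
  (fibration_type f l (nseq 2 IV ++ nseq 4 I3 ++ nseq 4 I1) <->
     is_twisted_cubic (singular_point (ruled_quartic E ga))) /\
  (fibration_type f l (nseq 6 IV) <-> is_line (singular_point (ruled_quartic E ga))).
Proof.
have [g0|g0] := eqVneq ga 0.
  have t6 := fibration_type_6IV g0; have ln := singular_line hE ch2 ch3 g0.
  split; split=> // [h|tc]; first by have := fibration_type_size h t6.
  by case: (line_not_twisted_cubic ch2 ln tc).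
have t10 := fibration_type_I3_I1 g0; have tc := singular_twisted_cubic hE ch2 ch3 g0.
split; split=> // [h|ln]; first by have := fibration_type_size h t10.
by case: (line_not_twisted_cubic ch2 ln tc).
Qed.

End SegreQuartic.

(** * The line of the second kind with ramification 2 P1 + 2 P2 *)

Theorem corollary7p5 (K : closedFieldType) (f : {mpoly K[4]})
    (l : {vspace 'rV[K]_4}) (P1 P2 : 'rV[K]_4) :
  2%N \notin [pchar K] -> 3%N \notin [pchar K] ->
  f \is 4.-homog -> smooth_hypersurface f ->
  \dim l = 2%N -> subset_hypersurface l f ->
  second_kind f l ->
  P1 \in l -> P1 != 0 -> P2 \in l -> P2 != 0 -> <[P1]>%VS != <[P2]>%VS ->
  ramification_divisor f l
    (fun P => 2 * (<[P]>%VS == <[P1]>%VS) + 2 * (<[P]>%VS == <[P2]>%VS))%N ->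
  (segre_construction f l <->
     exists H1 H2 : {vspace 'rV[K]_4},
       [/\ H1 != H2, IV_fiber_singular_on f l H1 & IV_fiber_singular_on f l H2])
  /\
  (segre_construction f l ->
     exists (S4 : {mpoly K[4]}) (L : 4.-tuple 'cV[K]_4),
       [/\ (* i *)
           [/\ S4 \is 4.-homog, ruled_surface S4
             & reduced_surface (surface_S8 f l) 6
                 (linform (gradient f P1) * linform (gradient f P2) * S4)],
           (* ii *)
           (let planes := [:: tangent_space f P1, tangent_space f P2
                            & [seq hyperplane c | c <- L]] in
            uniq planes /\ triplets_in_planes f l planes),
           (* iii *)
           (exists2 lambda : K, lambda != 0 &
              segre_decomposition f l (lambda *: S4) L) /\
           (forall S Lhat, segre_decomposition f l S Lhat ->
              (exists2 a : K, a != 0 & S = a *: S4) /\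
              [seq hyperplane c | c <- Lhat] =i [seq hyperplane c | c <- L])
         & (* iv *)
           (fibration_type f l (nseq 2 IV ++ nseq 4 I3 ++ nseq 4 I1) <->
              is_twisted_cubic (singular_point S4)) /\
           (fibration_type f l (nseq 6 IV) <-> is_line (singular_point S4))]).
Proof.
move=> ch2 ch3 hf smooth dl lf sk P1l P1n P2l P2n P12 ram.
have nat_neq0 p : prime p -> p \notin [pchar K] -> p%:R != 0 :> K.
  by move=> pp; rewrite inE pp.
have c2 : 2%:R != 0 :> K by apply: nat_neq0.
have c3 : 3%:R != 0 :> K by apply: nat_neq0.
have r1 : ramification_index f l P1 3.
  by have := ram _ P1l P1n; rewrite eqxx (negPf P12).
have r2 : ramification_index f l P2 3.
  by have := ram _ P2l P2n; rewrite eqxx eq_sym (negPf P12).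
have [E [B [G [[hE e1 e2 hl] fE]]]] :=
  second_kind_normal_form c2 c3 hf dl lf P1l P1n P2l P2n P12 r1 r2 sk.
have [om [om2 om1]] := primitive_cube_root ch3.
pose ga := B 1%N / 3%:R.
have special : B 0%N = 0 -> B 2%N = 0 -> forall a b c d, f.@[(pt E a b c d) 0]
    = c * a ^+ 3 + d * b ^+ 3 + 3%:R * ga * (a * b * (c * d)) + bquartic G c d.
  move=> B0 B2 a b c d; rewrite fE /bquad B0 B2 (_ : 3%:R * ga = B 1%N); first by ring.
  by rewrite mulrC divfK.
have segre_B : segre_construction f l -> B 0%N = 0 /\ B 2%N = 0.
  case=> S [L dec]; have [a [h [_ _ _ rel]]] := segre_relation hE hl fE dec.
  by have [B0 B2 _] := segre_coefficients c3 rel.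
have main : B 0%N = 0 -> B 2%N = 0 -> exists rs (L : 4.-tuple 'cV[K]_4),
    [/\ [/\ size rs = 4%N, uniq rs, 0 \notin rs & forall c d,
          bquartic (split_form ga G) c d = G 4%N * \prod_(r <- rs) (d - r * c)],
        forall c, c \in L -> c != 0,
        [seq hyperplane c | c <- L] = [seq plane E 1 r | r <- rs],
        (\bigcap_(c <- L) hyperplane c)%VS = l
      & forall a b c d, \prod_(u <- L) dot (pt E a b c d) u = bquartic (split_form ga G) c d].
  move=> B0 B2; have fS := special B0 B2.
  have [rs [rs1 rs2 rs3 rs4]] := split_roots c2 c3 hE fS smooth.
  have [L [L1 L2 L3 L4]] := segre_planes c2 c3 hE hl fS smooth rs1 rs2 rs4.
  by exists rs, L.
split.
  split=> [/segre_B[B0 B2]|[H1 [H2 [H12 IV1 IV2]]]].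
    have IVf := ramified_IV_fiber c2 c3 hE (special B0 B2) smooth hl om2 om1.
    exists (plane E 0 1), (plane E 1 0); split.
    - by rewrite eq_plane ?oner_eq0 // mulr1 mul0r oner_eq0 andbF.
    - by apply: IVf; rewrite ?oner_eq0 ?orbT ?mul0r.
    - by apply: IVf; rewrite ?oner_eq0 ?mulr0.
  have [B0 B2] := two_IV_fibers c3 hE hl fE H12 IV1 IV2.
  have [rs [L [_ L1 _ L3 L4]]] := main B0 B2.
  exists (1 *: ruled_quartic E ga), L.
  exact: (special_is_segre c2 om2 hE hl (special B0 B2) L1 L3 L4).
move=> /segre_B[B0 B2]; have fS := special B0 B2.
have [rs [L [[rs1 rs2 rs3 rs4] L1 L2 L3 L4]]] := main B0 B2.
exists (ruled_quartic E ga), L; rewrite e1 e2; split.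
- split; [exact: ruled_quartic_homog | exact: (ruled_quartic_ruled ga hE om2) |].
  exact: (reduced_surface_S8 c3 om2 hE hl fS).
- rewrite L2 (tangent_P1 hE fS) (tangent_P2 hE fS) /=; split.
    exact: slope_planes_uniq.
  exact: (special_triplets c2 c3 om2 om1 hE hl dl fS smooth rs2 rs3 rs4).
- split; last exact: (segre_unique c3 hE hl fS L1 L4).
  exists 1; first exact: oner_neq0.
  exact: (special_is_segre c2 om2 hE hl fS L1 L3 L4).
- exact: (fibration_types_singular_locus c2 c3 om2 om1 hE hl fS smooth rs1 rs2 rs3 rs4).
Qed.
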